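(* There exists $\varepsilon_0>0$ such that for every free group $\mathbb{F}_n$ on $n$ generators ($n\ge1$ an integer or $n=\infty$), every finite real number $q\ge 4-\varepsilon_0$ and every $t>0$, $$\|P_t\|_{2\to q}\le 1\quad\Longleftrightarrow\quad t\ge\log\sqrt{q-1},$$ where $(P_t)_{t>0}$ is the Poisson semigroup on the group von Neumann algebra of $\mathbb{F}_n$ associated with the natural length function of $\mathbb{F}_n$.
   Context: For a discrete group $G$ with identity $e$, $\lambda$ is the left regular representation on $\ell_2(G)$, $vN(G)=\lambda(G)''\subset B(\ell_2(G))$ is the group von Neumann algebra, equipped with the canonical trace $\tau(x)=\langle x\delta_e,\delta_e\rangle$ where $\delta_e\in\ell_2(G)$ is the basis vector at $e$, and $\mathbb{C}[G]$ denotes the finite linear combinations of the $\lambda(g)$, $g\in G$. $L_p(vN(G))$ is the noncommutative $L_p$-space of $(vN(G),\tau)$, with norm $\|x\|_p=\tau(|x|^p)^{1/p}$. Let $|g|$ denote the length of the reduced word $g\in\mathbb{F}_n$ with respect to the free generators and their inverses. For $t>0$, $P_t$ is the linear map defined on $\mathbb{C}[\mathbb{F}_n]$ by $$P_t\Big(\sum_{g}x(g)\lambda(g)\Big)=\sum_{g}e^{-t|g|}x(g)\lambda(g),$$ and it extends to a contraction on $L_p(vN(\mathbb{F}_n))$ for all $1\le p\le\infty$. The quantity $\|P_t\|_{2\to q}$ is the norm of $P_t$ from $L_2(vN(\mathbb{F}_n))$ to $L_q(vN(\mathbb{F}_n))$, i.e. the supremum of $\|P_t(x)\|_q$ over $x\in\mathbb{C}[\mathbb{F}_n]$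 with $\|x\|_2\le1$ (possibly $+\infty$). *)

(* Defs.v *)
From HB Require Import structures.
From mathcomp Require Import all_boot all_order all_algebra.
From mathcomp Require Import finmap.
From mathcomp Require Import complex ring.
From mathcomp Require Import all_classical all_reals all_analysis.

Set Implicit Arguments.
Unset Strict Implicit.
Unset Printing Implicit Defensive.

Import Order.TTheory GRing.Theory Num.Theory.
Local Open Scope ring_scope.

(* The free group on [I]: a letter [(i, b)] is the generator [i] if [b] is true
   and its inverse otherwise; elements are the reduced words, multiplied by
   concatenation followed by cancellation. *)
Section FreeGroup.
Variable I : choiceType.
Local Notation letter := (I * bool)%type.

Definition linv (a : letter) : letter := (a.1, ~~ a.2).

Definition reduced (w : seq letter) : bool :=
  sorted (fun a b => b != linv a) w.

Definition lcons (a : letter) (w : seq letter) : seq letter :=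
  if w is b :: w' then if b == linv a then w' else a :: w else [:: a].

Definition wmul (u v : seq letter) : seq letter := foldr lcons v u.
Definition winv (u : seq letter) : seq letter := rev (map linv u).

Lemma linvK : involutive linv.
Proof. by case=> i b; rewrite /linv /= negbK. Qed.

Lemma linv_neq a : linv a != a.
Proof. by case: a => i b; apply/eqP => -[]; case: b. Qed.

Lemma reduced_behead a w : reduced (a :: w) -> reduced w.
Proof. by case: w => //= b w /andP[]. Qed.

Lemma lcons_reduced a w : reduced w -> reduced (lcons a w).
Proof.
case: w => [//|b w] wP /=; case: ifPn => [_|ba]; first exact: reduced_behead wP.
by rewrite /reduced /= ba.
Qed.

Lemma lconsE a w : reduced (a :: w) -> lcons a w = a :: w.
Proof. by case: w => //= b w; rewrite /reduced /= => /andP[/negbTE ->]. Qed.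

Lemma lconsK a w : reduced w -> lcons a (lcons (linv a) w) = w.
Proof.
case: w => [|b w] wP; first by rewrite /= eqxx.
rewrite [lcons (linv a) _]/= linvK; case: eqP => [ba|_]; last by rewrite /= eqxx.
by subst b; rewrite lconsE.
Qed.

Lemma wmul_reduced u v : reduced v -> reduced (wmul u v).
Proof. by move=> vP; elim: u => //= a u IH; exact: lcons_reduced. Qed.

Lemma wmul_lcons a v w : reduced v -> reduced w ->
  wmul (lcons a v) w = lcons a (wmul v w).
Proof.
case: v => [//|b v] vP wP /=; case: eqP => [->|//].
by rewrite lconsK// wmul_reduced.
Qed.

Lemma wmulA u v w : reduced v -> reduced w ->
  wmul u (wmul v w) = wmul (wmul u v) w.
Proof.
move=> vP wP; elim: u => //= a u ->.
by rewrite wmul_lcons// wmul_reduced.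
Qed.

Lemma wmulw0 u : reduced u -> wmul u [::] = u.
Proof.
elim: u => //= a u IH uP; rewrite IH ?(reduced_behead uP)//; exact: lconsE.
Qed.

Lemma winv_reduced u : reduced u -> reduced (winv u).
Proof.
rewrite /reduced /winv rev_sorted sorted_map; apply: sub_sorted => a b.
by apply: contra_neq => /(inv_inj linvK) ->; rewrite linvK.
Qed.

Lemma wmulV_aux u w : reduced w -> wmul (winv u) (wmul u w) = w.
Proof.
elim: u w => //= a u IH w wP.
rewrite /winv /= rev_cons /wmul foldr_rcons -/(wmul _ _) -/(wmul u w).
have := @lconsK (linv a) (wmul u w); rewrite linvK => ->; first exact: IH.
exact: wmul_reduced.
Qed.

Record freegroup := FreeGroup {
  fgword :> seq letter;
  fgwordP : reduced fgword }.

HB.instance Definition _ := [isSub for fgword].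
HB.instance Definition _ := [Choice of freegroup by <:].

Definition fgmul (u v : freegroup) : freegroup :=
  FreeGroup (wmul_reduced u (fgwordP v)).
Definition fginv (u : freegroup) : freegroup :=
  FreeGroup (winv_reduced (fgwordP u)).
Definition fgone : freegroup := @FreeGroup [::] isT.

Lemma fgmulA : associative fgmul.
Proof. by move=> u v w; apply: val_inj; rewrite /= wmulA// fgwordP. Qed.
Lemma fgmul1 : left_id fgone fgmul.
Proof. by move=> u; apply: val_inj. Qed.
Lemma fgmulr1 : right_id fgone fgmul.
Proof. by move=> u; apply: val_inj; rewrite /= wmulw0// fgwordP. Qed.
Lemma fgmulV : left_inverse fgone fginv fgmul.
Proof.
move=> u; apply: val_inj => /=.
by rewrite -[in X in wmul _ X](wmulw0 (fgwordP u)) wmulV_aux.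
Qed.
Lemma fgmulrV : right_inverse fgone fginv fgmul.
Proof.
move=> u; rewrite -[LHS]fgmul1 -{1}(fgmulV (fginv u)) -fgmulA.
by rewrite [fgmul (fginv u) _]fgmulA fgmulV fgmul1 fgmulV.
Qed.

HB.instance Definition _ := isGroup.Build freegroup
  fgmulA fgmul1 fgmulr1 fgmulV fgmulrV.

End FreeGroup.

(* [None] stands for n = oo *)
Definition gens (n : option nat) : choiceType :=
  if n is Some m then 'I_m : choiceType else nat : choiceType.

Definition fglen (I : choiceType) (g : freegroup I) : nat := size (fgword g).

Definition freegrp (n : option nat) : groupType := freegroup (gens n).

Section L2.
Variables (R : realType) (G : groupType).
Local Notation C := (R[i]).
Local Open Scope complex_scope.

Definition normsq (z : C) : R := complex.Re z ^+ 2 + complex.Im z ^+ 2.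

Definition l2sq (f : G -> C) : \bar R :=
  (\esum_(g in [set: G]) (normsq (f g))%:E)%E.

Definition l2pred : {pred G -> C} := [pred f | (l2sq f < +oo)%E].

Lemma normsq_ge0 z : 0 <= normsq z.
Proof. by rewrite addr_ge0// sqr_ge0. Qed.

Lemma normsqD z w : normsq (z + w) <= 2 * normsq z + 2 * normsq w.
Proof.
case: z w => [a b] [c d]; rewrite /normsq /= -subr_ge0.
have -> : 2 * (a ^+ 2 + b ^+ 2) + 2 * (c ^+ 2 + d ^+ 2) -
   ((a + c) ^+ 2 + (b + d) ^+ 2) = (a - c) ^+ 2 + (b - d) ^+ 2 :> R by ring.
by rewrite addr_ge0// sqr_ge0.
Qed.

Lemma normsqM z w : normsq (z * w) = normsq z * normsq w.
Proof. by case: z w => [a b] [c d]; rewrite /normsq /=; ring. Qed.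

Lemma l2sq_ge0 f : (0 <= l2sq f)%E.
Proof. by apply: esum_ge0 => g _; rewrite lee_fin normsq_ge0. Qed.

Lemma le_esumZ (c : R) (u : G -> \bar R) : 0 <= c -> (forall g, 0 <= u g)%E ->
  (\esum_(g in [set: G]) (c%:E * u g) <= c%:E * \esum_(g in [set: G]) u g)%E.
Proof.
move=> c0 u0; apply: ge_ereal_sup => _ [X [finX _] <-].
rewrite -ge0_mule_fsumr//; apply: lee_pmul => //; first exact: fsume_ge0.
by apply: esum_ge; exists X.
Qed.

Lemma l2sqD f h : (l2sq (f + h)%R <= 2%:E * l2sq f + 2%:E * l2sq h)%E.
Proof.
have P (k : G -> C) g : (0 <= (normsq (k g))%:E)%E by rewrite lee_fin normsq_ge0.
apply: (@le_trans _ _ (\esum_(g in [set: G])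
    (2%:E * (normsq (f g))%:E + 2%:E * (normsq (h g))%:E))%E).
  by apply: le_esum => g _; rewrite -!EFinM -EFinD lee_fin; exact: normsqD.
by rewrite esumD => [|g _|g _]; rewrite ?mule_ge0// leeD// le_esumZ.
Qed.

Lemma l2sqZ c f : (l2sq (c *: f)%R <= (normsq c)%:E * l2sq f)%E.
Proof.
apply: le_trans (le_esumZ (normsq_ge0 c) _) => [|g]; last first.
  by rewrite lee_fin normsq_ge0.
by apply: le_esum => g _; rewrite -EFinM lee_fin -normsqM.
Qed.

Lemma l2pred_submod : submod_closed l2pred.
Proof.
split=> [|c f h].
  rewrite inE /l2sq esum1 ?ltry// => g _.
  by rewrite /normsq /= expr0n addr0.
rewrite !inE => fP hP; apply: le_lt_trans (l2sqD _ _) _.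
rewrite lte_add_pinfty// lte_mul_pinfty// ?l2sq_ge0//.
apply: le_lt_trans (l2sqZ _ _) _.
by rewrite lte_mul_pinfty// ?l2sq_ge0// lee_fin normsq_ge0.
Qed.

HB.instance Definition _ := GRing.isSubmodClosed.Build C (G -> C) l2pred
  l2pred_submod.

Record l2 := L2 { l2val :> G -> C; l2valP : l2val \in l2pred }.
HB.instance Definition _ := [isSub for l2val].
HB.instance Definition _ := [Choice of l2 by <:].
HB.instance Definition _ := [SubChoice_isSubLmodule of l2 by <:].

Definition l2norm (f : l2) : R := Num.sqrt (fine (l2sq f)).

Lemma l2sq_fin (f : l2) : l2sq f \is a fin_num.
Proof. by rewrite ge0_fin_numE ?l2sq_ge0//; have := l2valP f; rewrite inE. Qed.

Lemma l2norm_ge0 f : 0 <= l2norm f.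
Proof. exact: sqrtr_ge0. Qed.

Lemma l2norm_sqr f : l2norm f ^+ 2 = fine (l2sq f).
Proof. by rewrite sqr_sqrtr// fine_ge0// l2sq_ge0. Qed.

Lemma l2normD f h : l2norm (f + h) <= 2 * l2norm f + 2 * l2norm h.
Proof.
have f0 := l2norm_ge0 f; have h0 := l2norm_ge0 h.
have fh0 : 0 <= 2 * l2norm f + 2 * l2norm h by rewrite addr_ge0// mulr_ge0.
rewrite -(@ler_pXn2r _ 2)// ?nnegrE ?l2norm_ge0//.
apply: (@le_trans _ _ (2 * l2norm f ^+ 2 + 2 * l2norm h ^+ 2)).
  rewrite !l2norm_sqr -lee_fin EFinD !EFinM !fineK ?l2sq_fin//.
  exact: l2sqD.
rewrite -subr_ge0.
have -> : (2 * l2norm f + 2 * l2norm h) ^+ 2 -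
  (2 * l2norm f ^+ 2 + 2 * l2norm h ^+ 2) =
  2 * l2norm f ^+ 2 + 2 * l2norm h ^+ 2 + 8 * (l2norm f * l2norm h) by ring.
by rewrite !addr_ge0 ?mulr_ge0// sqr_ge0.
Qed.

Lemma l2normZ c f : l2norm (c *: f) <= Num.sqrt (normsq c) * l2norm f.
Proof.
rewrite -sqrtrM ?normsq_ge0// ler_wsqrtr// -lee_fin EFinM !fineK ?l2sq_fin//.
exact: l2sqZ.
Qed.

(* sum over G of an absolutely summable family of reals *)
Definition rsum (u : G -> R) : R :=
  fine (\esum_(g in [set: G]) (Num.max (u g) 0)%:E
      - \esum_(g in [set: G]) (Num.max (- u g) 0)%:E)%E.

Definition dot (f h : l2) : C :=
  (rsum (fun g => complex.Re (f g * (h g)^*))) +i*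
  (rsum (fun g => complex.Im (f g * (h g)^*))).

Lemma delta_subproof (g : G) : (fun h => (h == g)%:R : C) \in l2pred.
Proof.
rewrite inE /l2sq.
rewrite (@eq_esum _ _ _ _ (fun i => if i \in [set g]%classic then 1%E else 0%E)).
  by rewrite -esum_mkcond esum_set1// ltry.
move=> h _; have [->|/eqP hg] := eqVneq h g.
  by rewrite mem_set// /normsq /= expr1n expr0n addr0.
by rewrite memNset// /normsq /= expr0n addr0.
Qed.

Definition delta (g : G) : l2 := L2 (delta_subproof g).

(* bounded operators on l2 G *)
Record bop := Bop {
  bfun :> {linear l2 -> l2};
  bfun_bounded : exists M : R, forall f, l2norm (bfun f) <= M * l2norm f }.

HB.instance Definition _ := gen_eqMixin bop.
HB.instance Definition _ := gen_choiceMixin bop.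

Lemma bop0_subproof :
  exists M : R, forall f, l2norm ((\0 : {linear l2 -> l2}) f) <= M * l2norm f.
Proof.
exists 0 => f; rewrite mul0r /l2norm (_ : l2sq _ = 0%E) ?sqrtr0//.
rewrite /l2sq esum1// => g _.
by rewrite /normsq /= expr0n addr0.
Qed.
Definition bop0 : bop := Bop bop0_subproof.

Lemma bcomp_subproof (S T : bop) :
  exists M : R, forall f,
    l2norm ((bfun S \o bfun T : {linear l2 -> l2}) f) <= M * l2norm f.
Proof.
have [M SM] := bfun_bounded S; have [N TN] := bfun_bounded T.
exists (`|M| * `|N|) => f /=; apply: le_trans (SM _) _.
apply: (@le_trans _ _ (`|M| * l2norm (T f))).
  by rewrite ler_wpM2r ?l2norm_ge0 ?ler_norm.
rewrite -mulrA ler_wpM2l//; apply: le_trans (TN _) _.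
by rewrite ler_wpM2r ?l2norm_ge0 ?ler_norm.
Qed.
Definition bcomp (S T : bop) : bop := Bop (bcomp_subproof S T).

Definition opnorm (T : l2 -> l2) : R :=
  sup [set l2norm (T f) | f in [set f | l2norm f <= 1]]%classic.

(* The adjoint exists and is unique, so that bop0 is never used as a default
   value; likewise in [oppow] below. *)
Definition adjoint (T : bop) : bop :=
  xget bop0 [set S : bop | forall f h, dot (T f) h = dot f (S h)]%classic.

Definition polyop (p : {poly R}) (T : l2 -> l2) : l2 -> l2 :=
  fun f => \sum_(i < size p) (p`_i)%:C *: iter i T f.

(* [oppow a r] is a^r (a positive, r > 0) in the continuous functional calculus:
   the norm limit of p_k(a) for polynomials p_k that converge to s |-> s^r
   uniformly on [0, ||a||]. *)
Definition oppow (a : bop) (r : R) : bop :=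
  xget bop0 [set b : bop | forall e : R, 0 < e -> exists p : {poly R},
    (forall s, 0 <= s <= opnorm a -> `|p.[s] - s `^ r| <= e) /\
    opnorm (fun f => polyop p a f - b f) <= e]%classic.

Definition absop (x : bop) : bop := oppow (bcomp (adjoint x) x) 2^-1.

Definition lreg_fun (g : G) (f : G -> C) : G -> C := fun h => f (g^-1 * h)%g.

Lemma l2sq_lreg g f : l2sq (lreg_fun g f) = l2sq f.
Proof.
rewrite /l2sq [RHS](@reindex_esum _ _ _ [set: G]%classic [set: G]%classic
  (fun h => g^-1 * h)%g)//.
split=> // [h k _ _ /mulgI //|h _].
by exists (g * h)%g => //; rewrite mulKg.
Qed.

Lemma lreg_l2 g (f : l2) : lreg_fun g f \in l2pred.
Proof. by rewrite inE l2sq_lreg; have := l2valP f; rewrite inE. Qed.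

Definition lreg_l2fun g (f : l2) : l2 := L2 (lreg_l2 g f).

Lemma lreg_linear g : linear (lreg_l2fun g).
Proof. by move=> c f h; apply: val_inj. Qed.
HB.instance Definition _ g :=
  GRing.isLinear.Build C l2 l2 *:%R (lreg_l2fun g) (lreg_linear g).

Lemma lreg_bounded g :
  exists M : R, forall f, l2norm (lreg_l2fun g f) <= M * l2norm f.
Proof. by exists 1 => f; rewrite mul1r /l2norm l2sq_lreg. Qed.

(* left regular representation *)
Definition lreg (g : G) : bop := @Bop (lreg_l2fun g) (lreg_bounded g).

Definition commutant (S : set bop) : set bop :=
  [set T | forall U, S U -> forall f, T (U f) = U (T f)]%classic.

(* vN(G) = lambda(G)'' *)
Record vN := VN {
  vNop :> bop;
  vNopP : commutant (commutant (range lreg)) vNop }.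

(* canonical trace *)
Definition tau (x : bop) : C := dot (x (delta 1%g)) (delta 1%g).

(* tau(|x|^p)^(1/p); the trace of the positive operator |x|^p is a nonnegative
   real, hence the real part *)
Definition Lpnorm (p : R) (x : vN) : R :=
  (complex.Re (tau (oppow (absop x) p))) `^ p^-1.

(* coefficients (x(g))_g of the elements of C[G] *)
Definition grpalg := {fsfun G -> C with 0}.

Definition lsum_fun (x : grpalg) (f : l2) : l2 :=
  \sum_(g <- finsupp x) x g *: lreg g f.

Lemma lsum_linear x : linear (lsum_fun x).
Proof.
move=> c f h; rewrite /lsum_fun scaler_sumr -big_split /=.
apply: eq_bigr => g _; rewrite linearP scalerDr !scalerA; congr (_ + _).
by rewrite mulrC.
Qed.
HB.instance Definition _ x :=
  GRing.isLinear.Build C l2 l2 *:%R (lsum_fun x) (lsum_linear x).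

Lemma lsum_bounded x :
  exists M : R, forall f, l2norm (lsum_fun x f) <= M * l2norm f.
Proof.
rewrite /lsum_fun; elim: (finsupp x : seq G) => [|g r [M IH]].
  by have [M MP] := bop0_subproof; exists M => f; rewrite big_nil; exact: MP.
exists (2 * Num.sqrt (normsq (x g)) + 2 * M) => f; rewrite big_cons.
apply: le_trans (l2normD _ _) _; rewrite [leRHS]mulrDl -!mulrA lerD// ler_wpM2l//.
by apply: le_trans (l2normZ _ _) _; rewrite /l2norm l2sq_lreg.
Qed.

Definition lsum_bop (x : grpalg) : bop := @Bop (lsum_fun x) (lsum_bounded x).

Lemma lsum_vN x : commutant (commutant (range lreg)) (lsum_bop x).
Proof.
move=> U UP f /=; rewrite /lsum_fun linear_sum; apply: eq_bigr => g _ /=.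
by rewrite linearZ (UP (lreg g))//; exists g.
Qed.

(* sum_g x(g) lambda(g) *)
Definition lsum (x : grpalg) : vN := VN (lsum_vN x).

(* the norm L_2(vN(G)) -> L_q(vN(G)) of a linear map T of C[G], which is dense
   in L_2(vN(G)) *)
Definition norm2to (q : R) (T : grpalg -> grpalg) : \bar R :=
  ereal_sup [set (Lpnorm q (lsum (T x)))%:E |
              x in [set x | Lpnorm 2 (lsum x) <= 1]]%classic.

End L2.

Definition Poisson (R : realType) (n : option nat) (t : R)
    (x : grpalg R (freegrp n)) : grpalg R (freegrp n) :=
  [fsfun g in finsupp x => (expR (- (t * (fglen g)%:R)))%:C%C * x g].

(* Main.v *)
(* Let z = P_t x with |x|_2 <= 1, y = z^* z, p = q / 2, X = exp(-2t) = 1 / (q - 1),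
   and let Y_D be the L_2 norm of the part of y on words of length D.
   Haagerup's inequality bounds Y_D by a convolution of the L_2 norms of the
   length parts of x.  Minkowski's inequality over the number of cancelled letters
   and Cauchy-Schwarz over the pairs of remaining lengths a + b = D then give
     tau(y)^2 + (p - 1) Y_1^2 + sum_(D >= 2) sigma_D Y_D^2 <= 1,
   with sigma_D = (1 - X)^2 / ((D + 1) X^D) >= (p - 1)^D.
   - If 4 - eps0 <= q <= 8, then tau(y^p) is bounded by comparing s^p with a quartic
     polynomial that agrees with it to third order at s = 1.  The third and fourth moments of
     y are again controlled by Haagerup's inequality, and |z|_q <= 1 becomes a
     polynomial inequality in 1 - tau(y), Y_1 and the weighted tail of Y.
   - If it holds for p, it holds for 2p: |z|_(2p)^2 = |y|_p, and y = P_t' z' where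
     exp(2t') = p - 1 and |z'|_2^2 = sum_D (p - 1)^D Y_D^2 <= 1.
   - Conversely the second order expansion of |P_t x|_q at the unit in the direction
     lambda(g) + lambda(g^-1), g a generator, forces (q - 1) exp(-2t) <= 1. *)

(* At the critical time there is no slack on words of length one: perturbing the unit along
   [lambda(g) + lambda(g^-1)] gives equality to second order. So the coefficient [p - 1] of [Y_1^2]
   must be exact, and so must the second order of the polynomial compared with [s^p] at 1. Slack
   exists only in the tail [D >= 2] and in [1 - tau(y)]. At [p = 2] nothing more is needed, since
   [tau(y^2)] is the sum of the [Y_D^2]. Below 2 the comparison costs [2 - p] times terms that are
   quadratically small in [1 - tau(y)] and in the tail. The ratio of this gain to the crude
   constants in the cost is the origin of [eps0]. Doubling needs a whole octave of base cases,
   [4 <= q <= 8], that is [2 <= p <= 4], and a polynomial that dominates [s^p] up to [p = 4] has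
   degree at least 4. *)
From HB Require Import structures.
From mathcomp Require Import all_boot all_order all_algebra.
From mathcomp Require Import finmap.
From mathcomp Require Import complex ring lra zify.
From mathcomp Require Import all_classical all_reals all_analysis.
Require Import Defs.

Set Implicit Arguments.
Unset Strict Implicit.
Unset Printing Implicit Defensive.

Import Order.TTheory GRing.Theory Num.Theory.
Import numFieldNormedType.Exports.
Local Open Scope ring_scope.

Lemma le_of_sqr (R : realDomainType) (a b : R) : 0 <= b -> a ^+ 2 <= b ^+ 2 -> a <= b.
Proof. by move=> b0 ab; rewrite leNgt; apply/negP => ba; nra. Qed.

(** * The Hilbert space l2(G) *)

Section RSum.
Variables (R : realType) (T : groupType).
Implicit Types (u a b : T -> R).

Definition asummable u := (\esum_(g in [set: T]) (`|u g|)%:E < +oo)%E.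

Lemma esum_fin a : (forall g, 0 <= a g) -> asummable a ->
  (\esum_(g in [set: T]) (a g)%:E)%E \is a fin_num.
Proof.
move=> a0; rewrite /asummable => h.
rewrite ge0_fin_numE; last by apply: esum_ge0 => g _; rewrite lee_fin.
apply: le_lt_trans h; apply: le_esum => g _; rewrite lee_fin ler_norm//.
Qed.

(** Any splitting into two nonnegative summable families computes [rsum], not only the one into
    positive and negative parts; additivity follows by adding splittings. *)
Lemma rsum_sub a b : (forall g, 0 <= a g) -> (forall g, 0 <= b g) ->
  asummable a -> asummable b ->
  rsum (fun g => a g - b g) = fine (\esum_(g in [set: T]) (a g)%:E)%E
                            - fine (\esum_(g in [set: T]) (b g)%:E)%E.
Proof.
move=> a0 b0 sa sb; rewrite /rsum -fineB ?esum_fin//; congr fine.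
rewrite -(@esumB _ _ _ (fun g => (a g)%:E) (fun g => (b g)%:E))//.
- congr (_ - _)%E; apply: eq_esum => g _.
    by rewrite funeposE /= EFin_max.
  by rewrite funenegE /= EFin_max.
- by move=> i _; rewrite lee_fin.
- by move=> i _; rewrite lee_fin.
Qed.

Lemma asummable_le u a : (forall g, `|u g| <= a g) -> asummable a -> asummable u.
Proof.
move=> ua; apply: le_lt_trans; apply: le_esum => g _; rewrite lee_fin.
by rewrite (le_trans (ua g))// ler_norm.
Qed.

Lemma asummableD u v : asummable u -> asummable v ->
  asummable (fun g => u g + v g).
Proof.
move=> su sv; apply: le_lt_trans (lte_add_pinfty su sv).
rewrite -esumD => [|g _|g _]; rewrite ?lee_fin//.
by apply: le_esum => g _; rewrite lee_fin ler_normD.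
Qed.

Lemma asummableZ c u : asummable u -> asummable (fun g => c * u g).
Proof.
rewrite /asummable => su; apply: (@le_lt_trans _ _
  ((`|c|)%:E * (\esum_(g in [set: T]) (`|u g|)%:E))%E); last first.
  by rewrite lte_mul_pinfty// lee_fin.
apply: (@le_trans _ _ (\esum_(g in [set: T]) ((`|c|)%:E * (`|u g|)%:E))%E).
  by apply: le_esum => g _; rewrite normrM EFinM.
by apply: le_esumZ => // g; rewrite lee_fin.
Qed.

Lemma asummableN u : asummable u -> asummable (fun g => - u g).
Proof. by rewrite /asummable; under [in X in _ -> X]eq_esum do rewrite normrN. Qed.

Let pos u g := Num.max (u g) 0.
Let neg u g := Num.max (- u g) 0.
Let pos_ge0 u g : 0 <= pos u g. Proof. by rewrite /pos le_max lexx orbT. Qed.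
Let neg_ge0 u g : 0 <= neg u g. Proof. by rewrite /neg le_max lexx orbT. Qed.
Let posneg u g : u g = pos u g - neg u g.
Proof.
by rewrite /pos /neg; case: (leP (u g) 0); case: (leP (- u g) 0); lra.
Qed.
Let spos u : asummable u -> asummable (pos u).
Proof.
move=> su; apply: (@asummable_le _ (fun g => `|u g|)); last first.
  by rewrite /asummable; under eq_esum do rewrite normr_id.
move=> g; rewrite ger0_norm ?pos_ge0// /pos ge_max ler_norm normr_ge0//.
Qed.
Let sneg u : asummable u -> asummable (neg u).
Proof.
move=> su; apply: (@asummable_le _ (fun g => `|u g|)); last first.
  by rewrite /asummable; under eq_esum do rewrite normr_id.
move=> g; rewrite ger0_norm ?neg_ge0// /neg ge_max normr_ge0 -normrN ler_norm//.
Qed.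

Lemma rsum_ge0E a : (forall g, 0 <= a g) ->
  rsum a = fine (\esum_(g in [set: T]) (a g)%:E)%E.
Proof.
move=> a0; rewrite /rsum [X in (_ - X)%E]esum1 ?sube0; last first.
  by move=> g _; rewrite max_r// oppr_le0.
by congr fine; apply: eq_esum => g _; rewrite max_l.
Qed.

Lemma rsumD u v : asummable u -> asummable v ->
  rsum (fun g => u g + v g) = rsum u + rsum v.
Proof.
move=> su sv.
have -> : (fun g => u g + v g) =
  (fun g => (pos u g + pos v g) - (neg u g + neg v g)).
  by apply/funext => g; rewrite {1}(posneg u) {1}(posneg v); ring.
have E w : asummable w -> rsum w =
  fine (\esum_(g in [set: T]) (pos w g)%:E)%E
  - fine (\esum_(g in [set: T]) (neg w g)%:E)%E.
  move=> sw; rewrite -rsum_sub//; [|exact: spos|exact: sneg].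
  by congr rsum; apply/funext => g; rewrite -posneg.
rewrite rsum_sub ?E//; last 4 first.
- by move=> g; rewrite addr_ge0.
- by move=> g; rewrite addr_ge0.
- by apply: asummableD; exact: spos.
- by apply: asummableD; exact: sneg.
have F p q : (forall g, 0 <= p g) -> (forall g, 0 <= q g) -> asummable p ->
  asummable q -> fine (\esum_(g in [set: T]) (p g + q g)%:E)%E =
  fine (\esum_(g in [set: T]) (p g)%:E)%E + fine (\esum_(g in [set: T]) (q g)%:E)%E.
  move=> p0 q0 sp sq; rewrite -fineD ?esum_fin//; congr fine.
  rewrite -esumD => [|g _|g _]; rewrite ?lee_fin//.
rewrite (F (pos u) (pos v)) ?(F (neg u) (neg v)) //; try exact: spos;
  try exact: sneg.
by rewrite opprD addrACA.
Qed.

Lemma rsumN u : asummable u -> rsum (fun g => - u g) = - rsum u.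
Proof.
move=> su; have := @rsumD u (fun g => - u g) su.
have -> : rsum (fun g => u g - u g) = 0.
  rewrite rsum_ge0E => [|g]; last by rewrite subrr.
  by rewrite esum1// => g _; rewrite subrr.
move=> /(_ (asummableN su))/eqP; rewrite eq_sym addrC addr_eq0 => h.
exact/eqP.
Qed.

Lemma rsumZ c u : asummable u -> rsum (fun g => c * u g) = c * rsum u.
Proof.
suff P d a : 0 <= d -> (forall g, 0 <= a g) -> asummable a ->
    rsum (fun g => d * a g) = d * rsum a.
  have Q d w : 0 <= d -> asummable w -> rsum (fun g => d * w g) = d * rsum w.
    move=> d0 sw; have -> : (fun g => d * w g) =
      (fun g => d * pos w g + (-  (d * neg w g))).
      by apply/funext => g; rewrite {1}posneg; ring.
    have sp := spos sw; have sn := sneg sw.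
    rewrite (rsumD (asummableZ d sp) (asummableN (asummableZ d sn))).
    rewrite (rsumN (asummableZ d sn)) (P _ _ d0 (pos_ge0 w) sp).
    rewrite (P _ _ d0 (neg_ge0 w) sn).
    rewrite -mulrBr (rsum_ge0E (pos_ge0 w)) (rsum_ge0E (neg_ge0 w)).
    rewrite -(rsum_sub (pos_ge0 w) (neg_ge0 w) sp sn).
    by congr (_ * rsum _); apply/funext => g; rewrite -posneg.
  move=> su; have [c0|c0] := leP 0 c; first exact: Q.
  have -> : (fun g => c * u g) = (fun g => - ((- c) * u g)).
    by apply/funext => g; ring.
  rewrite rsumN; last exact: asummableZ.
  rewrite Q//; first by ring.
  by rewrite oppr_ge0 ltW.
move=> d0 a0 sa; rewrite !rsum_ge0E//; last by move=> g; rewrite mulr_ge0.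
have fa := esum_fin a0 sa.
rewrite -[d in RHS]/(fine d%:E) -fineM//; congr fine.
apply/eqP; rewrite eq_le; apply/andP; split.
  under eq_esum do rewrite EFinM.
  by apply: le_esumZ => // g; rewrite lee_fin.
have [->|dn0] := eqVneq d 0.
  by rewrite mul0e; apply: esum_ge0 => g _; rewrite mul0r.
have dp : 0 < d by rewrite lt_neqAle eq_sym dn0.
(* [le_esumZ] gives one inequality only; the converse is the same lemma applied to [d^-1]. *)
have h : (\esum_(g in [set: T]) (a g)%:E <=
    (d^-1)%:E * \esum_(g in [set: T]) (d * a g)%:E)%E.
  rewrite [leLHS](_ : _ = \esum_(g in [set: T]) ((d^-1)%:E * (d * a g)%:E))%E.
    by apply: le_esumZ => [|g]; rewrite ?invr_ge0// lee_fin mulr_ge0.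
  by apply: eq_esum => g _; rewrite -EFinM mulrA mulVf// mul1r.
have d0' : (0 <= d%:E)%E by rewrite lee_fin.
apply: le_trans (lee_wpmul2l d0' h) _.
by rewrite muleA -EFinM divff// mul1e.
Qed.

Lemma eq_rsum u v : u =1 v -> rsum u = rsum v.
Proof. by move=> /funext ->. Qed.

Lemma rsum_shift u (g : T) : rsum (fun h => u (g * h)%g) = rsum u.
Proof.
have S (v : T -> R) :  (forall h, 0 <= v h) ->
  (\esum_(h in [set: T]) (v (g * h)%g)%:E = \esum_(h in [set: T]) (v h)%:E)%E.
  move=> v0; rewrite [RHS](@reindex_esum _ _ _ [set: T]%classic [set: T]%classic
    (fun h => g * h)%g)//.
  split=> // [h k _ _ /mulgI //|h _].
  by exists (g^-1 * h)%g => //; rewrite mulVKg.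
rewrite /rsum; congr (fine (_ - _)).
  by rewrite (S (pos u)).
by rewrite (S (neg u)).
Qed.

End RSum.

Section InnerProduct.
Variables (R : realType) (T : groupType).
Local Open Scope complex_scope.
Local Notation C := R[i].
Local Notation l2 := (l2 R T).
Implicit Types (f h k : l2) (c : R).

Lemma l2D f h g : (f + h) g = f g + h g. Proof. by []. Qed.
Lemma l2Z (c : C) f g : (c *: f) g = c * f g. Proof. by []. Qed.
Lemma l2_0 g : (0 : l2) g = 0. Proof. by []. Qed.

Lemma l2_ext f h : (forall g, f g = h g) -> f = h.
Proof. by move=> fh; apply: val_inj; apply/funext. Qed.

(** The real part of [dot]. It determines [dot] (see [dotE]), so the Hilbert space can be handled
    through a real bilinear form. *)
Definition ip f h : R := rsum (fun g => complex.Re (f g * (h g)^*)).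

Lemma asummable_normsq f : asummable (fun g => normsq (f g)).
Proof.
rewrite /asummable.
under eq_esum => g _ do rewrite ger0_norm ?normsq_ge0//.
by have := l2valP f; rewrite inE.
Qed.

Lemma asummable_ip f h : asummable (fun g => complex.Re (f g * (h g)^*)).
Proof.
apply: (asummable_le (a := fun g => normsq (f g) + normsq (h g))); last first.
  by apply: asummableD; exact: asummable_normsq.
move=> g; case: (f g) (h g) => [a b] [a' b']; rewrite /normsq /=.
have h1 := sqr_ge0 (a + a'); have h2 := sqr_ge0 (b + b').
have h3 := sqr_ge0 (a - a'); have h4 := sqr_ge0 (b - b').
rewrite mulrN opprK ler_norml; apply/andP; split; nra.
Qed.

Lemma ipC f h : ip f h = ip h f.
Proof.
apply: eq_rsum => g; case: (f g) (h g) => [a b] [a' b'] /=; lra.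
Qed.

Lemma ipDl f h k : ip (f + h) k = ip f k + ip h k.
Proof.
rewrite /ip -rsumD; try exact: asummable_ip.
by apply: eq_rsum => g; rewrite l2D mulrDl raddfD.
Qed.

Lemma ipZl c f h : ip (c%:C *: f) h = c * ip f h.
Proof.
rewrite /ip -rsumZ; last exact: asummable_ip.
apply: eq_rsum => g; rewrite l2Z.
by case: (f g) (h g) => [a b] [a' b'] /=; ring.
Qed.

Lemma ipZ (c : C) f h : ip (c *: f) h = ip f (c^* *: h).
Proof.
apply: eq_rsum => g; rewrite !l2Z.
by case: c (f g) (h g) => [x y] [a b] [a' b'] /=; ring.
Qed.

Lemma ipNl f h : ip (- f) h = - ip f h.
Proof.
have -> : - f = (-1)%:C *: f by rewrite raddfN /= scaleN1r.
by rewrite ipZl mulN1r.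
Qed.

Lemma ip0l h : ip 0 h = 0.
Proof. by have := ipDl 0 0 h; rewrite addr0 => /eqP; rewrite -subr_eq subrr => /eqP. Qed.

Lemma ip0r h : ip h 0 = 0. Proof. by rewrite ipC ip0l. Qed.

Lemma ipBl f h k : ip (f - h) k = ip f k - ip h k.
Proof. by rewrite ipDl ipNl. Qed.

Lemma ipDr f h k : ip k (f + h) = ip k f + ip k h.
Proof. by rewrite ipC ipDl !(ipC k). Qed.

Lemma ipBr f h k : ip k (f - h) = ip k f - ip k h.
Proof. by rewrite ipC ipBl !(ipC k). Qed.

Lemma ipZr c f h : ip f (c%:C *: h) = c * ip f h.
Proof. by rewrite ipC ipZl ipC. Qed.

Lemma ip_suml (J : Type) (r : seq J) (P : pred J) (F : J -> l2) h :
  ip (\sum_(j <- r | P j) F j) h = \sum_(j <- r | P j) ip (F j) h.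
Proof.
elim/big_rec2: _ => [|j x y _ <-]; first exact: ip0l.
by rewrite ipDl.
Qed.

Lemma ip_sumr (J : Type) (r : seq J) (P : pred J) (F : J -> l2) h :
  ip h (\sum_(j <- r | P j) F j) = \sum_(j <- r | P j) ip h (F j).
Proof. by rewrite ipC ip_suml; apply: eq_bigr => j _; rewrite ipC. Qed.

Lemma ipff f : ip f f = l2norm f ^+ 2.
Proof.
rewrite l2norm_sqr /ip rsum_ge0E.
  congr fine; apply: eq_esum => g _; congr (_%:E).
  by case: (f g) => [a b]; rewrite /normsq /=; ring.
by move=> g; case: (f g) => [a b] /=; nra.
Qed.

Lemma cauchy_schwarz f h : `|ip f h| <= l2norm f * l2norm h.
Proof.
have P f' h' : 0 < l2norm h' -> `|ip f' h'| <= l2norm f' * l2norm h'.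
  move=> h0; set a := ip f' h'; set n := l2norm h'.
  have : 0 <= ip (f' - (a / n ^+ 2)%:C *: h') (f' - (a / n ^+ 2)%:C *: h').
    by rewrite ipff sqr_ge0.
  rewrite ipBl !ipBr !ipZl !ipZr -/a (ipC h' f') -/a !ipff -/n.
  have n0 : n != 0 by rewrite gt_eqF.
  have -> : l2norm f' ^+ 2 - a / n ^+ 2 * a -
     (a / n ^+ 2 * a - a / n ^+ 2 * (a / n ^+ 2 * n ^+ 2)) =
     l2norm f' ^+ 2 - (a / n) ^+ 2 by field.
  rewrite subr_ge0 -[X in X <= _]real_normK ?num_real// ler_pXn2r ?nnegrE ?l2norm_ge0//.
  by rewrite normrM normfV (ger0_norm (l2norm_ge0 h')) ler_pdivrMr.
have := l2norm_ge0 h; rewrite le_eqVlt => /orP[/eqP h0|]; last exact: P.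
have := l2norm_ge0 f; rewrite le_eqVlt => /orP[/eqP f0|f0]; last first.
  by rewrite ipC mulrC; exact: P.
(* Both norms vanish here, and the squares of [f + h] and [f - h] expand to plus and minus twice
   [ip f h]. *)
have := sqr_ge0 (l2norm (f + h)); have := sqr_ge0 (l2norm (f - h)).
rewrite -!ipff ipBl !ipBr ipDl !ipDr !ipff -f0 -h0 (ipC h f) expr0n /= mul0r.
move=> h1 h2; rewrite normr_le0; apply/eqP; lra.
Qed.

Lemma ip_le f h : ip f h <= l2norm f * l2norm h.
Proof. exact: le_trans (ler_norm _) (cauchy_schwarz f h). Qed.

Lemma l2norm_triangle f h : l2norm (f + h) <= l2norm f + l2norm h.
Proof.
apply: le_of_sqr; first by rewrite addr_ge0 ?l2norm_ge0.
rewrite -ipff ipDl !ipDr !ipff (ipC h f); have := ip_le f h; nra.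
Qed.

Lemma l2normZr c f : l2norm (c%:C *: f) = `|c| * l2norm f.
Proof.
apply/eqP; rewrite -(@eqrXn2 _ 2)// ?mulr_ge0 ?l2norm_ge0//.
rewrite -ipff ipZl ipZr ipff exprMn real_normK ?num_real//.
by rewrite mulrA -expr2.
Qed.

Lemma l2normN f : l2norm (- f) = l2norm f.
Proof.
have -> : - f = (-1)%:C *: f by rewrite raddfN /= scaleN1r.
by rewrite l2normZr normrN1 mul1r.
Qed.

Lemma l2norm0 : l2norm (0 : l2) = 0.
Proof. by apply/eqP; rewrite -sqrf_eq0 -ipff ip0l. Qed.

Lemma l2norm_sum (J : Type) (r : seq J) (P : pred J) (F : J -> l2) :
  l2norm (\sum_(j <- r | P j) F j) <= \sum_(j <- r | P j) l2norm (F j).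
Proof.
elim/big_rec2: _ => [|j x y _ h]; first by rewrite l2norm0.
by apply: le_trans (l2norm_triangle _ _) _; rewrite lerD2l.
Qed.

Lemma normsq_le_l2norm f g : normsq (f g) <= l2norm f ^+ 2.
Proof.
rewrite l2norm_sqr -lee_fin fineK ?l2sq_fin// /l2sq.
apply: esum_ge; exists [set g]%classic; first by split.
by rewrite fsbig_set1.
Qed.

Lemma l2norm_eq0 f : l2norm f = 0 -> f = 0.
Proof.
move=> f0; apply: l2_ext => g; rewrite l2_0; have := normsq_le_l2norm f g.
rewrite f0 expr0n /=; case: (f g) => [a b]; rewrite /normsq /= => ab.
have /eqP a0 : a == 0 by rewrite -sqrf_eq0 eq_le sqr_ge0 andbT; nra.
have /eqP b0 : b == 0 by rewrite -sqrf_eq0 eq_le sqr_ge0 andbT; nra.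
by rewrite a0 b0.
Qed.

Lemma ip_ext f h : (forall k, ip k f = ip k h) -> f = h.
Proof.
move=> fh; apply/eqP; rewrite -subr_eq0; apply/eqP/l2norm_eq0/eqP.
by rewrite -sqrf_eq0 -ipff ipBr !fh subrr.
Qed.

Lemma Re_dot f h : complex.Re (dot f h) = ip f h. Proof. by []. Qed.

Lemma dotE f h : dot f h = ip f h +i* ip (- 'i *: f) h.
Proof.
congr (_ +i* _); apply: eq_rsum => g; rewrite l2Z.
by case: (f g) (h g) => [a b] [a' b'] /=; ring.
Qed.

Lemma l2norm_le f (b : R) : 0 <= b ->
  (forall X : {fset T}, \sum_(g <- X) normsq (f g) <= b ^+ 2) -> l2norm f <= b.
Proof.
move=> b0 H; apply: le_of_sqr => //.
rewrite l2norm_sqr -lee_fin fineK ?l2sq_fin//.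
apply: ge_ereal_sup => _ [X [finX _] <-].
by rewrite fsbig_finite// sumEFin lee_fin.
Qed.

Lemma sum_normsq_le f (X : {fset T}) : \sum_(g <- X) normsq (f g) <= l2norm f ^+ 2.
Proof.
rewrite l2norm_sqr -lee_fin fineK ?l2sq_fin// -sumEFin.
apply: esum_ge; exists [set` X]%classic; first by split.
by rewrite fsbig_finite ?set_fsetK//; exact: finite_fset.
Qed.

End InnerProduct.

Section Completeness.
Variables (R : realType) (T : groupType).
Local Notation l2 := (l2 R T).

Lemma cauchy_real_cvg (x : nat -> R) :
  (forall e, 0 < e -> exists N, forall m n, (N <= m)%N -> (N <= n)%N ->
     `|x m - x n| <= e) -> cvg (x @ \oo)%classic.
Proof.
move=> H; apply/cauchy_cvgP/cauchy_exP => e e0.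
have [N NP] := H (e / 2) (divr_gt0 e0 (ltr0Sn _ _)).
exists (x N); exists N => // m /= Nm; rewrite /ball /=.
by apply: le_lt_trans (NP N m (leqnn N) Nm) _; rewrite ltr_pdivrMr// ltr_pMr// ltr1n.
Qed.

Lemma cvg_sum_seq (J : Type) (r : seq J) (F : J -> nat -> R) (l : J -> R) :
  (forall j, (F j @ \oo --> l j)%classic) ->
  ((fun m => \sum_(j <- r) F j m) @ \oo --> \sum_(j <- r) l j)%classic.
Proof.
move=> H; elim: r => [|j r IH].
  under eq_fun do rewrite big_nil; rewrite big_nil; exact: cvg_cst.
under eq_fun do rewrite big_cons; rewrite big_cons; exact: cvgD.
Qed.

(** The limit is taken coordinate by coordinate. The Cauchy bound holds over each finite set of
    coordinates, passes to the limit there, and [l2norm_le] gathers the finite sets. *)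
Lemma l2_complete (u : nat -> l2) :
  (forall e, 0 < e -> exists N, forall m n, (N <= m)%N -> (N <= n)%N ->
     l2norm (u m - u n) <= e) ->
  exists l : l2, forall e, 0 < e -> exists N, forall n, (N <= n)%N ->
     l2norm (u n - l) <= e.
Proof.
move=> H.
have HN e : 0 < e -> exists N, forall m n, (N <= m)%N -> (N <= n)%N ->
    forall g, normsq (u m g - u n g) <= e ^+ 2.
  move=> e0; have [N NP] := H e e0; exists N => m n Nm Nn g.
  apply: le_trans (normsq_le_l2norm (u m - u n) g) _.
  by rewrite ler_pXn2r ?nnegrE ?l2norm_ge0 ?(ltW e0)//; exact: NP.
have Hr g : cvg ((fun n => complex.Re (u n g)) @ \oo)%classic.
  apply: cauchy_real_cvg => e e0; have [N NP] := HN e e0.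
  exists N => m n Nm Nn; have h := NP m n Nm Nn g.
  apply: le_of_sqr; rewrite ?(ltW e0)// real_normK ?num_real//.
  apply: le_trans h; case: (u m g) (u n g) => [a b] [a' b'] /=.
  by rewrite /normsq /= lerDl sqr_ge0.
have Hi g : cvg ((fun n => complex.Im (u n g)) @ \oo)%classic.
  apply: cauchy_real_cvg => e e0; have [N NP] := HN e e0.
  exists N => m n Nm Nn; have h := NP m n Nm Nn g.
  apply: le_of_sqr; rewrite ?(ltW e0)// real_normK ?num_real//.
  apply: le_trans h; case: (u m g) (u n g) => [a b] [a' b'] /=.
  by rewrite /normsq /= lerDr sqr_ge0.
pose l g : R[i] := Complex (lim ((fun n => complex.Re (u n g)) @ \oo)%classic)
                    (lim ((fun n => complex.Im (u n g)) @ \oo)%classic).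
have cv n g : ((fun m => normsq (u m g - u n g)) @ \oo -->
               normsq (l g - u n g))%classic.
  have E z w : normsq (z - w) = (complex.Re z - complex.Re w) *
     (complex.Re z - complex.Re w) + (complex.Im z - complex.Im w) *
     (complex.Im z - complex.Im w) :> R.
    by case: z w => [a b] [a' b']; rewrite /normsq /= -!expr2.
  under eq_fun do rewrite E; rewrite E.
  by apply: cvgD; apply: cvgM; apply: cvgB; try exact: cvg_cst;
    [exact: Hr|exact: Hr|exact: Hi|exact: Hi].
have bd e n : 0 < e -> (exists N, forall m, (N <= m)%N -> l2norm (u m - u n) <= e)
    -> forall X : {fset T}, \sum_(g <- X) normsq (l g - u n g) <= e ^+ 2.
  move=> e0 [N NP] X.
  have := @cvg_sum_seq _ X (fun g m => normsq (u m g - u n g))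
    (fun g => normsq (l g - u n g)) (cv n).
  move=> /cvgr_to_le; apply; exists N => // m /= Nm.
  apply: le_trans (sum_normsq_le (u m - u n) X) _.
  by rewrite ler_pXn2r ?nnegrE ?l2norm_ge0 ?(ltW e0)//; exact: NP.
have [N0 N0P] := H 1 ltr01.
have lP : (l : T -> R[i]) \in @l2pred R T.
  have d2 : ((fun g => l g - u N0 g) : T -> R[i]) \in @l2pred R T.
    rewrite inE /l2sq; apply: (@le_lt_trans _ _ (1 ^+ 2 : R)%:E); last exact: ltry.
    apply: ge_ereal_sup => _ [X [finX _] <-].
    rewrite fsbig_finite// sumEFin lee_fin; apply: bd => //.
    by exists N0 => m Nm; exact: N0P.
  have -> : l = ((fun g => l g - u N0 g) : T -> R[i]) + l2val (u N0).
    by apply/funext => g; rewrite /= subrK.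
  by apply: rpredD => //; exact: l2valP.
exists (L2 lP) => e e0; have [N NP] := H e e0; exists N => n Nn.
rewrite -l2normN opprB; apply: l2norm_le; first exact: ltW.
move=> X; apply: bd => //; exists N => m Nm; exact: NP.
Qed.

End Completeness.

(** * Positivity of polynomials on an interval *)

Lemma bin_mul_ffact n k j : (j <= n)%N -> (k <= n)%N ->
  ('C(n, k) * k ^_ j = if (j <= k)%N then n ^_ j * 'C(n - j, k - j) else 0)%N.
Proof.
move=> jn kn; have [jk|kj] := leqP j k; last by rewrite ffact_small// muln0.
apply/eqP; rewrite -(@eqn_pmul2r ((k - j)`! * (n - k)`!)) ?muln_gt0 ?fact_gt0//.
rewrite -[X in X == _]mulnA [X in (_ * X == _)%N]mulnA (ffact_fact jk) (bin_fact kn).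
rewrite -mulnA [X in (_ == _ * X)%N](_ : _ = (n - j)`!) ?(ffact_fact jn)//.
by rewrite -[RHS](@bin_fact _ (k - j)) ?leq_sub2r// subnBA// subnK.
Qed.

Lemma exists_natr_gt (R : realType) (x : R) : exists m : nat, x < m%:R.
Proof.
exists (Num.bound `|x|); apply: le_lt_trans (ler_norm _) _.
exact: archi_boundP.
Qed.

Section Bernstein.
Variables (R : realType) (M : R).
Hypothesis M0 : 0 < M.

Definition bern (n k : nat) : {poly R} := 'X^k * (M%:P - 'X) ^+ (n - k).

(** Falling factorials of [k], rather than powers, give exact monomials: [k ^_ j] merges with the
    binomial coefficient and leaves a binomial expansion of degree [n - j]. *)
Lemma sum_bern n j : (j <= n)%N ->
  \sum_(k < n.+1) ('C(n, k) * k ^_ j)%:R *: bern n k =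
  ((n ^_ j)%:R * M ^+ (n - j)) *: 'X^j.
Proof.
move=> jn.
have -> : ((n ^_ j)%:R * M ^+ (n - j)) *: 'X^j =
  (n ^_ j)%:R *: ('X^j * ((M%:P - 'X) + 'X) ^+ (n - j)) :> {poly R}.
  by rewrite subrK -scalerA -polyC_exp mulrC mul_polyC.
rewrite exprDn mulr_sumr scaler_sumr.
rewrite -(big_mkord xpredT (fun k => ('C(n, k) * k ^_ j)%:R *: bern n k)).
rewrite (big_cat_nat (n := j)) //=; last exact: leqW.
rewrite big_nat big1 ?add0r; last first.
  by move=> k /andP[_ kj]; rewrite ffact_small// muln0 scale0r.
rewrite -{1}[j]add0n big_addn subSn// big_mkord; apply: eq_bigr => i _.
have ij : (i <= n - j)%N by rewrite -ltnS.
have ijn : (i + j <= n)%N by move: ij; rewrite leq_subRL// addnC.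
rewrite bin_mul_ffact// leq_addl addnK natrM -scalerA mulrnAr.
rewrite -[X in _ = _ *: X]scaler_nat.
suff -> : bern n (i + j) = 'X^j * ((M%:P - 'X) ^+ (n - j - i) * 'X^i) by [].
by rewrite /bern addnC subnDA exprD -mulrA [X in _ * X = _]mulrC.
Qed.

Section Functional.
Variable ell : {poly R} -> R.
Hypothesis ellP : forall a P Q, ell (a *: P + Q) = a * ell P + ell Q.

Lemma ell0 : ell 0 = 0.
Proof. by have := ellP 1 0 0; rewrite scale1r addr0 mul1r => /eqP; rewrite -subr_eq subrr eq_sym => /eqP. Qed.

Lemma ellZ a P : ell (a *: P) = a * ell P.
Proof. by rewrite -[a *: P]addr0 ellP ell0 addr0. Qed.

Lemma ellD P Q : ell (P + Q) = ell P + ell Q.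
Proof. by rewrite -[P]scale1r ellP mul1r scale1r. Qed.

Lemma ell_sum (J : Type) (r : seq J) (F : J -> {poly R}) :
  ell (\sum_(j <- r) F j) = \sum_(j <- r) ell (F j).
Proof. by elim/big_rec2: _ => [|j x y _ <-]; rewrite ?ell0 ?ellD. Qed.

Lemma ell_sumZ n (F : 'I_n -> {poly R}) c :
  ell (\sum_(j < n) c j *: F j) = \sum_(j < n) c j * ell (F j).
Proof. by rewrite ell_sum; apply: eq_bigr => j _; rewrite ellZ. Qed.

Hypothesis ell_sqr : forall Q, 0 <= ell (Q ^+ 2).
Hypothesis ell_Xsqr : forall Q, 0 <= ell ('X * Q ^+ 2).
Hypothesis ell_MXsqr : forall Q, 0 <= ell ((M%:P - 'X) * Q ^+ 2).

(** By the parities of the two exponents, the polynomial is a square times one of 1, [X], [M - X],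
    [X (M - X)]. The last case reduces to the others by
    [M X (M - X) = X^2 (M - X) + X (M - X)^2]. *)
Lemma ell_bern n k : 0 <= ell (bern n k).
Proof.
rewrite /bern; move: (n - k)%N => m.
rewrite -(odd_double_half k) -(odd_double_half m).
set a := k./2; set b := m./2; rewrite !exprD -!muln2 !exprM.
case: (odd k) (odd m) => [] []; rewrite ?expr1 ?expr0 ?mul1r.
- have -> : 'X * ('X ^+ a) ^+ 2 * ((M%:P - 'X) * ((M%:P - 'X) ^+ b) ^+ 2) =
    M^-1 *: ((M%:P - 'X) * ('X ^+ a * (M%:P - 'X) ^+ b * 'X) ^+ 2 +
     'X * ('X ^+ a * (M%:P - 'X) ^+ b * (M%:P - 'X)) ^+ 2) :> {poly R}.
    have h : (M^-1)%:P * M%:P = 1 :> {poly R}.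
      by rewrite -polyCM mulVf ?gt_eqF.
    rewrite -mul_polyC.
    transitivity (((M^-1)%:P * M%:P) * ('X * ('X ^+ a) ^+ 2 *
      ((M%:P - 'X) * ((M%:P - 'X) ^+ b) ^+ 2)) : {poly R}).
      by rewrite h mul1r.
    set u := 'X ^+ a; set w := _ ^+ b; ring.
  by rewrite ellZ mulr_ge0 ?invr_ge0 ?(ltW M0)// ellD addr_ge0.
- rewrite -mulrA -exprMn; exact: ell_Xsqr.
- rewrite mulrCA -exprMn; exact: ell_MXsqr.
- rewrite -exprMn; exact: ell_sqr.
Qed.

(** Induction on [j]: each new factor [(k - j) / (n - j)] is within [2 J / n] of [k / n] because [j]
    is at most half of [n], and all factors lie in [[0, 1]]. *)
Lemma ffact_ratio (J n k : nat) : (J.*2 <= n)%N -> (0 < n)%N -> (k <= n)%N ->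
  forall j, (j <= J)%N ->
  0 <= (k ^_ j)%:R / (n ^_ j)%:R :> R /\ (k ^_ j)%:R / (n ^_ j)%:R <= 1 :> R /\
  `|(k ^_ j)%:R / (n ^_ j)%:R - (k%:R / n%:R) ^+ j| <= j%:R * (J.*2%:R / n%:R) :> R.
Proof.
move=> Jn n0 kn; elim=> [|j IH] jJ.
  by rewrite !ffactn0 divr1 expr0 subrr normr0 mul0r; do !split.
have [a0 [a1 ab]] := IH (ltnW jJ).
have n0R : 0 < n%:R :> R by rewrite ltr0n.
have jn : (j < n)%N.
  apply: leq_trans (leq_trans jJ _) Jn; by rewrite -addnn leq_addr.
have nj0 : 0 < (n - j)%:R :> R by rewrite ltr0n subn_gt0.
set a := _ / _ in a0 a1 ab; pose s : R := k%:R / n%:R.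
pose t : R := (k - j)%:R / (n - j)%:R.
have t0 : 0 <= t by rewrite divr_ge0.
have t1 : t <= 1 by rewrite ler_pdivrMr// mul1r ler_nat leq_sub2r.
have s0 : 0 <= s by rewrite divr_ge0.
have s1 : s <= 1 by rewrite ler_pdivrMr// mul1r ler_nat.
have -> : (k ^_ j.+1)%:R / (n ^_ j.+1)%:R = a * t :> R.
  by rewrite /a /t !ffactnSr !natrM invfM mulrACA.
split; first by rewrite mulr_ge0.
split; first by rewrite mulr_ile1.
have st : `|t - s| <= J.*2%:R / n%:R.
  have jnR : j%:R *+ 2 <= n%:R :> R.
    rewrite -mulr_natr -natrM ler_nat muln2; apply: leq_trans Jn.
    by rewrite leq_double ltnW.
  have jJR : j%:R <= J%:R :> R by rewrite ler_nat ltnW.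
  have knR : k%:R <= n%:R :> R by rewrite ler_nat.
  have k0R : 0 <= k%:R :> R by [].
  have j0R : 0 <= j%:R :> R by [].
  rewrite -muln2 natrM.
  have [jk|kj] := leqP j k.
    have -> : t - s = - (j%:R * (n%:R - k%:R) / ((n - j)%:R * n%:R)).
      rewrite /t /s (natrB _ jk) (natrB _ (ltnW jn)); field.
      by rewrite -(natrB _ (ltnW jn)) !gt_eqF.
    rewrite normrN ger0_norm; last first.
      by rewrite divr_ge0 ?mulr_ge0 ?subr_ge0 ?ler0n// ltW.
    rewrite ler_pdivrMr ?mulr_gt0//.
    rewrite [leRHS](_ : _ = J%:R * 2 * (n - j)%:R); last first.
      by field; rewrite gt_eqF.
    rewrite (natrB _ (ltnW jn)); nra.
  have -> : t = 0 by rewrite /t (eqP (_ : (k - j)%N == 0%N)) ?mul0r// subn_eq0 ltnW.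
  rewrite sub0r normrN ger0_norm// ler_pdivrMr// divfK ?gt_eqF//.
  have : k%:R <= j%:R :> R by rewrite ler_nat ltnW.
  nra.
have b1 : 0 <= s ^+ j <= 1 by rewrite exprn_ge0 //= exprn_ile1.
have -> : a * t - s ^+ j.+1 = (a - s ^+ j) * t + s ^+ j * (t - s).
  by rewrite exprSr; ring.
apply: le_trans (ler_normD _ _) _.
rewrite (normrM (a - s ^+ j) t) (normrM (s ^+ j) (t - s)) -natr1 mulrDl mul1r.
apply: lerD.
  rewrite (ger0_norm t0); apply: le_trans ab.
  by rewrite ler_piMr.
have /andP[b0 b1'] := b1.
rewrite (ger0_norm b0); apply: le_trans st.
by rewrite ler_piMl.
Qed.

(* [W] is a combination of Bernstein polynomials of degree [n] whose coefficients are
   nonnegative up to [O(1/n)]. *)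
Lemma ell_ge0 W : (forall s, 0 <= s <= M -> 0 <= W.[s]) -> 0 <= ell W.
Proof.
move=> W0; set J := size W.
pose K := \sum_(j < J) `|W`_j| * M ^+ j * (J%:R * J.*2%:R) * ell 1.
have e1 : 0 <= ell 1 by have := ell_sqr 1; rewrite expr1n.
have main n : (J.*2 <= n)%N -> (0 < n)%N -> - K / n%:R <= ell W.
  move=> Jn n0; have n0R : 0 < n%:R :> R by rewrite ltr0n.
  have jn (j : 'I_J) : (j <= n)%N.
    by apply: leq_trans Jn; rewrite -addnn ltnW// ltn_addr.
  have Mn m : M ^+ m != 0 by rewrite expf_neq0 ?gt_eqF.
  have EW : W = \sum_(k < n.+1) (M ^- n * 'C(n, k)%:R * \sum_(j < J) W`_j * M ^+ j *
       ((k ^_ j)%:R / (n ^_ j)%:R)) *: bern n k.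
    rewrite -[LHS]coefK poly_def.
    transitivity (\sum_(j < J) \sum_(k < n.+1) (M ^- n * 'C(n, k)%:R *
      (W`_j * M ^+ j * ((k ^_ j)%:R / (n ^_ j)%:R))) *: bern n k); last first.
      rewrite exchange_big; apply: eq_bigr => k _.
      by rewrite -scaler_suml mulr_sumr.
    apply: eq_bigr => j _.
    have nj : (n ^_ j)%:R != 0 :> R by rewrite pnatr_eq0 -lt0n ffact_gt0.
    transitivity ((W`_j * M ^+ j * M ^- n / (n ^_ j)%:R) *:
      (\sum_(k < n.+1) ('C(n, k) * k ^_ j)%:R *: bern n k)).
      rewrite (sum_bern (jn j)) scalerA.
      apply: (congr1 (fun c => c *: 'X^j)).
      rewrite (_ : M ^- n = (M ^+ (n - j) * M ^+ j)^-1); last first.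
        by rewrite -exprD subnK.
      by field; rewrite nj !Mn.
    rewrite scaler_sumr; apply: eq_bigr => k _; rewrite scalerA natrM.
    by apply: (congr1 (fun c => c *: bern n k)); ring.
  rewrite (congr1 ell EW) ell_sumZ.
  have E1 : \sum_(k < n.+1) M ^- n * 'C(n, k)%:R * ell (bern n k) = ell 1.
    have := congr1 ell (sum_bern (leq0n n)); rewrite ell_sumZ ffactn0 subn0 mul1r ellZ.
    rewrite expr0 => h; rewrite -[RHS](mulKf (Mn n)) -h mulr_sumr.
    by apply: eq_bigr => k _; rewrite ffactn0 muln1 mulrA.
  rewrite [leLHS](_ : _ = \sum_(k < n.+1) M ^- n * 'C(n, k)%:R * ell (bern n k) *
     (- (\sum_(j < J) `|W`_j| * M ^+ j * (J%:R * J.*2%:R)) / n%:R)); last first.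
    by rewrite -mulr_suml E1 /K -mulr_suml; ring.
  apply: ler_sum => k _; rewrite [leRHS]mulrAC.
  apply: ler_wpM2l.
    by rewrite !mulr_ge0 ?ell_bern// invr_ge0 exprn_ge0// ltW.
  have kn : (k <= n)%N by rewrite -ltnS.
  have := W0 (M * (k%:R / n%:R)).
  rewrite mulr_ge0 ?divr_ge0 ?(ltW M0)//= ler_piMr ?(ltW M0)//; last first.
    by rewrite ler_pdivrMr// mul1r ler_nat.
  move=> /(_ isT); rewrite horner_coef => h.
  rewrite -subr_ge0; apply: le_trans h _.
  rewrite mulNr opprK mulr_suml -big_split /=; apply: ler_sum => j _.
  have [_ [_ hj]] := ffact_ratio Jn n0 kn (ltnW (ltn_ord j)).
  have h2 : (k ^_ j)%:R / (n ^_ j)%:R - (k%:R / n%:R) ^+ j >= - (J%:R * (J.*2%:R / n%:R)) :> R.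
    rewrite lerNl; apply: le_trans (le_trans hj _).
      by rewrite -normrN ler_norm.
    by rewrite ler_wpM2r ?divr_ge0// ler_nat ltnW.
  set u := (k ^_ j)%:R / _ in hj h2 *; set w := (k%:R / n%:R) ^+ j in hj h2 *.
  have hj' : `|u - w| <= J%:R * (J.*2%:R / n%:R).
    by apply: le_trans hj _; rewrite ler_wpM2r ?divr_ge0// ler_nat ltnW.
  rewrite exprMn -/w -subr_ge0 (_ : _ - _ =
    M ^+ j * (W`_j * (u - w) + `|W`_j| * (J%:R * (J.*2%:R / n%:R)))); last by ring.
  rewrite mulr_ge0 ?exprn_ge0 ?(ltW M0)//.
  have : - (W`_j * (u - w)) <= `|W`_j| * (J%:R * (J.*2%:R / n%:R)).
    apply: le_trans (ler_norm _) _; rewrite normrN normrM.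
    exact: ler_wpM2l.
  lra.
(* A negative value contradicts [main] as soon as [n] exceeds [K / - ell W]. *)
rewrite leNgt; apply/negP => W_lt0.
have [m mP] := exists_natr_gt (K / (- ell W)).
pose n := maxn m (maxn J.*2 1).
have n0 : (0 < n)%N by rewrite /n !leq_max leqnn !orbT.
have := main n _ n0; rewrite /n leq_max [X in _ || X]leq_max leqnn /= orbT => /(_ isT).
rewrite leNgt => /negP; apply.
have n0R : 0 < n%:R :> R by rewrite ltr0n.
rewrite -/n ltr_pdivlMr//; move: mP; rewrite ltr_pdivrMr ?oppr_gt0// => mP.
have : m%:R <= n%:R :> R by rewrite ler_nat leq_max leqnn.
nra.
Qed.

End Functional.

(** Bernstein's proof. The modulus of continuity carries a quadratic term so that averaging over the
    Bernstein weights produces their variance, [s * (M - s) / n]. *)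
Lemma weierstrass (f : R -> R) :
  (forall e, 0 < e -> exists K, 0 <= K /\ forall u v, 0 <= u <= M -> 0 <= v <= M ->
     `|f u - f v| <= e + K * (u - v) ^+ 2) ->
  forall e, 0 < e -> exists P : {poly R}, forall s, 0 <= s <= M -> `|P.[s] - f s| <= e.
Proof.
move=> fP e e0; have [K [K0 KP]] := fP (e / 2) (divr_gt0 e0 (ltr0Sn _ _)).
have [m mP] := exists_natr_gt (K * M ^+ 2 / (e / 2)).
(* At least 2, so that [sum_bern] applies to the second factorial moment. *)
pose n := m.+2; have n0 : 0 < n%:R :> R by rewrite ltr0n.
exists (\sum_(k < n.+1) (M ^- n * 'C(n, k)%:R * f (M * (k%:R / n%:R))) *: bern n k).
move=> s sM; have /andP[s0 s1] := sM.
have B0 k : 0 <= (bern n k).[s].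
  rewrite /bern hornerM hornerXn horner_exp hornerD hornerN hornerX hornerC.
  by rewrite mulr_ge0 ?exprn_ge0// subr_ge0.
pose E j := \sum_(k < n.+1) ('C(n, k) * k ^_ j)%:R * (bern n k).[s].
have EE j : (j <= n)%N -> E j = (n ^_ j)%:R * M ^+ (n - j) * s ^+ j.
  move=> jn; have := congr1 (fun P => P.[s]) (sum_bern jn).
  rewrite hornerZ hornerXn => <-; rewrite horner_sum; apply: eq_bigr => k _.
  by rewrite hornerZ.
have Mn : M ^+ n != 0 by rewrite expf_neq0 ?gt_eqF.
pose w (k : 'I_n.+1) := M ^- n * 'C(n, k)%:R * (bern n k).[s].
have w0 k : 0 <= w k by rewrite !mulr_ge0 ?invr_ge0 ?exprn_ge0 ?(ltW M0).
have w1 : \sum_k w k = 1.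
  have := EE 0%N isT; rewrite /E ffactn0 subn0 expr0 mul1r mulr1 => h.
  rewrite -[RHS](mulVf Mn) -{2}h mulr_sumr; apply: eq_bigr => k _.
  by rewrite ffactn0 muln1 /w mulrA.
have wk : \sum_k w k * k%:R = n%:R * s / M.
  have := EE 1%N isT; rewrite /E ffactn1 expr1 => h.
  transitivity (M ^- n * (n%:R * M ^+ (n - 1) * s)).
    rewrite -h mulr_sumr; apply: eq_bigr => k _.
    by rewrite ffactn1 /w natrM; ring.
  rewrite /n subn1 /= exprS; field.
  by rewrite expf_neq0 ?gt_eqF.
have wkk : \sum_k w k * k%:R ^+ 2 = n%:R * (n%:R - 1) * s ^+ 2 / M ^+ 2 + n%:R * s / M.
  have := EE 2%N isT; rewrite /E => h.
  rewrite -wk -[X in X + _](_ : \sum_k w k * (k ^_ 2)%:R = _).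
    rewrite -big_split /=; apply: eq_bigr => k _.
    have -> : k%:R ^+ 2 = (k ^_ 2)%:R + k%:R :> R.
      rewrite ffactnS ffactn1; case: (k : nat) => [|i]; first by rewrite mul0n expr0n addr0.
      by rewrite -natrD -natrX; congr (_%:R); rewrite /= expnS expn1 mulnS addnC.
    by ring.
  transitivity (M ^- n * ((n ^_ 2)%:R * M ^+ (n - 2) * s ^+ 2)).
    rewrite -h mulr_sumr; apply: eq_bigr => k _.
    by rewrite /w natrM; ring.
  rewrite ffactnS ffactn1 /n natrM !subSS subn0 !exprS /= -[in RHS]natr1 addrK.
  field.
  by rewrite expf_neq0 ?gt_eqF.
have Ws : (\sum_(k < n.+1) (M ^- n * 'C(n, k)%:R * f (M * (k%:R / n%:R))) *: bern n k).[s]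
   - f s = \sum_k w k * (f (M * (k%:R / n%:R)) - f s).
  rewrite horner_sum.
  rewrite [in LHS](_ : f s = \sum_k w k * f s); last by rewrite -mulr_suml w1 mul1r.
  rewrite -sumrB; apply: eq_bigr => k _; rewrite hornerZ /w; ring.
rewrite Ws; apply: le_trans (ler_norm_sum _ _ _) _.
apply: (@le_trans _ _ (\sum_k w k * (e / 2 + K * (M * (k%:R / n%:R) - s) ^+ 2))).
  apply: ler_sum => k _; rewrite normrM (ger0_norm (w0 k)) ler_wpM2l//.
  apply: KP => //; rewrite mulr_ge0 ?divr_ge0 ?(ltW M0)//= ler_piMr ?(ltW M0)//.
  by rewrite ler_pdivrMr// mul1r ler_nat -ltnS.
have -> : \sum_k w k * (e / 2 + K * (M * (k%:R / n%:R) - s) ^+ 2) =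
  (e / 2 + K * s ^+ 2) * (\sum_k w k) + K * M ^+ 2 / n%:R ^+ 2 * (\sum_k w k * k%:R ^+ 2)
  - 2 * K * M / n%:R * s * (\sum_k w k * k%:R).
  rewrite !mulr_sumr -big_split -sumrB; apply: eq_bigr => k _ /=.
  by field; rewrite gt_eqF.
rewrite w1 wk wkk.
have -> : (e / 2 + K * s ^+ 2) * 1 + K * M ^+ 2 / n%:R ^+ 2 *
   (n%:R * (n%:R - 1) * s ^+ 2 / M ^+ 2 + n%:R * s / M) -
   2 * K * M / n%:R * s * (n%:R * s / M) = e / 2 + K * (s * (M - s)) / n%:R.
  by field; rewrite !gt_eqF.
rewrite [leRHS](splitr e) lerD2l ler_pdivrMr//.
have h : K * (s * (M - s)) <= K * M ^+ 2 by apply: ler_wpM2l => //; nra.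
apply: le_trans h _; move: mP; rewrite ltr_pdivrMr ?divr_gt0// => mP.
apply: le_trans (ltW mP) _; rewrite mulrC ler_wpM2l ?divr_ge0 ?(ltW e0)//.
by rewrite ler_nat /n ltnW.
Qed.

End Bernstein.

(** * Real powers: tangent inequalities and polynomial approximation *)

Section PowerFunctions.
Variable R : realType.
Implicit Types s t r : R.

(** Young's inequality for the product of [s ^ t] and 1, with conjugate exponents [1 / t] and
    [1 / (1 - t)]. *)
Lemma powR_le_tangent s t : 0 <= s -> 0 <= t <= 1 -> s `^ t <= 1 + t * (s - 1).
Proof.
move=> s0 /andP[t0 t1]; have [->|tn0] := eqVneq t 0.
  by rewrite powRr0 mul0r addr0.
have [->|tn1] := eqVneq t 1; first by rewrite powRr1// mul1r addrC subrK.
have tp : 0 < t by rewrite lt_neqAle eq_sym tn0.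
have tp1 : 0 < 1 - t by rewrite subr_gt0 lt_neqAle tn1.
have := @conjugate_powR R (s `^ t) 1 t^-1 (1 - t)^-1 (powR_ge0 _ _) ler01.
rewrite !invr_gt0 !invrK => /(_ tp tp1); rewrite addrC subrK => /(_ erefl).
rewrite mulr1 -powRrM divff// powRr1// powR1 mul1r; lra.
Qed.

(** The preceding bound for the number [s ^ r] and the exponent [1 / r]. *)
Lemma powR_ge_tangent s r : 0 <= s -> 1 <= r -> 1 + r * (s - 1) <= s `^ r.
Proof.
move=> s0 r1; have r0 : 0 < r by lra.
have := @powR_le_tangent (s `^ r) r^-1 (powR_ge0 _ _).
rewrite invr_ge0 ltW//= invf_le1// => /(_ r1).
rewrite -powRrM divff ?gt_eqF// powRr1// => h.
have : r * s <= r * (1 + r^-1 * (s `^ r - 1)) by rewrite ler_pM2l.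
rewrite mulrDr mulrA divff ?gt_eqF// mulr1 mul1r; lra.
Qed.

Lemma powR_lip r M : 1 <= r -> 0 <= M -> exists2 L, 0 <= L &
  forall u v, 0 <= u <= M -> 0 <= v <= M -> `|u `^ r - v `^ r| <= L * `|u - v|.
Proof.
move=> r1 M0; have r0 : 0 < r by lra.
exists (r * M `^ (r - 1)); first by rewrite mulr_ge0 ?powR_ge0// ltW.
have P u v : 0 <= v -> v <= u -> u <= M -> u `^ r - v `^ r <= r * M `^ (r - 1) * (u - v).
  move=> v0 vu uM; have u0 := le_trans v0 vu.
  have [u_eq0|un0] := eqVneq u 0.
    have v_eq0 : v = 0 by apply/eqP; rewrite eq_le v0 andbT -u_eq0.
    by rewrite u_eq0 v_eq0 !subrr mulr0.
  have up : 0 < u by rewrite lt_neqAle eq_sym un0.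
  have vu0 : 0 <= v / u by rewrite divr_ge0.
  have h := powR_ge_tangent vu0 r1.
  have E : v `^ r = u `^ r * (v / u) `^ r.
    by rewrite -powRM// mulrC divfK.
  have Eu : u `^ r = u * u `^ (r - 1) by rewrite mulr_powRB1.
  have h2 : u `^ r * (1 + r * (v / u - 1)) <= v `^ r.
    by rewrite E ler_wpM2l ?powR_ge0.
  have h3 : u `^ r * (1 + r * (v / u - 1)) = u `^ r - r * u `^ (r - 1) * (u - v).
    by rewrite Eu; field.
  have h4 : u `^ (r - 1) <= M `^ (r - 1).
    by apply: ge0_ler_powR; rewrite ?nnegrE ?subr_ge0.
  have h5 : r * u `^ (r - 1) * (u - v) <= r * M `^ (r - 1) * (u - v).
    by rewrite ler_wpM2r ?subr_ge0// ler_wpM2l// ltW.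
  lra.
move=> u v /andP[u0 uM] /andP[v0 vM].
have [uv|/ltW vu] := leP u v.
  rewrite distrC (distrC u) !ger0_norm ?subr_ge0//; first exact: P.
  by apply: ge0_ler_powR; rewrite ?nnegrE// ltW.
rewrite !ger0_norm ?subr_ge0//; first exact: P.
by apply: ge0_ler_powR; rewrite ?nnegrE// ltW.
Qed.

(** The exponent 1/2 serves the absolute value, exponents at least 1 the later powers. For 1/2, let
    [d] be the distance of the square roots: if [d > e], then [e^3 d <= d^4 <= (u - v)^2], whence
    [K = e^-3]. For [r >= 1], the Lipschitz bound [L d] is at most [e + L^2 d^2 / e]. *)
Lemma powR_modulus r M : r = 2^-1 \/ 1 <= r -> 0 <= M ->
  forall e, 0 < e -> exists K, 0 <= K /\ forall u v, 0 <= u <= M -> 0 <= v <= M ->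
     `|u `^ r - v `^ r| <= e + K * (u - v) ^+ 2.
Proof.
move=> [->|r1] M0 e e0.
  exists (e ^- 3); split; first by rewrite invr_ge0 exprn_ge0// ltW.
  move=> u v /andP[u0 _] /andP[v0 _]; rewrite !powR12_sqrt//.
  set a := Num.sqrt u; set b := Num.sqrt v.
  have -> : u - v = (a - b) * (a + b).
    by rewrite -[u]sqr_sqrtr// -[v]sqr_sqrtr// -/a -/b; ring.
  have a0 : 0 <= a by exact: sqrtr_ge0.
  have b0 : 0 <= b by exact: sqrtr_ge0.
  set d := `|a - b|; have d0 : 0 <= d by exact: normr_ge0.
  have dab : d <= a + b by rewrite ler_norml; apply/andP; split; lra.
  have [de|ed] := leP d e.
    apply: le_trans de _; rewrite lerDl mulr_ge0 ?sqr_ge0//.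
    by rewrite invr_ge0 exprn_ge0// ltW.
  apply: (@le_trans _ _ (e ^- 3 * ((a - b) * (a + b)) ^+ 2)); last first.
    by rewrite lerDr ltW.
  rewrite mulrC ler_pdivlMr ?exprn_gt0//.
  rewrite exprMn -[(a - b) ^+ 2]real_normK ?num_real// -/d.
  have h1 : d ^+ 2 <= (a + b) ^+ 2 by rewrite ler_pXn2r// ?nnegrE ?addr_ge0.
  have h2 : e ^+ 2 <= d ^+ 2 by rewrite ler_pXn2r// ?nnegrE ltW.
  apply: (@le_trans _ _ (d ^+ 2 * d ^+ 2)); last by rewrite ler_wpM2l// sqr_ge0.
  have -> : d ^+ 2 * d ^+ 2 = d * (d * d ^+ 2) by ring.
  apply: ler_wpM2l => //; rewrite exprS; apply: ler_pM => //; try exact: ltW.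
  exact: sqr_ge0.
have [L L0 LP] := powR_lip r1 M0.
exists (L ^+ 2 / e); split; first by rewrite divr_ge0 ?sqr_ge0// ltW.
move=> u v uM vM; apply: le_trans (LP u v uM vM) _.
rewrite -[(u - v) ^+ 2]real_normK ?num_real//; set d := `|u - v|.
rewrite -subr_ge0 (_ : _ - _ = ((L * d - e) ^+ 2 + e * (L * d)) / e).
  by rewrite divr_ge0 ?addr_ge0 ?sqr_ge0 ?mulr_ge0 ?normr_ge0// ltW.
by field; rewrite gt_eqF.
Qed.

Lemma powR_approx r M : r = 2^-1 \/ 1 <= r -> 0 <= M ->
  forall e, 0 < e -> exists P : {poly R}, forall s, 0 <= s <= M ->
    `|P.[s] - s `^ r| <= e.
Proof.
move=> r1 M0; have [<-|Mn0] := eqVneq 0 M.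
  move=> e e0; exists ((0 `^ r)%:P) => s /andP[s0 s1].
  have -> : s = 0 by apply/eqP; rewrite eq_le s0 s1.
  by rewrite hornerC subrr normr0 ltW.
apply: weierstrass; first by rewrite lt_neqAle Mn0.
exact: powR_modulus.
Qed.

End PowerFunctions.

(** * Functional calculus and L_p norms *)

Section PolyOperators.
Variables (R : realType) (T : groupType).
Local Open Scope complex_scope.
Local Notation l2 := (l2 R T).
Local Notation bop := (bop R T).
Implicit Types (P Q : {poly R}) (a b : bop) (f h v : l2).

Lemma polyop_widen n P (A : l2 -> l2) f : (size P <= n)%N ->
  polyop P A f = \sum_(i < n) (P`_i)%:C *: iter i A f.
Proof.
move=> Pn; rewrite /polyop (big_ord_widen n (fun i => (P`_i)%:C *: iter i A f) Pn).
rewrite big_mkcond /=; apply: eq_bigr => i _; case: ltnP => // iP.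
by rewrite nth_default// scale0r.
Qed.

Lemma polyop_lin c P Q (A : l2 -> l2) f :
  polyop (c *: P + Q) A f = c%:C *: polyop P A f + polyop Q A f.
Proof.
set n := maxn (size P) (size Q).
rewrite !(@polyop_widen n) ?leq_maxl ?leq_maxr//; last first.
  apply: leq_trans (size_polyD _ _) _; rewrite geq_max leq_maxr andbT.
  by apply: leq_trans (size_scale_leq _ _) _; rewrite leq_maxl.
rewrite scaler_sumr -big_split; apply: eq_bigr => i _ /=.
by rewrite coefD coefZ rmorphD rmorphM scalerDl scalerA.
Qed.

Lemma polyop0 (A : l2 -> l2) f : polyop 0 A f = 0.
Proof. by rewrite /polyop size_poly0 big_ord0. Qed.

Lemma polyopD P Q (A : l2 -> l2) f : polyop (P + Q) A f = polyop P A f + polyop Q A f.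
Proof. by rewrite -[P]scale1r polyop_lin scale1r scale1r. Qed.

Lemma polyopZ c P (A : l2 -> l2) f : polyop (c *: P) A f = c%:C *: polyop P A f.
Proof. by rewrite -[c *: P]addr0 polyop_lin polyop0 addr0. Qed.

Lemma polyopC c (A : l2 -> l2) f : polyop c%:P A f = c%:C *: f.
Proof.
rewrite (@polyop_widen 1) ?size_polyC_leq1// big_ord1 coefC eqxx //.
Qed.

Lemma polyop_cons P c (A : l2 -> l2) f :
  polyop (P * 'X + c%:P) A f = polyop P A (A f) + c%:C *: f.
Proof.
rewrite polyopD polyopC; congr (_ + _).
rewrite (@polyop_widen (size P).+1); last first.
  by apply: leq_trans (size_polyMleq _ _) _; rewrite size_polyX addn2.
rewrite big_ord_recl coefMX eqxx scale0r add0r (@polyop_widen (size P) P)//.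
by apply: eq_bigr => i _; rewrite lift0 coefMX [LHS]/= -iterSr.
Qed.

Lemma polyopX (A : l2 -> l2) f : polyop 'X A f = A f.
Proof.
have -> : 'X = 1%:P * 'X + 0%:P :> {poly R} by rewrite mul1r addr0.
by rewrite polyop_cons polyopC scale1r scale0r addr0.
Qed.

Lemma polyop_linear P a : linear (polyop P a).
Proof.
elim/poly_ind: P => [|P c IH] k f h; first by rewrite !polyop0 scaler0 addr0.
rewrite !polyop_cons linearP IH scalerDr !scalerDr !scalerA addrACA.
by rewrite [c%:C * k]mulrC.
Qed.
HB.instance Definition _ P a :=
  GRing.isLinear.Build R[i] l2 l2 *:%R (polyop P a) (polyop_linear P a).

Lemma polyop_bounded P a :
  exists M : R, forall f, l2norm (polyop P a f) <= M * l2norm f.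
Proof.
elim/poly_ind: P => [|P c [N IH]].
  by exists 0 => f; rewrite polyop0 l2norm0 mul0r.
have [M MP] := bfun_bounded a; exists (`|N| * `|M| + `|c|) => f.
rewrite polyop_cons; apply: le_trans (l2norm_triangle _ _) _.
rewrite l2normZr mulrDl lerD2r -mulrA; apply: le_trans (IH _) _.
apply: le_trans (_ : `|N| * l2norm (a f) <= _).
  by rewrite ler_wpM2r ?l2norm_ge0 ?ler_norm.
rewrite ler_wpM2l//; apply: le_trans (MP _) _.
by rewrite ler_wpM2r ?l2norm_ge0 ?ler_norm.
Qed.

Definition pbop P a : bop := Bop (polyop_bounded P a).

Lemma polyopM P Q a f : polyop (P * Q) a f = polyop P a (polyop Q a f).
Proof.
elim/poly_ind: P f => [|P c IH] f; first by rewrite mul0r !polyop0.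
have C v : polyop Q a (a v) = a (polyop Q a v).
  elim/poly_ind: Q v {IH} => [|Q d IH] v; first by rewrite !polyop0 linear0.
  by rewrite !polyop_cons IH linearD linearZ.
rewrite mulrDl polyopD mul_polyC polyopZ polyop_cons -C -IH; congr (_ + _).
have -> : P * 'X * Q = P * Q * 'X + 0%:P by rewrite addr0 mulrAC.
by rewrite polyop_cons scale0r addr0.
Qed.

Lemma polyop_comp P Q a f : polyop (P \Po Q) a f = polyop P (polyop Q a) f.
Proof.
elim/poly_ind: P f => [|P c IH] f; first by rewrite comp_poly0 !polyop0.
rewrite comp_polyD comp_polyM comp_polyX comp_polyC polyopD polyopC polyopM.
by rewrite IH polyop_cons.
Qed.

Lemma eq_polyop P (A B : l2 -> l2) f : A =1 B -> polyop P A f = polyop P B f.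
Proof. by move=> /funext ->. Qed.

(** [M] may be any bound of the norm: [[0, M]] stands for an interval that contains the spectrum. *)
Definition posop a M := [/\ forall f h, ip (a f) h = ip f (a h),
  forall f, 0 <= ip (a f) f, 0 <= M & forall f, l2norm (a f) <= M * l2norm f].

Section Pos.
Variables (a : bop) (M : R).
Hypothesis aP : posop a M.

Lemma polyop_sym P f h : ip (polyop P a f) h = ip f (polyop P a h).
Proof.
have [sa _ _ _] := aP; elim/poly_ind: P f h => [|P c IH] f h.
  by rewrite !polyop0 ip0l ip0r.
rewrite !polyop_cons ipDl ipDr ipZl ipZr IH; congr (_ + _).
have -> : polyop P a (a h) = a (polyop P a h) by rewrite -!(polyopX a) -!polyopM mulrC.
exact: sa.
Qed.

(** The functional [P |-> ip (P(a) f) f] satisfies the hypotheses of [ell_ge0], by moving one factor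
    of each square to the other side. This replaces the spectral theorem. *)
Lemma polyop_ge0 P f : (forall s, 0 <= s <= M -> 0 <= P.[s]) ->
  0 <= ip (polyop P a f) f.
Proof.
have [sa a0 M0 aM] := aP => P0.
(* Bernstein polynomials require [M > 0]; for [M = 0] the operator is zero and [P] acts as the
   scalar [P.[0]]. *)
have [M_eq0|Mn0] := eqVneq 0 M.
  have E v : a v = 0.
    by apply: l2norm_eq0; apply/eqP; rewrite eq_le l2norm_ge0 andbT
      (le_trans (aM v))// -M_eq0 mul0r.
  have P00 : 0 <= P.[0] by apply: P0; rewrite lexx M0.
  suff -> : polyop P a f = P.[0]%:C *: f by rewrite ipZl ipff mulr_ge0 ?sqr_ge0.
  elim/poly_ind: P {P0 P00} => [|Q c IH]; first by rewrite polyop0 horner0 scale0r.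
  rewrite polyop_cons E hornerMXaddC mulr0 add0r.
  by rewrite (linear0 (polyop Q a)) add0r.
have Mp : 0 < M by rewrite lt_neqAle Mn0.
apply: (@ell_ge0 _ M Mp (fun P => ip (polyop P a f) f)) => //.
- by move=> c Q Q'; rewrite polyop_lin ipDl ipZl.
- by move=> Q; rewrite expr2 polyopM polyop_sym ipff sqr_ge0.
- move=> Q; rewrite expr2 mulrCA polyopM polyop_sym polyopM polyopX; exact: a0.
- move=> Q; rewrite expr2 mulrCA polyopM polyop_sym polyopM polyopD polyopC.
  rewrite -scaleN1r polyopZ polyopX ipDl !ipZl mulN1r ipff subr_ge0.
  apply: le_trans (ip_le _ _) _; rewrite expr2 mulrA ler_wpM2r ?l2norm_ge0//.
Qed.

(** Positivity of [C^2 - P^2] on [[0, M]]. *)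
Lemma polyop_norm P C f : 0 <= C -> (forall s, 0 <= s <= M -> `|P.[s]| <= C) ->
  l2norm (polyop P a f) <= C * l2norm f.
Proof.
move=> C0 PC; apply: le_of_sqr; first by rewrite mulr_ge0 ?l2norm_ge0.
rewrite exprMn -!ipff polyop_sym -polyopM ipC -subr_ge0.
have -> : C ^+ 2 * ip f f - ip (polyop (P * P) a f) f =
    ip (polyop ((C ^+ 2)%:P - P * P) a f) f.
  by rewrite -[- (P * P)]scaleN1r polyopD polyopZ polyopC ipDl !ipZl mulN1r.
apply: polyop_ge0 => s sM; rewrite hornerD hornerN hornerM hornerC subr_ge0.
by rewrite -expr2 -real_normK ?num_real// ler_pXn2r ?nnegrE//; exact: PC.
Qed.

End Pos.
End PolyOperators.

Lemma le0_eps (R : realType) (x C : R) : (forall e, 0 < e -> x <= C * e) -> x <= 0.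
Proof.
move=> H; rewrite leNgt; apply/negP => x0.
have C0 : 0 < C by have := H 1 ltr01; lra.
have := H (x / (2 * C)); rewrite divr_gt0 ?mulr_gt0// => /(_ isT).
rewrite (_ : C * (x / (2 * C)) = x / 2); last by field; rewrite gt_eqF.
lra.
Qed.

Section FunctionalCalculus.
Variables (R : realType) (T : groupType).
Local Open Scope complex_scope.
Local Notation l2 := (l2 R T).
Local Notation bop := (bop R T).
Implicit Types (P Q : {poly R}) (a b : bop) (f h v : l2) (phi psi : R -> R).

Section Opnorm.
Variables (A : l2 -> l2) (K : R).
Hypothesis AZ : forall c f, A (c%:C *: f) = c%:C *: A f.
Hypothesis AK : forall f, l2norm (A f) <= K * l2norm f.

Let A0 : A 0 = 0.
Proof. by have := AZ 0 0; rewrite rmorph0 !scale0r. Qed.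

Let bounded_img : has_sup [set l2norm (A f) | f in [set f | l2norm f <= 1]]%classic.
Proof.
split; first by exists (l2norm (A 0)); exists 0 => //=; rewrite l2norm0.
exists `|K| => _ [f /= f1 <-]; apply: le_trans (AK f) _.
apply: (@le_trans _ _ (`|K| * l2norm f)).
  by rewrite ler_wpM2r ?l2norm_ge0 ?ler_norm.
by rewrite ler_piMr.
Qed.

Lemma opnorm_ge0 : 0 <= opnorm A.
Proof.
apply: ub_le_sup; first by case: bounded_img.
by exists 0 => /=; rewrite ?A0 l2norm0.
Qed.

(** Proved for a bare homogeneous function, because [oppow] applies [opnorm] to a difference that is
    not packed as a [bop]. *)
Lemma opnorm_bound f : l2norm (A f) <= opnorm A * l2norm f.
Proof.
have [f0|fn0] := eqVneq (l2norm f) 0.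
  by apply: le_trans (AK f) _; rewrite f0 !mulr0.
have fp : 0 < l2norm f by rewrite lt_neqAle eq_sym fn0 l2norm_ge0.
rewrite -ler_pdivrMr//.
have -> : l2norm (A f) / l2norm f = l2norm (A ((l2norm f)^-1%:C *: f)).
  by rewrite AZ l2normZr ger0_norm ?invr_ge0 ?l2norm_ge0// mulrC.
apply: ub_le_sup; first by case: bounded_img.
exists ((l2norm f)^-1%:C *: f) => //=.
by rewrite l2normZr ger0_norm ?invr_ge0 ?l2norm_ge0// mulVf.
Qed.

Lemma opnorm_le C : 0 <= C -> (forall f, l2norm (A f) <= C * l2norm f) ->
  opnorm A <= C.
Proof.
move=> C0 AC; apply: ge_sup; first by case: bounded_img.
move=> _ [f /= f1 <-]; apply: le_trans (AC f) _; by rewrite ler_piMr.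
Qed.

End Opnorm.

Lemma bopZ a c f : a (c%:C *: f) = c%:C *: a f. Proof. exact: linearZ. Qed.

Lemma bop_opnorm a f : l2norm (a f) <= opnorm a * l2norm f.
Proof. by have [K aK] := bfun_bounded a; exact: (opnorm_bound (bopZ a) aK). Qed.

Lemma bop_opnorm_ge0 a : 0 <= opnorm a.
Proof. by have [K aK] := bfun_bounded a; exact: (opnorm_ge0 (bopZ a) aK). Qed.

Lemma bop_opnorm_le a C : 0 <= C -> (forall f, l2norm (a f) <= C * l2norm f) ->
  opnorm a <= C.
Proof. by have [K aK] := bfun_bounded a; exact: (opnorm_le aK). Qed.

(** [b] is [phi(a)] in the continuous functional calculus: the condition inside [oppow], for any
    function and interval, with a bound on each vector instead of [opnorm]. *)
Definition calc b phi a (M : R) := forall e, 0 < e -> exists P,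
  (forall s, 0 <= s <= M -> `|P.[s] - phi s| <= e) /\
  (forall v, l2norm (polyop P a v - b v) <= e * l2norm v).

Definition approximable phi (M : R) := forall e, 0 < e -> exists P : {poly R},
  forall s, 0 <= s <= M -> `|P.[s] - phi s| <= e.

Lemma polyopB P Q a v : polyop (P - Q) a v = polyop P a v - polyop Q a v.
Proof. by rewrite -[- Q]scaleN1r polyopD polyopZ rmorphN1 scaleN1r. Qed.

Lemma polyop_dist a M P Q e v : posop a M -> 0 <= e ->
  (forall s, 0 <= s <= M -> `|P.[s] - Q.[s]| <= e) ->
  l2norm (polyop P a v - polyop Q a v) <= e * l2norm v.
Proof.
move=> aM e0 PQ; rewrite -polyopB; apply: (polyop_norm aM) => // s sM.
by rewrite hornerD hornerN; exact: PQ.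
Qed.

(** Approximating polynomials [P n] make [P n (a) v] a Cauchy sequence with rate proportional to the
    norm of [v]. Its limit therefore depends linearly and boundedly on [v]. *)
Lemma calc_exists a M phi : posop a M -> approximable phi M ->
  exists b, calc b phi a M.
Proof.
move=> aM ap.
have /choice[P PP] : forall n : nat, exists P : {poly R}, forall s, 0 <= s <= M ->
    `|P.[s] - phi s| <= n.+1%:R^-1.
  by move=> n; apply: ap; rewrite invr_gt0.
have dist m n v : l2norm (polyop (P m) a v - polyop (P n) a v) <=
    (m.+1%:R^-1 + n.+1%:R^-1) * l2norm v.
  apply: (polyop_dist _ aM); first by rewrite addr_ge0 ?invr_ge0.
  move=> s sM; have := PP m s sM; have := PP n s sM => h1 h2.
  have -> : (P m).[s] - (P n).[s] = ((P m).[s] - phi s) - ((P n).[s] - phi s) by ring.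
  by apply: le_trans (ler_normB _ _) _; rewrite lerD.
have inv_small (e : R) : 0 < e -> exists N : nat, forall n, (N <= n)%N -> n.+1%:R^-1 <= e.
  move=> e0; have [N NP] := exists_natr_gt e^-1; exists N => n Nn.
  rewrite -[leRHS]invrK lef_pV2 ?posrE ?invr_gt0//.
  by apply: le_trans (ltW NP) _; rewrite ler_nat ltnW.
have /choice[B BP] : forall v, exists l : l2, forall e, 0 < e -> exists N,
    forall n, (N <= n)%N -> l2norm (polyop (P n) a v - l) <= e.
  move=> v; apply: (@l2_complete _ _ (fun n => polyop (P n) a v)) => e e0.
  have [N NP] := inv_small (e / (2 * (l2norm v + 1)))
    (divr_gt0 e0 (mulr_gt0 (ltr0Sn _ _) (ltr_wpDl (l2norm_ge0 v) ltr01))).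
  exists N => m n Nm Nn; apply: le_trans (dist m n v) _.
  have v0 := l2norm_ge0 v.
  apply: (@le_trans _ _ ((e / (2 * (l2norm v + 1)) *+ 2) * l2norm v)).
    by rewrite ler_wpM2r// mulr2n lerD// NP.
  rewrite -mulr_natl (_ : 2 * _ * _ = e * (l2norm v / (l2norm v + 1))); last first.
    by field; rewrite gt_eqF// ltr_wpDl.
  rewrite ler_piMr ?(ltW e0)// ler_pdivrMr ?mul1r ?lerDl//.
  by rewrite ltr_wpDl.
have Bn n v : l2norm (polyop (P n) a v - B v) <= n.+1%:R^-1 * l2norm v.
  rewrite -subr_le0; apply: (@le0_eps _ _ (l2norm v + 1)) => e e0.
  have [N1 N1P] := BP v e e0; have [N2 N2P] := inv_small e e0.
  pose m := maxn N1 N2.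
  have h1 := N1P m (leq_maxl _ _); have h2 := N2P m (leq_maxr _ _).
  rewrite lerBlDr.
  have -> : polyop (P n) a v - B v = (polyop (P n) a v - polyop (P m) a v) +
     (polyop (P m) a v - B v) by rewrite addrA subrK.
  apply: le_trans (l2norm_triangle _ _) _.
  apply: le_trans (lerD (dist n m v) h1) _.
  have v0 := l2norm_ge0 v.
  have : m.+1%:R^-1 * l2norm v <= e * l2norm v by rewrite ler_wpM2r.
  by move: (m.+1%:R^-1) (n.+1%:R^-1) => x y h; lra.
have Blin : linear B.
  move=> k f h; apply/eqP; rewrite -subr_eq0; apply/eqP/l2norm_eq0/eqP.
  rewrite eq_le l2norm_ge0 andbT.
  apply: (@le0_eps _ _ (l2norm (k *: f + h) + Num.sqrt (normsq k) * l2norm f + l2norm h)).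
  move=> e e0; have [N NP] := inv_small e e0.
  have -> : B (k *: f + h) - (k *: B f + B h) =
    - (polyop (P N) a (k *: f + h) - B (k *: f + h)) +
    (k *: (polyop (P N) a f - B f) + (polyop (P N) a h - B h)).
    rewrite (linearP (polyop (P N) a)) /= scalerBr.
    by rewrite opprB [X in _ = _ + X]addrACA -opprD addrA subrK.
  have Nn x : N.+1%:R^-1 * l2norm x <= e * l2norm x.
    by rewrite ler_wpM2r ?l2norm_ge0// NP.
  apply: le_trans (l2norm_triangle _ _) _; rewrite l2normN !mulrDl -addrA.
  apply: lerD; first by rewrite mulrC; apply: le_trans (Bn _ _) _.
  apply: le_trans (l2norm_triangle _ _) _; apply: lerD.
    apply: le_trans (l2normZ _ _) _; rewrite -mulrA ler_wpM2l ?sqrtr_ge0//.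
    by apply: le_trans (Bn _ _) _; rewrite [leRHS]mulrC.
  by apply: le_trans (Bn _ _) _; rewrite [leRHS]mulrC.
pose Bl : {linear l2 -> l2} := HB.pack B (GRing.isLinear.Build R[i] l2 l2 *:%R B Blin).
have Bb : exists K : R, forall f, l2norm (Bl f) <= K * l2norm f.
  have [K KP] := polyop_bounded (P 0%N) a; exists (1 + K) => f.
  have -> : Bl f = - (polyop (P 0%N) a f - B f) + polyop (P 0%N) a f.
    by rewrite opprB subrK.
  apply: le_trans (l2norm_triangle _ _) _; rewrite l2normN mulrDl lerD//.
  by apply: le_trans (Bn _ _) _; rewrite invr1.
exists (Bop Bb) => e e0; have [N NP] := inv_small e e0; exists (P N); split.
  by move=> s sM; apply: le_trans (PP N s sM) _; exact: NP.
move=> v; apply: le_trans (Bn N v) _.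
by rewrite ler_wpM2r ?l2norm_ge0// NP.
Qed.

End FunctionalCalculus.

Section PolyLipschitz.
Variables (R : realType) (T : groupType).
Local Open Scope complex_scope.
Local Notation l2 := (l2 R T).
Local Notation bop := (bop R T).

Lemma horner_lip (Q : {poly R}) (K : R) : 0 <= K -> exists L : R, 0 <= L /\
  forall x y, `|x| <= K -> `|y| <= K -> `|Q.[x] - Q.[y]| <= L * `|x - y|.
Proof.
move=> K0; suff [L [N [L0 [N0 [LP NP]]]]] : exists L N : R, 0 <= L /\ 0 <= N /\
  (forall x y, `|x| <= K -> `|y| <= K -> `|Q.[x] - Q.[y]| <= L * `|x - y|) /\
  (forall x, `|x| <= K -> `|Q.[x]| <= N) by exists L.
elim/poly_ind: Q => [|Q c [L [N [L0 [N0 [LP NP]]]]]].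
  exists 0, 0; do ! split => //; first by move=> x y _ _; rewrite !horner0 subrr normr0 mul0r.
  by move=> x _; rewrite horner0 normr0.
exists (L * K + N), (N * K + `|c|); split; first by rewrite addr_ge0 ?mulr_ge0.
split; first by rewrite addr_ge0 ?mulr_ge0.
split=> [x y xK yK|x xK]; rewrite !hornerMXaddC.
  have -> : Q.[x] * x + c - (Q.[y] * y + c) = (Q.[x] - Q.[y]) * x + Q.[y] * (x - y) by ring.
  apply: le_trans (ler_normD _ _) _; rewrite !normrM mulrDl; apply: lerD.
    by rewrite mulrAC; apply: ler_pM; rewrite ?normr_ge0//; exact: LP.
  by rewrite ler_wpM2r// NP.
apply: le_trans (ler_normD _ _) _; rewrite normrM lerD2r.
by apply: ler_pM; rewrite ?normr_ge0// NP.
Qed.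

(** Composition of functional calculi replaces the operator inside a fixed polynomial by an
    approximation. As in [horner_lip], a bound [N] on [Q] itself is carried through the induction
    because of the product rule. *)
Lemma polyop_lip (Q : {poly R}) (K : R) : 0 <= K -> exists L : R, 0 <= L /\
  forall (A B : bop) d, 0 <= d -> (forall v, l2norm (A v) <= K * l2norm v) ->
   (forall v, l2norm (B v) <= K * l2norm v) ->
   (forall v, l2norm (A v - B v) <= d * l2norm v) ->
   forall v, l2norm (polyop Q A v - polyop Q B v) <= L * d * l2norm v.
Proof.
move=> K0; suff [L [N [L0 [N0 [LP NP]]]]] : exists L N : R, 0 <= L /\ 0 <= N /\
  (forall (A B : bop) d, 0 <= d -> (forall v, l2norm (A v) <= K * l2norm v) ->
   (forall v, l2norm (B v) <= K * l2norm v) ->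
   (forall v, l2norm (A v - B v) <= d * l2norm v) ->
   forall v, l2norm (polyop Q A v - polyop Q B v) <= L * d * l2norm v) /\
  (forall (B : bop), (forall v, l2norm (B v) <= K * l2norm v) ->
   forall v, l2norm (polyop Q B v) <= N * l2norm v) by exists L.
elim/poly_ind: Q => [|Q c [L [N [L0 [N0 [LP NP]]]]]].
  exists 0, 0; do ! split => //.
    by move=> A B d _ _ _ _ v; rewrite !polyop0 subrr l2norm0 !mul0r.
  by move=> B _ v; rewrite polyop0 l2norm0 mul0r.
exists (L * K + N), (N * K + `|c|); split; first by rewrite addr_ge0 ?mulr_ge0.
split; first by rewrite addr_ge0 ?mulr_ge0.
split=> [A B d d0 AK BK AB v|B BK v]; rewrite !polyop_cons.
  have -> : polyop Q A (A v) + c%:C *: v - (polyop Q B (B v) + c%:C *: v) =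
     (polyop Q A (A v) - polyop Q B (A v)) + polyop Q B (A v - B v).
    by rewrite (linearB (polyop Q B)) addrA subrK opprD addrACA subrr addr0.
  apply: le_trans (l2norm_triangle _ _) _; rewrite !mulrDl; apply: lerD.
    apply: le_trans (LP A B d d0 AK BK AB _) _.
    by rewrite [L * K * d]mulrAC -!mulrA !ler_wpM2l.
  by apply: le_trans (NP B BK _) _; rewrite -mulrA ler_wpM2l.
apply: le_trans (l2norm_triangle _ _) _; rewrite l2normZr mulrDl lerD2r.
by apply: le_trans (NP B BK _) _; rewrite -mulrA ler_wpM2l.
Qed.

End PolyLipschitz.

Section CalcTheory.
Variables (R : realType) (T : groupType).
Local Open Scope complex_scope.
Local Notation l2 := (l2 R T).
Local Notation bop := (bop R T).
Implicit Types (P Q : {poly R}) (a b : bop) (f h v : l2) (phi psi : R -> R) (M : R).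

Lemma calc_norm a b phi M C : posop a M -> calc b phi a M -> 0 <= C ->
  (forall s, 0 <= s <= M -> `|phi s| <= C) -> forall v, l2norm (b v) <= C * l2norm v.
Proof.
move=> aM ba C0 phiC v; rewrite -subr_le0.
apply: (@le0_eps _ _ (2 * l2norm v)) => e e0; have [P [P1 P2]] := ba e e0.
have -> : b v = - (polyop P a v - b v) + polyop P a v by rewrite opprB subrK.
rewrite lerBlDr; apply: le_trans (l2norm_triangle _ _) _; rewrite l2normN.
have h : l2norm (polyop P a v) <= (C + e) * l2norm v.
  apply: (polyop_norm aM) => [|s sM]; first by rewrite addr_ge0// ltW.
  rewrite -[P.[s]](subrK (phi s)) addrC.
  by apply: le_trans (ler_normD _ _) _; rewrite lerD ?phiC ?P1.
have := P2 v; lra.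
Qed.

Lemma calc_approx a b phi M P e : posop a M -> calc b phi a M -> 0 <= e ->
  (forall s, 0 <= s <= M -> `|P.[s] - phi s| <= e) ->
  forall v, l2norm (polyop P a v - b v) <= e * l2norm v.
Proof.
move=> aM ba e0 Pe v; rewrite -subr_le0.
apply: (@le0_eps _ _ (2 * l2norm v)) => d d0; have [Q [Q1 Q2]] := ba d d0.
have -> : polyop P a v - b v = (polyop P a v - polyop Q a v) + (polyop Q a v - b v).
  by rewrite addrA subrK.
rewrite lerBlDr; apply: le_trans (l2norm_triangle _ _) _.
have h : l2norm (polyop P a v - polyop Q a v) <= (e + d) * l2norm v.
  apply: (polyop_dist _ aM) => [|s sM]; first by rewrite addr_ge0// ltW.
  have -> : P.[s] - Q.[s] = (P.[s] - phi s) - (Q.[s] - phi s) by ring.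
  by apply: le_trans (ler_normB _ _) _; rewrite lerD ?Pe ?Q1.
have := Q2 v; lra.
Qed.

Lemma calc_uniq a b b' phi psi M : posop a M -> calc b phi a M -> calc b' psi a M ->
  (forall s, 0 <= s <= M -> phi s = psi s) -> forall v, b v = b' v.
Proof.
move=> aM ba b'a pp v; apply/eqP; rewrite -subr_eq0; apply/eqP/l2norm_eq0/eqP.
rewrite eq_le l2norm_ge0 andbT; apply: (@le0_eps _ _ (2 * l2norm v)) => e e0.
have [P [P1 P2]] := ba e e0.
have h : l2norm (polyop P a v - b' v) <= e * l2norm v.
  by apply: (calc_approx aM b'a (ltW e0)) => s sM; rewrite -pp// P1.
have -> : b v - b' v = - (polyop P a v - b v) + (polyop P a v - b' v).
  by rewrite opprB addrA subrK.
apply: le_trans (l2norm_triangle _ _) _; rewrite l2normN.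
have := P2 v; lra.
Qed.

Lemma calc_posop a b phi M : posop a M -> calc b phi a M ->
  (forall s, 0 <= s <= M -> 0 <= phi s) -> posop b (opnorm b).
Proof.
move=> aM ba phi0; split.
- move=> f h; apply/eqP; rewrite -subr_eq0 -normr_eq0 eq_le normr_ge0 andbT.
  apply: (@le0_eps _ _ (2 * (l2norm f * l2norm h))) => e e0.
  have [P [_ P2]] := ba e e0.
  have -> : ip (b f) h - ip f (b h) = ip f (polyop P a h - b h) - ip (polyop P a f - b f) h.
    by rewrite ipBl ipBr (polyop_sym aM); lra.
  apply: le_trans (ler_normB _ _) _.
  have h1 : `|ip f (polyop P a h - b h)| <= l2norm f * (e * l2norm h).
    apply: le_trans (cauchy_schwarz _ _) _; by rewrite ler_wpM2l ?l2norm_ge0.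
  have h2 : `|ip (polyop P a f - b f) h| <= e * l2norm f * l2norm h.
    apply: le_trans (cauchy_schwarz _ _) _; by rewrite ler_wpM2r ?l2norm_ge0.
  lra.
- move=> f; rewrite -oppr_le0; apply: (@le0_eps _ _ (2 * l2norm f ^+ 2)) => e e0.
  have [P [P1 P2]] := ba e e0.
  have h1 : 0 <= ip (polyop (P + e%:P) a f) f.
    apply: (polyop_ge0 aM) => s sM; rewrite hornerD hornerC.
    have := P1 s sM; rewrite ler_norml => /andP[]; have := phi0 s sM; lra.
  rewrite polyopD polyopC ipDl ipZl ipff in h1.
  have h2 := ip_le (polyop P a f - b f) f; rewrite ipBl in h2.
  have h3 : l2norm (polyop P a f - b f) * l2norm f <= e * l2norm f * l2norm f.
    by rewrite ler_wpM2r ?l2norm_ge0.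
  rewrite expr2 in h1 *; lra.
- exact: bop_opnorm_ge0.
- exact: bop_opnorm.
Qed.

(** If [P] approximates [phi] and [Q] approximates [psi], then [Q] composed with [P] approximates
    the composite, both on scalars and on operators. [P] is chosen after [Q], with a precision that
    depends on the Lipschitz constants of [Q]. *)
Lemma calc_comp a b1 b2 phi psi M M1 : posop a M -> calc b1 phi a M ->
  0 <= M1 -> (forall s, 0 <= s <= M -> 0 <= phi s <= M1) ->
  (forall v, l2norm (b1 v) <= M1 * l2norm v) -> calc b2 psi b1 M1 ->
  calc b2 (psi \o phi) a M.
Proof.
move=> aM b1a M10 phiM b1M b2b e e0.
have e30 : 0 < e / 3 by rewrite divr_gt0.
have [Q [Q1 Q2]] := b2b _ e30.
(* The values of [P] may leave [[0, M1]], but by at most [d <= 1]; hence the radius [M1 + 1]. *)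
have K0 : 0 <= M1 + 1 by rewrite addr_ge0.
have [L1 [L10 L1P]] := horner_lip Q K0.
have [L2 [L20 L2P]] := @polyop_lip R T Q _ K0.
pose d := Num.min 1 (e / 3 / (L1 + L2 + 1)).
have LL : 0 < L1 + L2 + 1 by lra.
have d0 : 0 < d by rewrite lt_min ltr01 divr_gt0.
have d1 : d <= 1 by rewrite ge_min lexx.
have dL : (L1 + L2 + 1) * d <= e / 3.
  by rewrite mulrC -ler_pdivlMr// ge_min lexx orbT.
have [P [P1 P2]] := b1a d d0.
exists (Q \Po P); split.
  move=> s sM; rewrite horner_comp /=.
  have /andP[p0 p1] := phiM s sM; have hP := P1 s sM.
  have h1 := L1P P.[s] (phi s).
  have h2 : `|P.[s]| <= M1 + 1.
    rewrite -[P.[s]](subrK (phi s)) addrC; apply: le_trans (ler_normD _ _) _.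
    by rewrite lerD ?(ger0_norm p0)// (le_trans hP).
  have h3 : `|phi s| <= M1 + 1 by rewrite ger0_norm//; lra.
  have {}h1 := h1 h2 h3.
  have h4 := Q1 _ (phiM s sM).
  have -> : Q.[P.[s]] - psi (phi s) = (Q.[P.[s]] - Q.[phi s]) + (Q.[phi s] - psi (phi s)) by ring.
  apply: le_trans (ler_normD _ _) _.
  have h5 : L1 * `|P.[s] - phi s| <= L1 * d by rewrite ler_wpM2l.
  have h6 : 0 <= L2 * d by rewrite mulr_ge0// ltW.
  lra.
move=> v; rewrite polyop_comp.
have h1 : forall w, l2norm (pbop P a w) <= (M1 + 1) * l2norm w.
  move=> w /=; rewrite -[polyop P a w](subrK (b1 w)) addrC.
  apply: le_trans (l2norm_triangle _ _) _; rewrite mulrDl lerD//.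
  by apply: le_trans (P2 w) _; rewrite ler_wpM2r ?l2norm_ge0.
have h2 : forall w, l2norm (b1 w) <= (M1 + 1) * l2norm w.
  by move=> w; apply: le_trans (b1M w) _; rewrite ler_wpM2r ?l2norm_ge0// lerDl.
have h3 := L2P (pbop P a) b1 d (ltW d0) h1 h2 P2 v.
have -> : polyop Q (polyop P a) v - b2 v =
  (polyop Q (polyop P a) v - polyop Q b1 v) + (polyop Q b1 v - b2 v).
  by rewrite addrA subrK.
apply: le_trans (l2norm_triangle _ _) _.
have h4 := Q2 v.
have h5 : L2 * d * l2norm v <= e / 3 * l2norm v.
  rewrite ler_wpM2r ?l2norm_ge0//.
  have : 0 <= L1 * d by rewrite mulr_ge0// ltW.
  lra.
have h6 : e * l2norm v = e / 3 * l2norm v + e / 3 * l2norm v + e / 3 * l2norm v by field.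
have h7 : 0 <= e / 3 * l2norm v by rewrite mulr_ge0 ?l2norm_ge0// ltW.
apply: (@le_trans _ _ (L2 * d * l2norm v + e / 3 * l2norm v)); first exact: lerD h3 h4.
lra.
Qed.

(** [calc_exists] shows that the set from which [oppow] chooses is inhabited, so [xget] returns a
    genuine power and not its default [bop0]. *)
Lemma oppow_calc a r : posop a (opnorm a) -> r = 2^-1 \/ 1 <= r ->
  calc (oppow a r) (fun s => s `^ r) a (opnorm a).
Proof.
move=> aM r1; have [_ _ M0 _] := aM.
have [b ba] := calc_exists aM (powR_approx r1 M0).
have hom p (b' : bop) : (forall c f, polyop p a (c%:C *: f) - b' (c%:C *: f) =
    c%:C *: (polyop p a f - b' f)).
  move=> c f; have /= -> := bopZ (pbop p a) c f.
  by rewrite bopZ scalerBr.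
have bdd p (b' : bop) : exists K : R, forall f,
    l2norm (polyop p a f - b' f) <= K * l2norm f.
  exists (opnorm (pbop p a) + opnorm b') => f.
  apply: le_trans (l2norm_triangle _ _) _; rewrite l2normN mulrDl lerD//.
    exact: (bop_opnorm (pbop p a)).
  exact: bop_opnorm.
have : exists b, [set b : bop | forall e : R, 0 < e -> exists p : {poly R},
    (forall s, 0 <= s <= opnorm a -> `|p.[s] - s `^ r| <= e) /\
    opnorm (fun f => polyop p a f - b f) <= e]%classic b.
  exists b => e e0; have [p [p1 p2]] := ba e e0; exists p; split=> //.
  have [K KP] := bdd p b.
  by apply: (opnorm_le KP) => //; exact: ltW.
move=> /(xgetPex (bop0 R T)) H e e0; have [p [p1 p2]] := H e e0.
exists p; split=> // v; have [K KP] := bdd p (oppow a r).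
apply: le_trans (opnorm_bound (hom p (oppow a r)) KP v) _.
by rewrite ler_wpM2r ?l2norm_ge0.
Qed.

Lemma posop_bcomp (x S : bop) : (forall f h, dot (x f) h = dot f (S h)) ->
  posop (bcomp S x) (opnorm (bcomp S x)).
Proof.
move=> xS; have xS' f h : ip (x f) h = ip f (S h) by rewrite -!Re_dot xS.
split; last exact: (bop_opnorm (bcomp S x)); last exact: (bop_opnorm_ge0 (bcomp S x)).
- by move=> f h /=; rewrite ipC -xS' -xS' ipC.
- by move=> f /=; rewrite ipC -xS' ipff sqr_ge0.
Qed.

Lemma adjointP (x : bop) : (exists S : bop, forall f h, dot (x f) h = dot f (S h)) ->
  forall f h, dot (x f) h = dot f (adjoint x h).
Proof. by move=> /(xgetPex (bop0 R T)). Qed.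

Lemma l2norm_delta (g : T) : l2norm (delta R g) = 1.
Proof.
rewrite /l2norm (_ : l2sq _ = 1%:E) ?sqrtr1// /l2sq.
rewrite (@eq_esum _ _ _ _ (fun i => if i \in [set g]%classic then 1%E else 0%E)).
  by rewrite -esum_mkcond esum_set1.
move=> h _; have [->|/eqP hg] := eqVneq h g.
  by rewrite mem_set//= eqxx /normsq /= expr1n expr0n addr0.
by rewrite memNset//= (negbTE (introN eqP hg)) /normsq /= expr0n addr0.
Qed.

(** Composing the calculi of [s^(1/2)] and [s^q] identifies the [q]-th power of the absolute value
    with the power [q / 2] of [x^* x]. From here on the absolute value no longer appears. *)
Lemma Lpnorm_calc (x : vN R T) q :
  (exists S : bop, forall f h, dot (vNop x f) h = dot f (S h)) -> 1 <= q ->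
  let a := bcomp (adjoint x) x in
  posop a (opnorm a) /\ exists b, calc b (fun s => s `^ (q / 2)) a (opnorm a) /\
   0 <= Lpnorm q x /\ Lpnorm q x `^ q = ip (b (delta R 1%g)) (delta R 1%g).
Proof.
move=> ex q1 a; have xS := adjointP ex.
have aM : posop a (opnorm a) := posop_bcomp xS; split=> //.
have [_ _ M0 _] := aM; set M := opnorm a in aM M0 *.
have b1a : calc (absop x) (fun s => s `^ 2^-1) a M by apply: oppow_calc => //; left.
set b1 := absop x in b1a.
have pos1 s : 0 <= s <= M -> 0 <= s `^ 2^-1 by move=> _; exact: powR_ge0.
have b1P : posop b1 (opnorm b1) := calc_posop aM b1a pos1.
have b2b : calc (oppow b1 q) (fun s => s `^ q) b1 (opnorm b1).
  by apply: oppow_calc => //; right.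
have sqM s : 0 <= s <= M -> 0 <= s `^ 2^-1 <= M `^ 2^-1.
  move=> /andP[s0 sM]; rewrite powR_ge0/=.
  by apply: ge0_ler_powR; rewrite ?nnegrE ?invr_ge0.
have b1M : forall v, l2norm (b1 v) <= M `^ 2^-1 * l2norm v.
  apply: (calc_norm aM b1a); first exact: powR_ge0.
  by move=> s sM; rewrite ger0_norm ?powR_ge0//; case/andP: (sqM s sM).
have b1sq : calc (bcomp b1 b1) (fun s => s ^+ 2) b1 (M `^ 2^-1).
  move=> e e0; exists 'X^2; split=> [s _|v].
    by rewrite hornerXn subrr normr0 ltW.
  by rewrite expr2 polyopM !polyopX /= subrr l2norm0 mulr_ge0 ?l2norm_ge0// ltW.
have := calc_comp aM b1a (powR_ge0 _ _) sqM b1M b1sq => sq.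
have aa : calc a id a M.
  move=> e e0; exists 'X; split=> [s _|v].
    by rewrite hornerX subrr normr0 ltW.
  by rewrite polyopX subrr l2norm0 mulr_ge0 ?l2norm_ge0// ltW.
have b1b1 v : b1 (b1 v) = a v.
  have := calc_uniq aM sq aa; apply => s /andP[s0 _] /=.
  by rewrite powR12_sqrt// sqr_sqrtr.
(* The calculus of [oppow b1 q] lives on [[0, opnorm b1]]; this bound makes the square root map
   [[0, M]] into it. *)
have Mb : M <= opnorm b1 ^+ 2.
  apply: bop_opnorm_le => [|f]; first exact: sqr_ge0.
  rewrite -b1b1; apply: le_trans (bop_opnorm b1 _) _.
  by rewrite expr2 -mulrA ler_wpM2l ?bop_opnorm_ge0// bop_opnorm.
have sqb s : 0 <= s <= M -> 0 <= s `^ 2^-1 <= opnorm b1.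
  move=> sM; have /andP[-> h] /= := sqM s sM; apply: le_trans h _.
  rewrite powR12_sqrt// -(@ler_pXn2r _ 2)// ?nnegrE ?sqrtr_ge0 ?bop_opnorm_ge0//.
  by rewrite sqr_sqrtr.
have b2a := calc_comp aM b1a (bop_opnorm_ge0 b1) sqb (bop_opnorm b1) b2b.
exists (oppow b1 q); split.
  have E : (fun s : R => s `^ q) \o (fun s => s `^ 2^-1) = (fun s => s `^ (q / 2)).
    by apply/funext => s /=; rewrite -powRrM mulrC.
  by rewrite -E.
split; first exact: powR_ge0.
have pos2 s : 0 <= s <= opnorm b1 -> 0 <= s `^ q by move=> _; exact: powR_ge0.
have [_ p2 _ _] := calc_posop b1P b2b pos2.
rewrite /Lpnorm -powRrM mulVf ?powRr1//.
  by rewrite /tau Re_dot; exact: p2.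
by rewrite gt_eqF//; lra.
Qed.

Lemma Lpnorm_approx (x : vN R T) q (P : {poly R}) e M :
  (exists S : bop, forall f h, dot (vNop x f) h = dot f (S h)) -> 1 <= q -> 0 <= e ->
  let a := bcomp (adjoint x) x in opnorm a <= M ->
  (forall s, 0 <= s <= M -> `|P.[s] - s `^ (q / 2)| <= e) ->
  `|Lpnorm q x `^ q - ip (polyop P a (delta R 1%g)) (delta R 1%g)| <= e.
Proof.
move=> ex q1 e0 a aM Pe; have [pa [b [ba [_ ->]]]] := Lpnorm_calc ex q1.
rewrite -/a distrC -ipBl; apply: le_trans (cauchy_schwarz _ _) _.
rewrite l2norm_delta mulr1.
have := calc_approx pa ba e0 _ (delta R 1%g); rewrite l2norm_delta mulr1; apply.
by move=> s /andP[s0 sM]; apply: Pe; rewrite s0 (le_trans sM).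
Qed.

(** The sign [c] treats majorants and minorants at once. *)
Lemma Lpnorm_poly_compare (c : R) (x : vN R T) q (P : {poly R}) :
  (exists S : bop, forall f h, dot (vNop x f) h = dot f (S h)) -> 1 <= q ->
  let a := bcomp (adjoint x) x in c = 1 \/ c = -1 ->
  (forall s, 0 <= s -> c * s `^ (q / 2) <= c * P.[s]) ->
  c * Lpnorm q x `^ q <= c * ip (polyop P a (delta R 1%g)) (delta R 1%g).
Proof.
move=> ex q1 a c1 Pe; have [pa [b [ba [_ ->]]]] := Lpnorm_calc ex q1.
rewrite -/a in ba *; rewrite -subr_le0; apply: (@le0_eps _ _ 2) => e e0.
have [Q [Q1 Q2]] := ba e e0.
(* [Q] stands for the power up to [e], so [c P + e - c Q] is nonnegative on [[0, M]]. *)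
have h1 : 0 <= ip (polyop (c *: P + e%:P - c *: Q) a (delta R 1%g)) (delta R 1%g).
  apply: (polyop_ge0 pa) => s sM; rewrite !hornerD hornerN hornerC !hornerZ.
  have := Q1 s sM; rewrite ler_norml => /andP[].
  have /andP[s0 _] := sM; have := Pe s s0; case: c1 => ->; lra.
rewrite polyopB ipBl polyopD ipDl polyopC !polyopZ !ipZl ipff l2norm_delta expr1n in h1.
have h2 := cauchy_schwarz (polyop Q a (delta R 1%g) - b (delta R 1%g)) (delta R 1%g).
have := Q2 (delta R 1%g); rewrite l2norm_delta mulr1 in h2 * => h3.
rewrite ipBl ler_norml in h2; have /andP[h4 h5] := h2.
by move: c1 h1 => [->|->]; lra.
Qed.

Lemma Lpnorm_le_poly (x : vN R T) q (P : {poly R}) :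
  (exists S : bop, forall f h, dot (vNop x f) h = dot f (S h)) -> 1 <= q ->
  let a := bcomp (adjoint x) x in
  (forall s, 0 <= s -> s `^ (q / 2) <= P.[s]) ->
  Lpnorm q x `^ q <= ip (polyop P a (delta R 1%g)) (delta R 1%g).
Proof.
move=> ex q1 a Pe; have := @Lpnorm_poly_compare 1 x q P ex q1 (or_introl erefl).
by rewrite !mul1r; apply=> s s0; rewrite !mul1r; exact: Pe.
Qed.

Lemma Lpnorm_ge_poly (x : vN R T) q (P : {poly R}) :
  (exists S : bop, forall f h, dot (vNop x f) h = dot f (S h)) -> 1 <= q ->
  let a := bcomp (adjoint x) x in
  (forall s, 0 <= s -> P.[s] <= s `^ (q / 2)) ->
  ip (polyop P a (delta R 1%g)) (delta R 1%g) <= Lpnorm q x `^ q.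
Proof.
move=> ex q1 a Pe; have := @Lpnorm_poly_compare (-1) x q P ex q1 (or_intror erefl).
by rewrite !mulN1r lerN2; apply=> s s0; rewrite !mulN1r lerN2; exact: Pe.
Qed.

End CalcTheory.

(** * The group algebra *)

Section GroupAlgebra.
Variables (R : realType) (G : groupType).
Local Open Scope complex_scope.
Local Open Scope fset_scope.
Local Notation C := R[i].
Local Notation l2 := (l2 R G).
Local Notation A := (grpalg R G).
Implicit Types (u v w : A) (f h : l2) (a b c g : G).

Lemma l2_sumE (J : Type) (r : seq J) (P : pred J) (F : J -> l2) g :
  (\sum_(j <- r | P j) F j) g = \sum_(j <- r | P j) F j g.
Proof. by elim/big_rec2: _ => [|j x y _ <-]; rewrite ?l2_0 ?l2D. Qed.

Lemma lregE a f g : lreg R a f g = f (a^-1 * g)%g. Proof. by []. Qed.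

Lemma lsumE u f g : lsum u f g = \sum_(a <- finsupp u) u a * f (a^-1 * g)%g.
Proof. by rewrite /lsum /= /lsum_fun l2_sumE; apply: eq_bigr => a _. Qed.

Lemma lsum_sub (S : {fset G}) u f : finsupp u `<=` S ->
  lsum u f = \sum_(a <- S) u a *: lreg R a f.
Proof.
move=> uS; rewrite /lsum /= /lsum_fun (big_fset_incl _ uS)// => a _ au.
by rewrite (fsfun_dflt au) scale0r.
Qed.

Definition star u : A :=
  [fsfun g in [fset (a^-1)%g | a in finsupp u] => (u (g^-1)%g)^*].

Definition conv u v : A :=
  [fsfun g in [fset (a * b)%g | a in finsupp u, b in finsupp v] =>
     \sum_(a <- finsupp u) u a * v (a^-1 * g)%g].

Lemma starE u g : star u g = (u (g^-1)%g)^*.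
Proof.
rewrite fsfunE; case: ifPn => // gS; rewrite fsfun_dflt ?conjc0//.
apply: contraNN gS => gu; apply/imfsetP; exists (g^-1)%g => //.
by rewrite invgK.
Qed.

Lemma convE u v g : conv u v g = \sum_(a <- finsupp u) u a * v (a^-1 * g)%g.
Proof.
rewrite fsfunE; case: ifPn => // gS; rewrite big_seq big1// => a au.
rewrite [v _]fsfun_dflt ?mulr0//; apply: contraNN gS => av.
by apply/imfset2P; exists a => //; exists (a^-1 * g)%g => //; rewrite mulVKg.
Qed.

Lemma finsupp_conv u v : finsupp (conv u v) `<=`
  [fset (a * b)%g | a in finsupp u, b in finsupp v].
Proof. exact: finsupp_sub. Qed.

Lemma ip_lreg a f h : ip (lreg R a f) h = ip f (lreg R (a^-1)%g h).
Proof.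
rewrite /ip -[RHS](rsum_shift _ (a^-1)%g); apply: eq_rsum => g.
by rewrite !lregE invgK mulVKg.
Qed.

Lemma ip_lsum u f h : ip (lsum u f) h = ip f (lsum (star u) h).
Proof.
rewrite (lsum_sub f (fsubset_refl _)) (lsum_sub h (S := [fset (a^-1)%g | a in finsupp u])); last first.
  exact: finsupp_sub.
rewrite big_imfset /=; last by move=> a b _ _; exact: invg_inj.
rewrite ip_suml ip_sumr; apply: eq_bigr => a _.
by rewrite starE invgK ipZ ip_lreg linearZ.
Qed.

Lemma dot_lsum u f h : dot (lsum u f) h = dot f (lsum (star u) h).
Proof. by rewrite !dotE -!ip_lsum linearZ. Qed.

Lemma lsum_adjoint u : exists S : bop R G, forall f h,
  dot (lsum u f) h = dot f (S h).
Proof. by exists (lsum (star u)) => f h; exact: dot_lsum. Qed.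

Lemma adjoint_lsum u f : adjoint (lsum u) f = lsum (star u) f.
Proof.
apply: ip_ext => k; rewrite -ip_lsum -!Re_dot.
by rewrite -(adjointP (lsum_adjoint u)).
Qed.

Lemma inv_mulg a b : ((a * b)^-1 = b^-1 * a^-1)%g.
Proof. by apply: mulg1_eq; rewrite mulgA mulgK mulgV. Qed.

Lemma mulVg_eq1 a g : (a^-1 * g == 1)%g = (a == g).
Proof. by rewrite mulg_eq1 eqg_inv. Qed.

Lemma lreg_mul a b f : lreg R a (lreg R b f) = lreg R (a * b)%g f.
Proof. by apply: l2_ext => g; rewrite !lregE inv_mulg mulgA. Qed.

Lemma lsum_conv u v f : lsum (conv u v) f = lsum u (lsum v f).
Proof.
set S := [fset (a * b)%g | a in finsupp u, b in finsupp v].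
rewrite (lsum_sub f (finsupp_conv u v)) (lsum_sub _ (fsubset_refl (finsupp u))).
transitivity (\sum_(a <- finsupp u) \sum_(c <- S)
    (u a * v (a^-1 * c)%g) *: lreg R c f).
  rewrite exchange_big; apply: eq_bigr => c _; rewrite convE.
  by rewrite scaler_suml.
rewrite [LHS]big_seq [RHS]big_seq; apply: eq_bigr => a au.
rewrite (lsum_sub f (fsubset_refl (finsupp v))) linear_sum scaler_sumr.
have sub : [fset (a * b)%g | b in finsupp v] `<=` S.
  apply/fsubsetP => c /imfsetP[b /= bv ->]; apply/imfset2P.
  by exists a => //; exists b.
rewrite -(big_fset_incl _ sub) => [|c _ cS]; last first.
  rewrite [v _]fsfun_dflt ?mulr0 ?scale0r//; apply: contraNN cS => cv.
  by apply/imfsetP; exists (a^-1 * c)%g => //; rewrite mulVKg.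
rewrite big_imfset /=; last by move=> b b' _ _; exact: mulgI.
by apply: eq_bigr => b _; rewrite mulKg linearZ scalerA lreg_mul.
Qed.

Definition vec u : l2 := lsum u (delta R 1%g).

Lemma vecE u g : vec u g = u g.
Proof.
rewrite /vec lsumE /=.
transitivity (\sum_(a <- finsupp u) if a == g then u g else 0).
  apply: eq_bigr => a _; rewrite mulVg_eq1; case: eqP => [->|_].
    by rewrite mulr1.
  by rewrite mulr0.
rewrite -big_mkcond; case: (boolP (g \in finsupp u)) => gu.
  by rewrite -big_filter filter_pred1_uniq// big_seq1.
by rewrite (fsfun_dflt gu) big1.
Qed.

Lemma vec_conv u v : vec (conv u v) = lsum u (vec v).
Proof. exact: lsum_conv. Qed.

Definition nrm u : R := l2norm (vec u).

Lemma nrm_ge0 u : 0 <= nrm u. Proof. exact: l2norm_ge0. Qed.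

Lemma ip_vec (S : {fset G}) u f : finsupp u `<=` S ->
  ip (vec u) f = \sum_(g <- S) complex.Re (u g * (f g)^*).
Proof.
move=> uS; rewrite /vec (lsum_sub _ uS) ip_suml; apply: eq_bigr => a _.
rewrite /ip.
pose t := complex.Re (u a * (f a)^*).
have E g : complex.Re ((u a *: lreg R a (delta R 1%g)) g * (f g)^*) =
    if g == a then t else 0.
  rewrite l2Z lregE /= mulVg_eq1 [g == a]eq_sym; case: eqP => [<-|_].
    by rewrite mulr1.
  by rewrite mulr0 mul0r.
rewrite (eq_rsum E) -/t.
have P (s : R) : (0 <= s) -> rsum (fun g => if g == a then s else 0) = s.
  move=> s0; rewrite rsum_ge0E => [|g]; last by case: ifP.
  rewrite -[RHS]/(fine s%:E); congr fine.
  rewrite (@eq_esum _ _ _ _ (fun g => if g \in [set a]%classic then s%:E else 0%E)).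
    by rewrite -esum_mkcond esum_set1.
  move=> g _; have [->|/eqP ga] := eqVneq g a.
    by rewrite mem_set.
  by rewrite memNset.
have [t0|t0] := leP 0 t; first exact: P.
have := P (- t); rewrite oppr_ge0 (ltW t0) => /(_ isT).
rewrite (@eq_rsum _ _ _ (fun g => -1 * (if g == a then t else 0))).
  rewrite rsumZ; first by move=> h; lra.
  rewrite /asummable.
  rewrite (@eq_esum _ _ _ _ (fun g => if g \in [set a]%classic then (`|t|)%:E else 0%E)).
    by rewrite -esum_mkcond esum_set1 ?ltry// lee_fin.
  move=> g _; have [->|/eqP ga] := eqVneq g a; first by rewrite mem_set.
  by rewrite memNset// normr0.
by move=> g; case: ifP; rewrite ?mulr0 ?mulN1r.
Qed.

Lemma nrm_sqr (S : {fset G}) u : finsupp u `<=` S ->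
  nrm u ^+ 2 = \sum_(g <- S) normsq (u g).
Proof.
move=> uS; rewrite -ipff (ip_vec _ uS); apply: eq_bigr => g _.
by rewrite vecE; case: (u g) => [x y]; rewrite /normsq /=; ring.
Qed.

End GroupAlgebra.

(** * Finite sums: Cauchy-Schwarz and triangle inequalities *)

Section CauchySchwarzSums.
Variable R : realType.

Lemma exchange_sum (J K : Type) (r : seq J) (s : seq K) (f : J -> K -> R) :
  \sum_(j <- r) \sum_(k <- s) f j k = \sum_(k <- s) \sum_(j <- r) f j k.
Proof. exact: exchange_big. Qed.

Lemma cs_sum (J : Type) (r : seq J) (P : pred J) (x y : J -> R) :
  (\sum_(j <- r | P j) x j * y j) ^+ 2 <=
  (\sum_(j <- r | P j) x j ^+ 2) * (\sum_(j <- r | P j) y j ^+ 2).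
Proof.
have X0 (z : J -> R) s : 0 <= \sum_(j <- s | P j) z j ^+ 2.
  by apply: sumr_ge0 => j _; exact: sqr_ge0.
elim: r => [|j r IH]; first by rewrite !big_nil mul0r expr0n.
rewrite !big_cons; case: (P j) => //.
have := X0 x r; have := X0 y r; move: IH.
set S := \sum_(_ <- _ | _) _ * _; set A := \sum_(_ <- _ | _) x _ ^+ 2.
set B := \sum_(_ <- _ | _) _ => IH B0 A0.
move: (x j) (y j) => a b.
have h : (2 * (a * b * S)) ^+ 2 <= (a ^+ 2 * B + b ^+ 2 * A) ^+ 2.
  have h1 : a ^+ 2 * b ^+ 2 * S ^+ 2 <= a ^+ 2 * b ^+ 2 * (A * B).
    apply: ler_wpM2l; last exact: IH.
    apply: mulr_ge0; exact: sqr_ge0.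
  have h2 := sqr_ge0 (a ^+ 2 * B - b ^+ 2 * A).
  nra.
have h3 : 0 <= a ^+ 2 * B + b ^+ 2 * A.
  by apply: addr_ge0; apply: mulr_ge0 => //; exact: sqr_ge0.
have h4 : 2 * (a * b * S) <= a ^+ 2 * B + b ^+ 2 * A.
  exact: le_of_sqr.
nra.
Qed.

Definition md (z : R[i]) : R := Num.sqrt (normsq z).

Lemma md_ge0 z : 0 <= md z. Proof. exact: sqrtr_ge0. Qed.
Lemma md_sqr z : md z ^+ 2 = normsq z. Proof. by rewrite sqr_sqrtr ?normsq_ge0. Qed.
Lemma mdM z w : md (z * w) = md z * md w.
Proof. by rewrite /md normsqM sqrtrM ?normsq_ge0. Qed.

Lemma normsqD_le z w a b : 0 <= a -> 0 <= b -> normsq z <= a ^+ 2 ->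
  normsq w <= b ^+ 2 -> normsq (z + w) <= (a + b) ^+ 2 :> R.
Proof.
case: z w => [x y] [x' y']; rewrite /normsq /= => a0 b0 h1 h2.
have h3 : (x * x' + y * y') ^+ 2 <= (a * b) ^+ 2.
  apply: (@le_trans _ _ ((x ^+ 2 + y ^+ 2) * (x' ^+ 2 + y' ^+ 2))).
    rewrite -subr_ge0 (_ : _ - _ = (x * y' - y * x') ^+ 2) ?sqr_ge0//; ring.
  by rewrite exprMn ler_pM// addr_ge0 ?sqr_ge0.
have h4 : x * x' + y * y' <= a * b.
  by apply: le_of_sqr => //; exact: mulr_ge0.
nra.
Qed.

Lemma normsq_sum_le (J : Type) (r : seq J) (P : pred J) (F : J -> R[i]) :
  normsq (\sum_(j <- r | P j) F j) <= (\sum_(j <- r | P j) md (F j)) ^+ 2 :> R.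
Proof.
elim: r => [|j r IH]; first by rewrite !big_nil /normsq /= expr0n addr0.
rewrite !big_cons; case: (P j) => //; apply: normsqD_le => //.
- exact: md_ge0.
- by apply: sumr_ge0 => k _; exact: md_ge0.
- by rewrite md_sqr.
Qed.

Lemma normsq_cs (J : Type) (r : seq J) (P : pred J) (z w : J -> R[i]) :
  normsq (\sum_(j <- r | P j) z j * w j) <=
  (\sum_(j <- r | P j) normsq (z j)) * (\sum_(j <- r | P j) normsq (w j)) :> R.
Proof.
apply: le_trans (normsq_sum_le _ _ _) _.
under eq_bigr do rewrite mdM; apply: le_trans (cs_sum _ _ _ _) _.
by under eq_bigr do rewrite md_sqr; under [X in _ * X]eq_bigr do rewrite md_sqr.
Qed.

Lemma sum_const_inj (J : eqType) (s : seq J) (Q : pred J) (c : R) : uniq s ->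
  (forall g h, Q g -> Q h -> g = h) -> 0 <= c -> \sum_(g <- s | Q g) c <= c.
Proof.
move=> us QQ c0; rewrite -big_filter.
have : uniq [seq x <- s | Q x] by rewrite filter_uniq.
have : {in [seq x <- s | Q x] &, forall g h, g = h}.
  by move=> g h; rewrite !mem_filter => /andP[Qg _] /andP[Qh _]; exact: QQ.
case: [seq x <- s | Q x] => [|x [|y t]] eqt; rewrite ?big_nil ?big_seq1//.
rewrite /= inE negb_or => /andP[/andP[/eqP + _] _].
by case; apply: eqt; rewrite !inE eqxx ?orbT.
Qed.

Lemma sum_subset_le (J : choiceType) (X V : {fset J}) (f : J -> R) :
  (X `<=` V)%fset -> (forall j, 0 <= f j) -> \sum_(j <- X) f j <= \sum_(j <- V) f j.
Proof.
move=> XV f0.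
apply: (@le_trans _ _ (\sum_(j <- V) if j \in X then f j else 0)).
  rewrite -(big_fset_incl _ XV) => [|j _ /negbTE -> //].
  rewrite big_seq [leRHS]big_seq; apply: ler_sum => j -> //.
by apply: ler_sum => j _; case: ifP.
Qed.

End CauchySchwarzSums.

(** * Haagerup's inequality *)

Section Words.
Variable I : choiceType.
Local Notation letter := (I * bool)%type.

(** [l] is the number of letters cancelled on each side. Prepending [a] to [u] changes it only if
    all of [u] has been cancelled, since otherwise [a] meets a letter of the reduced word
    [a :: u]. *)
Lemma wmul_split (u v : seq letter) : reduced u -> exists l : nat,
  [/\ (l <= size u)%N, (l <= size v)%N &
      wmul u v = take (size u - l) u ++ drop l v].
Proof.
elim: u => [|a u IH] ru; first by exists 0%N; rewrite drop0.
have [l [lu lv E]] := IH (reduced_behead ru); rewrite [wmul _ _]/= -/(wmul u v) E.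
have [lt|ge] := ltnP l (size u).
  exists l; split => //=; first exact: ltnW.
  rewrite subSn// /=; case: u ru lt {IH E lu} => // b u /= /andP[ba _] lt.
  by rewrite subSn//= (negbTE ba).
have El : l = size u by apply/eqP; rewrite eqn_leq lu ge.
rewrite El subnn take0 cat0s -El.
case Ed: (drop l v) => [|b w] /=.
  exists l; split; rewrite ?El ?leqW -?El//= subSn ?El// subnn /= take0.
  by rewrite -El Ed.
have lv' : (l < size v)%N by rewrite ltnNge; apply/negP => /drop_oversize; rewrite Ed.
case: eqP => ba; last first.
  exists l; split; rewrite ?El ?leqW -?El//= subSn ?El// subnn /= take0.
  by rewrite -El Ed.
exists l.+1; split => //.
by rewrite subSS El subnn take0 cat0s -El -[l.+1]add1n -drop_drop Ed /= drop0.
Qed.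

Local Notation F := (freegroup I).

Lemma fg_split (a b : F) : exists l : nat, [/\ (l <= fglen a)%N, (l <= fglen b)%N &
  fgword (a * b)%g = take (fglen a - l) (fgword a) ++ drop l (fgword b)].
Proof. exact: wmul_split (fgwordP a). Qed.

Lemma fg_ext (a b : F) : fgword a = fgword b -> a = b.
Proof. exact: val_inj. Qed.

Lemma fglen_split (a b : F) l : (l <= fglen a)%N -> (l <= fglen b)%N ->
  fgword (a * b)%g = take (fglen a - l) (fgword a) ++ drop l (fgword b) ->
  fglen (a * b)%g = (fglen a - l + (fglen b - l))%N.
Proof.
move=> la lb E; rewrite {1}/fglen E size_cat size_drop size_take.
rewrite -/(fglen a) -/(fglen b); case: ltnP => // h.
by congr (_ + _)%N; apply/eqP; rewrite eqn_leq h leq_subr.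
Qed.

End Words.

Section Haagerup.
Variables (R : realType) (I : choiceType).
Local Open Scope fset_scope.
Local Notation F := (freegroup I).
Local Notation A := (grpalg R F).
Implicit Types (u v w : A) (a b g : F).

(** A product [g = a b] of this length arises with exactly [l] cancellations, so [g] shows the kept
    prefix of [a] and the kept suffix of [b]. Cauchy-Schwarz over the cancelled middle bounds the
    coefficient by [X g * Y g]; in the sum over [g] each pair [(a, b)] is then counted at most once,
    because prefix and suffix determine [g]. *)
Lemma haagerup_basic (i j l : nat) u v (S : {fset F}) :
  (forall a, a \in finsupp u -> fglen a = i) ->
  (forall a, a \in finsupp v -> fglen a = j) -> (l <= i)%N -> (l <= j)%N ->
  \sum_(g <- S | fglen g == (i - l + (j - l))%N) normsq (conv u v g) <=
  (\sum_(a <- finsupp u) normsq (u a)) * (\sum_(b <- finsupp v) normsq (v b)).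
Proof.
move=> ui vj li lj; set D := (i - l + (j - l))%N.
pose tk g := take (i - l) (fgword g); pose dk g := drop (i - l) (fgword g).
pose X g := \sum_(a <- finsupp u | take (i - l) (fgword a) == tk g) normsq (u a).
pose Y g := \sum_(b <- finsupp v | drop l (fgword b) == dk g) normsq (v b).
apply: (@le_trans _ _ (\sum_(g <- S | fglen g == D) X g * Y g)).
  apply: ler_sum => g /eqP gD.
  pose P a := (a^-1 * g)%g \in finsupp v.
  have split a : a \in finsupp u -> P a -> take (i - l) (fgword a) = tk g /\
      drop l (fgword (a^-1 * g)%g) = dk g.
    move=> au Pa; have [l' [l'a l'b E]] := fg_split a (a^-1 * g)%g.
    have L := fglen_split l'a l'b E.
    rewrite mulVKg (ui _ au) (vj _ Pa) in E L; rewrite (ui _ au) (vj _ Pa) in l'a l'b.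
    (* The length of [g] fixes the number of cancellations. *)
    have ll : l' = l.
      move: L; rewrite gD /D; lia.
    rewrite ll in E; rewrite /tk /dk E.
    have sz : size (take (i - l) (fgword a)) = (i - l)%N.
      rewrite size_take -/(fglen a) (ui _ au); case: ltnP => // h.
      by apply/eqP; rewrite eqn_leq h leq_subr.
    by rewrite take_cat drop_cat sz ltnn subnn take0 drop0 cats0.
  have -> : conv u v g = \sum_(a <- finsupp u | P a) u a * v (a^-1 * g)%g.
    rewrite convE [RHS]big_mkcond; apply: eq_bigr => a _; case: ifPn => // Pa.
    by rewrite (fsfun_dflt Pa) mulr0.
  apply: le_trans (normsq_cs _ _ _ _) _; apply: ler_pM.
  - by apply: sumr_ge0 => a _; exact: normsq_ge0.
  - by apply: sumr_ge0 => a _; exact: normsq_ge0.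
  - rewrite /X big_mkcond [leRHS]big_mkcond big_seq [leRHS]big_seq.
    apply: ler_sum => a au; case: ifP => Pa; last first.
      by case: ifP => // _; exact: normsq_ge0.
    by have [-> _] := split a au Pa; rewrite eqxx.
  - set U := [fset a in finsupp u | P a].
    have -> : \sum_(a <- finsupp u | P a) normsq (v (a^-1 * g)%g) =
      \sum_(b <- [fset (a^-1 * g)%g | a in U]) normsq (v b).
      rewrite big_imfset /=; last by move=> a b _ _ /mulIg/invg_inj.
      by rewrite big_fset /=.
    rewrite /Y [leRHS]big_fset_condE; apply: sum_subset_le; last by move=> b; exact: normsq_ge0.
    apply/fsubsetP => b /imfsetP[a /= ]; rewrite !inE /= => /andP[au Pa] ->.
    by have [_ h] := split a au Pa; rewrite [_ \in finsupp v]Pa h eqxx.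
rewrite big_distrlr /= .
apply: (@le_trans _ _ (\sum_(a <- finsupp u) \sum_(b <- finsupp v)
   \sum_(g <- S | (tk g == take (i - l) (fgword a)) && (dk g == drop l (fgword b)))
     normsq (u a) * normsq (v b))).
  rewrite [leRHS](_ : _ = \sum_(g <- S) X g * Y g).
    rewrite big_mkcond; apply: ler_sum => g _; case: ifP => // _.
    by rewrite mulr_ge0//; apply: sumr_ge0 => a _; exact: normsq_ge0.
  transitivity (\sum_(a <- finsupp u) \sum_(b <- finsupp v) \sum_(g <- S)
    (if tk g == take (i - l) (fgword a) then normsq (u a) else 0) *
    (if dk g == drop l (fgword b) then normsq (v b) else 0)).
    apply: eq_bigr => a _; apply: eq_bigr => b _; rewrite big_mkcond.
    apply: eq_bigr => g _; case: (tk g == _) => /=; rewrite ?mul0r//.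
    by case: ifP; rewrite ?mulr0.
  under eq_bigr do rewrite exchange_sum.
  rewrite exchange_sum.
  have E g : \sum_(a <- finsupp u) \sum_(b <- finsupp v)
      (if tk g == take (i - l) (fgword a) then normsq (u a) else 0) *
      (if dk g == drop l (fgword b) then normsq (v b) else 0) = X g * Y g.
    rewrite /X /Y big_distrlr /= [RHS]big_mkcond; apply: eq_bigr => a _.
    rewrite [tk g == _]eq_sym; case: ifP => _.
      rewrite [RHS]big_mkcond; apply: eq_bigr => b _.
      by rewrite [dk g == _]eq_sym; case: ifP; rewrite ?mulr0.
    by rewrite big1// => b _; rewrite mul0r.
  by under eq_bigr do rewrite E.
apply: ler_sum => a _; apply: ler_sum => b _; apply: sum_const_inj.
- exact: fset_uniq.
- move=> g h /andP[/eqP g1 /eqP g2] /andP[/eqP h1 /eqP h2]; apply: fg_ext.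
  by rewrite -(cat_take_drop (i - l) (fgword g)) -/(tk g) -/(dk g) g1 g2 -h1 -h2
     cat_take_drop.
- by rewrite mulr_ge0 ?normsq_ge0.
Qed.

End Haagerup.

(** * Length components and Haagerup's inequality for general elements *)

Section LengthComponents.
Variables (R : realType) (I : choiceType).
Local Open Scope fset_scope.
Local Notation F := (freegroup I).
Local Notation A := (grpalg R F).
Implicit Types (u v w : A) (a b g : F).

Definition lcomp (D : nat) u : A :=
  [fsfun g in finsupp u => if fglen g == D then u g else 0].

Lemma compE D u g : lcomp D u g = if fglen g == D then u g else 0.
Proof.
rewrite fsfunE; case: ifPn => // gu; case: ifP => // _.
by rewrite (fsfun_dflt gu).
Qed.

Lemma finsupp_comp D u : finsupp (lcomp D u) `<=` finsupp u.
Proof. exact: finsupp_sub. Qed.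

Lemma comp_len D u a : a \in finsupp (lcomp D u) -> fglen a = D.
Proof. rewrite mem_finsupp compE; case: (fglen a =P D) => // _.
by move/eqP; case. Qed.

(** For [u = y] this is the [Y_D] of the overview. *)
Definition nn u (D : nat) : R := nrm (lcomp D u).

Lemma nn_ge0 u D : 0 <= nn u D. Proof. exact: nrm_ge0. Qed.

(** Finite support is used through such a bound on the lengths, which turns sums over lengths into
    sums over ['I_n]. *)
Definition shorter (n : nat) u := forall g, g \in finsupp u -> (fglen g < n)%N.

Lemma shorter_le n m u : (n <= m)%N -> shorter n u -> shorter m u.
Proof. by move=> nm un g gu; exact: leq_trans (un g gu) nm. Qed.

Lemma exists_shorter u : exists n, shorter n u.
Proof.
exists (\sum_(g <- finsupp u) fglen g).+1 => g gu; rewrite ltnS.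
by rewrite (big_fsetD1 g) //= leq_addr.
Qed.

Lemma nn_sqr u D : nn u D ^+ 2 = \sum_(g <- finsupp u | fglen g == D) normsq (u g).
Proof.
rewrite /nn (nrm_sqr (finsupp_comp D u)) [RHS]big_mkcond; apply: eq_bigr => g _.
by rewrite compE; case: ifP => // _; rewrite /normsq /= expr0n addr0.
Qed.

Lemma nn_eq0 n u D : shorter n u -> (n <= D)%N -> nn u D = 0.
Proof.
move=> un nD; apply/eqP; rewrite -sqrf_eq0 nn_sqr big_seq_cond big1// => g.
by case/andP => gu /eqP gD; have := un g gu; rewrite gD ltnNge nD.
Qed.

Lemma sum_comp n u g : shorter n u -> \sum_(i < n) lcomp i u g = u g.
Proof.
move=> un; case: (boolP (g \in finsupp u)) => gu; last first.
  by rewrite (fsfun_dflt gu) big1// => i _; rewrite compE (fsfun_dflt gu) if_same.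
rewrite (bigD1 (Ordinal (un g gu))) //= compE eqxx big1 ?addr0// => i.
by rewrite compE -val_eqE /= eq_sym => /negbTE ->.
Qed.

Lemma vec_sum_comp n u : shorter n u -> vec u = \sum_(i < n) vec (lcomp i u).
Proof.
move=> un; apply: l2_ext => g; rewrite vecE -(sum_comp g un) [RHS]l2_sumE.
by apply: eq_bigr => i _; rewrite vecE.
Qed.

Lemma lsum_sum_comp n u f : shorter n u -> lsum u f = \sum_(i < n) lsum (lcomp i u) f.
Proof.
move=> un; rewrite (lsum_sub f (fsubset_refl (finsupp u))).
under [RHS]eq_bigr => i _ do rewrite (lsum_sub f (finsupp_comp i u)).
rewrite exchange_big /=; apply: eq_bigr => a _.
by rewrite -scaler_suml (sum_comp a un).
Qed.

Lemma ip_comp_le D u v : `|ip (vec (lcomp D u)) (vec v)| <= nn u D * nn v D.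
Proof.
have -> : ip (vec (lcomp D u)) (vec v) = ip (vec (lcomp D u)) (vec (lcomp D v)).
  rewrite !(ip_vec _ (finsupp_comp D u)); apply: eq_bigr => g _.
  rewrite !vecE !compE; case: ifP => // _; by rewrite !mul0r.
exact: cauchy_schwarz.
Qed.

Lemma ip_comp_self D u : ip (vec (lcomp D u)) (vec u) = nn u D ^+ 2.
Proof.
rewrite /nn -ipff !(ip_vec _ (finsupp_comp D u)); apply: eq_bigr => g _.
by rewrite !vecE !compE; case: ifP => // _; rewrite !mul0r.
Qed.

Lemma nrm_sum n u : shorter n u -> nrm u ^+ 2 = \sum_(D < n) nn u D ^+ 2.
Proof.
move=> un; rewrite -ipff {1}(vec_sum_comp un) ip_suml; apply: eq_bigr => D _.
exact: ip_comp_self.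
Qed.

Lemma ip_vec_le n u v : shorter n u -> `|ip (vec u) (vec v)| <= \sum_(D < n) nn u D * nn v D.
Proof.
move=> un; rewrite {1}(vec_sum_comp un) ip_suml.
apply: le_trans (ler_norm_sum _ _ _) _; apply: ler_sum => D _; exact: ip_comp_le.
Qed.

Lemma fglenV a : fglen (a^-1)%g = fglen a.
Proof. by rewrite /fglen /= /winv size_rev size_map. Qed.

Lemma finsupp_star u g : (g \in finsupp (star u)) = ((g^-1)%g \in finsupp u).
Proof. by rewrite !mem_finsupp starE conjc_eq0. Qed.

Lemma shorter_star n u : shorter n u -> shorter n (star u).
Proof. by move=> un g; rewrite finsupp_star => /un; rewrite fglenV. Qed.

Lemma normsq_conj (z : R[i]) : normsq (z^*)%C = normsq z.
Proof. by case: z => [x y]; rewrite /normsq /= sqrrN. Qed.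

Lemma nn_star u D : nn (star u) D = nn u D.
Proof.
apply/eqP; rewrite -(@eqrXn2 _ 2) ?nn_ge0 // !nn_sqr.
rewrite [X in _ == X]big_mkcond [X in X == _]big_mkcond.
have S : finsupp (star u) `<=` [fset (a^-1)%g | a in finsupp u] by exact: finsupp_sub.
rewrite (big_fset_incl _ S) /=; last first.
  move=> g _ gs; rewrite (fsfun_dflt gs) /normsq /= expr0n addr0.
  by rewrite if_same.
rewrite big_imfset /=; last by move=> a b _ _; exact: invg_inj.
apply/eqP; apply: eq_bigr => a _; rewrite starE normsq_conj invgK.
by rewrite fglenV.
Qed.

(* [l] letters cancel, and [a] and [b] letters remain on the left and on the right. *)
Definition convseq (n : nat) (x y : nat -> R) (D : nat) : R :=
  \sum_(l < n) \sum_(a < n) \sum_(b < n) (if (a + b == D)%N then x (a + l)%N * y (b + l)%N else 0).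

(** The triple sum has at most one nonzero term, as [i], [j] and [D] determine [l], [a] and [b].
    Written as a sum, it collapses to [convseq] when [haagerup] sums over [i] and [j]. *)
Lemma nn_conv_comp n i j D u v : (i < n)%N -> (j < n)%N ->
  nrm (lcomp D (conv (lcomp i u) (lcomp j v))) <=
  \sum_(l < n) \sum_(a < n) \sum_(b < n)
    (if [&& (a + b == D)%N, (a + l == i)%N & (b + l == j)%N]
     then nn u i * nn v j else 0).
Proof.
move=> iN jN; set c := conv _ _.
have N0 : 0 <= nn u i * nn v j by rewrite mulr_ge0 ?nn_ge0.
have S0 : 0 <= \sum_(l < n) \sum_(a < n) \sum_(b < n)
    (if [&& (a + b == D)%N, (a + l == i)%N & (b + l == j)%N]
     then nn u i * nn v j else 0).
  by do 3 (apply: sumr_ge0 => ? _); case: ifP.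
(* Without words of length [D] the left side is 0; otherwise a word of the support supplies the
   admissible [l]. *)
have [E|] := eqVneq (finsupp (lcomp D c)) fset0.
  rewrite (_ : nrm _ = 0)//; apply/eqP.
  by rewrite -sqrf_eq0 (nrm_sqr (fsubset_refl _)) E big_nil.
case/fset0Pn => g gD; have gl := comp_len gD.
have /imfset2P[a /= au [b /= bv gab]] :=
  fsubsetP (finsupp_conv _ _) g (fsubsetP (finsupp_comp _ _) g gD).
have [l [la lb E]] := fg_split a b; have L := fglen_split la lb E.
rewrite -gab gl (comp_len au) (comp_len bv) in L.
rewrite (comp_len au) in la; rewrite (comp_len bv) in lb.
have ln : (l < n)%N by exact: leq_ltn_trans la iN.
have an : (i - l < n)%N by exact: leq_ltn_trans (leq_subr _ _) iN.
have bn : (j - l < n)%N by exact: leq_ltn_trans (leq_subr _ _) jN.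
have ge : nn u i * nn v j <= \sum_(l < n) \sum_(a < n) \sum_(b < n)
    (if [&& (a + b == D)%N, (a + l == i)%N & (b + l == j)%N]
     then nn u i * nn v j else 0).
  rewrite (bigD1 (Ordinal ln)) //= (bigD1 (Ordinal an)) //= (bigD1 (Ordinal bn)) //=.
  rewrite L eqxx !subnK// !eqxx /= -!addrA lerDl !addr_ge0//.
  - by apply: sumr_ge0 => ? _; case: ifP.
  - by do 2 (apply: sumr_ge0 => ? _); case: ifP.
  - by do 3 (apply: sumr_ge0 => ? _); case: ifP.
apply: le_trans ge.
apply: le_of_sqr => //.
rewrite -/(nn c D) nn_sqr L exprMn.
apply: le_trans (haagerup_basic _ _ _ la lb) _.
- by move=> ? /comp_len.
- by move=> ? /comp_len.
by rewrite /nn !(nrm_sqr (fsubset_refl _)).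
Qed.

Lemma ler_if_sym (p q i j : nat) (f : nat -> nat -> R) :
  (if (p == i) && (q == j) then f i j else 0) <= (if (i == p) && (j == q) then f p q else 0).
Proof. by rewrite (eq_sym i) (eq_sym j); case: ifP => [/andP[/eqP -> /eqP ->]|_]. Qed.

Lemma haagerup n u v D : shorter n u -> shorter n v ->
  nn (conv u v) D <= convseq n (nn u) (nn v) D.
Proof.
move=> un vn.
have E : vec (lcomp D (conv u v)) =
    \sum_(i < n) \sum_(j < n) vec (lcomp D (conv (lcomp i u) (lcomp j v))).
  have E0 : vec (conv u v) = \sum_(i < n) \sum_(j < n) vec (conv (lcomp i u) (lcomp j v)).
    rewrite vec_conv (lsum_sum_comp _ un); apply: eq_bigr => i _.
    rewrite (vec_sum_comp vn) linear_sum; apply: eq_bigr => j _.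
    by rewrite vec_conv.
  apply: l2_ext => g; rewrite vecE compE -vecE E0 !l2_sumE.
  case: ifP => gD.
    apply: eq_bigr => i _; rewrite !l2_sumE; apply: eq_bigr => j _.
    by rewrite !vecE compE gD.
  rewrite big1// => i _; rewrite l2_sumE big1// => j _.
  by rewrite vecE compE gD.
rewrite /nn /nrm E; apply: le_trans (l2norm_sum _ _ _) _.
apply: (@le_trans _ _ (\sum_(i < n) \sum_(j < n) \sum_(l < n) \sum_(a < n) \sum_(b < n)
    (if [&& (a + b == D)%N, (a + l == i)%N & (b + l == j)%N]
     then nn u i * nn v j else 0))).
  apply: ler_sum => i _; apply: le_trans (l2norm_sum _ _ _) _; apply: ler_sum => j _.
  exact: nn_conv_comp.
rewrite /convseq.
under eq_bigr do rewrite exchange_sum; rewrite exchange_sum; apply: ler_sum => l _.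
under eq_bigr do rewrite exchange_sum; rewrite exchange_sum; apply: ler_sum => a _.
under eq_bigr do rewrite exchange_sum; rewrite exchange_sum; apply: ler_sum => b _.
have N0 i j : 0 <= nn u i * nn v j by rewrite mulr_ge0 ?nn_ge0.
case: ifP => abD; last by rewrite big1// => i _; rewrite big1.
apply: (@le_trans _ _ (\sum_(i < n) \sum_(j < n)
   (if (nat_of_ord i == a + l)%N && (nat_of_ord j == b + l)%N then nn u (a + l) * nn v (b + l) else 0))).
  apply: ler_sum => i _; apply: ler_sum => j _ /=.
  exact: (ler_if_sym (a + l) (b + l) i j (fun i j => nn u i * nn v j)).
have [al|al] := ltnP (a + l) n; last first.
  rewrite big1 ?N0// => i _; rewrite big1// => j _; case: eqP => //= ial.
  by have := ltn_ord i; rewrite ial ltnNge al.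
have [bl|bl] := ltnP (b + l) n; last first.
  rewrite big1 ?N0// => i _; rewrite big1// => j _; rewrite andbC; case: eqP => //= jbl.
  by have := ltn_ord j; rewrite jbl ltnNge bl.
rewrite (bigD1 (Ordinal al)) //= [X in (_ + X)%R]big1 ?addr0; last first.
  by move=> i; rewrite -val_eqE /= => /negbTE ->; rewrite big1.
rewrite (bigD1 (Ordinal bl)) //= !eqxx /= [X in (_ + X)%R]big1 ?addr0//.
by move=> j; rewrite -val_eqE /= => /negbTE ->.
Qed.

End LengthComponents.

(** * Weighted convolution estimates *)

Section ConvSequences.
Variable R : realType.
Implicit Types (x y u v w g : nat -> R).

Definition pairsum (n : nat) (f : nat -> nat -> R) (D : nat) : R :=
  \sum_(a < n) \sum_(b < n) (if (a + b == D)%N then f a b else 0).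

Lemma pairsumE n f D : pairsum n f D =
  \sum_(p : 'I_n * 'I_n | (p.1 + p.2 == D)%N) f p.1 p.2.
Proof. by rewrite /pairsum pair_bigA [RHS]big_mkcond. Qed.

Lemma sum_lt_le n D : \sum_(a < n) (if (a < D)%N then 1 else 0) <= D%:R :> R.
Proof.
elim: n D => [|n IH] D; first by rewrite big_ord0.
case: D => [|D]; first by rewrite big1//.
by rewrite big_ord_recl /= -natr1 addrC lerD2r; exact: IH.
Qed.

Lemma pairsum_count n D : pairsum n (fun _ _ => 1) D <= D.+1%:R.
Proof.
apply: le_trans (sum_lt_le n D.+1).
apply: ler_sum => a _; rewrite ltnS; have [aD|aD] := leqP a D; last first.
  rewrite big1// => b _; case: eqP => // abD.
  by move: aD; rewrite -abD ltnNge leq_addr.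
rewrite -big_mkcond; apply: sum_const_inj => //; first exact: index_enum_uniq.
by move=> b c /eqP h /eqP; rewrite -h => /addnI /esym /val_inj.
Qed.

Lemma pairsum_cs n x D :
  pairsum n (fun a b => x a * x b) D ^+ 2 <=
  D.+1%:R * pairsum n (fun a b => x a ^+ 2 * x b ^+ 2) D.
Proof.
rewrite !pairsumE.
have := @cs_sum R _ (index_enum _) (fun p : 'I_n * 'I_n => (p.1 + p.2 == D)%N)
  (fun p => x p.1 * x p.2) (fun _ => 1).
under eq_bigr do rewrite mulr1.
under [X in _ <= X * _ -> _]eq_bigr do rewrite exprMn.
move=> h; apply: le_trans h _; rewrite mulrC ler_wpM2r//.
  by apply: sumr_ge0 => p _; rewrite mulr_ge0// sqr_ge0.
under eq_bigr do rewrite expr1n.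
by have := pairsum_count n D; rewrite pairsumE.
Qed.

Lemma sum_indicator (N m : nat) (c : nat -> R) : (forall D, 0 <= c D) ->
  \sum_(D < N) (if (m == D)%N then c D else 0) <= c m.
Proof.
move=> c0; have [mN|mN] := ltnP m N; last first.
  rewrite big1// => D _; case: eqP => // mD; move: mN; rewrite mD leqNgt ltn_ord//.
rewrite (bigD1 (Ordinal mN)) //= eqxx big1 ?addr0// => D.
by rewrite -val_eqE /= eq_sym => /negbTE ->.
Qed.

(* Cauchy-Schwarz on the antidiagonal [a + b = D], which has at most [D + 1] points. *)
Lemma conv_single n N x (s : nat -> R) (K : nat -> nat -> R) :
  (forall D, 0 <= s D) -> (forall a b, s (a + b)%N * (a + b).+1%:R <= K a b) ->
  \sum_(D < N) s D * pairsum n (fun a b => x a * x b) D ^+ 2 <=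
  \sum_(a < n) \sum_(b < n) K a b * (x a ^+ 2 * x b ^+ 2).
Proof.
move=> s0 sK.
apply: (@le_trans _ _ (\sum_(D < N) \sum_(a < n) \sum_(b < n)
  (if (a + b == D)%N then s D * D.+1%:R * (x a ^+ 2 * x b ^+ 2) else 0))).
  apply: ler_sum => D _.
  apply: le_trans (ler_wpM2l (s0 D) (pairsum_cs n x D)) _.
  rewrite mulrA mulr_sumr; apply: ler_sum => a _; rewrite mulr_sumr; apply: ler_sum => b _.
  by case: ifP => //; rewrite mulr0.
rewrite exchange_sum; apply: ler_sum => a _; rewrite exchange_sum; apply: ler_sum => b _.
have xx : 0 <= x a ^+ 2 * x b ^+ 2 by apply: mulr_ge0; exact: sqr_ge0.
apply: le_trans (sum_indicator N (a + b) (c := fun D => s D * D.+1%:R * (x a ^+ 2 * x b ^+ 2)) _) _.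
  by move=> D; apply: mulr_ge0 => //; apply: mulr_ge0.
exact: ler_wpM2r.
Qed.

Lemma minkowski_sum (N n : nat) (s : nat -> R) (f : nat -> nat -> R) (b : nat -> R) :
  (forall D, 0 <= s D) -> (forall l, 0 <= b l) ->
  (forall l, (l < n)%N -> \sum_(D < N) s D * f l D ^+ 2 <= b l ^+ 2) ->
  \sum_(D < N) s D * (\sum_(l < n) f l D) ^+ 2 <= (\sum_(l < n) b l) ^+ 2.
Proof.
move=> s0 b0; elim: n => [|n IH] fb.
  by rewrite big_ord0 expr0n big1//= => D _; rewrite big_ord0 expr0n mulr0.
have {}IH := IH (fun l ln => fb l (leqW ln)); have fn := fb n (ltnSn n).
rewrite big_ord_recr /=; set B := \sum_(l < n) b l in IH *.
have B0 : 0 <= B by apply: sumr_ge0.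
pose u D := \sum_(l < n) f l D.
rewrite (eq_bigr (fun D : 'I_N => s D * (u D + f n D) ^+ 2)); last first.
  by move=> D _; rewrite big_ord_recr.
have -> : \sum_(D < N) s D * (u D + f n D) ^+ 2 =
  \sum_(D < N) s D * u D ^+ 2 + 2 * (\sum_(D < N) s D * (u D * f n D)) +
  \sum_(D < N) s D * f n D ^+ 2.
  by rewrite mulr_sumr -!big_split; apply: eq_bigr => D _ /=; ring.
have cs : (\sum_(D < N) s D * (u D * f n D)) ^+ 2 <= (B * b n) ^+ 2.
  have := @cs_sum R _ (index_enum _) xpredT (fun D : 'I_N => Num.sqrt (s D) * u D)
    (fun D : 'I_N => Num.sqrt (s D) * f n D).
  rewrite (eq_bigr (fun D : 'I_N => s D * (u D * f n D))); last first.
    by move=> D _; rewrite mulrACA -expr2 sqr_sqrtr.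
  rewrite [X in _ <= X * _ -> _](eq_bigr (fun D : 'I_N => s D * u D ^+ 2)); last first.
    by move=> D _; rewrite exprMn sqr_sqrtr.
  rewrite [X in _ <= _ * X -> _](eq_bigr (fun D : 'I_N => s D * f n D ^+ 2)); last first.
    by move=> D _; rewrite exprMn sqr_sqrtr.
  move=> h; apply: le_trans h _; rewrite exprMn; apply: ler_pM => //.
    by apply: sumr_ge0 => D _; rewrite mulr_ge0 ?sqr_ge0.
  by apply: sumr_ge0 => D _; rewrite mulr_ge0 ?sqr_ge0.
have cs' : \sum_(D < N) s D * (u D * f n D) <= B * b n.
  by apply: le_of_sqr => //; exact: mulr_ge0.
have : \sum_(D < N) s D * u D ^+ 2 <= B ^+ 2 by exact: IH.
move: fn cs'; set X := \sum_(D < N) s D * f n D ^+ 2.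
set Y := \sum_(D < N) s D * (u D * f n D); set Z := \sum_(D < N) _.
move=> h1 h2 h3; nra.
Qed.

(** With [l] cancelled letters the damping [r^(a + l) r^(b + l)] equals [(r^2)^l r^D], so each
    cancelled letter contributes a factor [r^2] whatever [D] is. *)
Lemma convseq_pairsum n r (x : nat -> R) D :
  convseq n (fun k => r ^+ k * x k) (fun k => r ^+ k * x k) D =
  \sum_(l < n) (r ^+ 2) ^+ l * (r ^+ D * pairsum n (fun a b => x (a + l)%N * x (b + l)%N) D).
Proof.
rewrite /convseq; apply: eq_bigr => l _; rewrite /pairsum !mulr_sumr.
apply: eq_bigr => a _; rewrite !mulr_sumr; apply: eq_bigr => b _.
case: eqP => [<-|_]; last by rewrite !mulr0.
by rewrite -exprM mul2n -addnn !exprD; ring.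
Qed.

Lemma convseq_bound n N r x (s : nat -> R) (b : nat -> R) :
  (forall D, 0 <= s D) -> (forall l, 0 <= b l) ->
  (forall l, (l < n)%N -> \sum_(D < N) s D * (r ^+ 2) ^+ D *
     pairsum n (fun a b => x (a + l)%N * x (b + l)%N) D ^+ 2 <= b l ^+ 2) ->
  \sum_(D < N) s D * convseq n (fun k => r ^+ k * x k) (fun k => r ^+ k * x k) D ^+ 2
   <= (\sum_(l < n) (r ^+ 2) ^+ l * b l) ^+ 2.
Proof.
move=> s0 b0 H.
rewrite (eq_bigr (fun D : 'I_N => s D * (\sum_(l < n) (r ^+ 2) ^+ l * (r ^+ D *
  pairsum n (fun a b => x (a + l)%N * x (b + l)%N) D)) ^+ 2)); last first.
  by move=> D _; rewrite convseq_pairsum.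
apply: (@minkowski_sum N n s (fun l D => (r ^+ 2) ^+ l * (r ^+ D *
  pairsum n (fun a b => x (a + l)%N * x (b + l)%N) D)) (fun l => (r ^+ 2) ^+ l * b l)) => //.
  by move=> l; rewrite mulr_ge0// exprn_ge0// sqr_ge0.
move=> l ln; rewrite [in leRHS](exprMn _ ((r ^+ 2) ^+ l)).
apply: le_trans (ler_wpM2l (sqr_ge0 ((r ^+ 2) ^+ l)) (H l ln)); rewrite mulr_sumr.
apply: ler_sum => D _; rewrite le_eqVlt; apply/orP; left; apply/eqP.
rewrite -[(r ^+ 2) ^+ D]exprM mulnC exprM; ring.
Qed.

Lemma sum_shift n l g w : (forall k, (n <= k)%N -> w k = 0) ->
  \sum_(a < n) g a * w (a + l)%N =
  \sum_(k < n) (if (l <= k)%N then g (k - l)%N * w k else 0).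
Proof.
move=> w0; elim: l => [|l IH] in w w0 *.
  by apply: eq_bigr => k _; rewrite addn0 subn0.
have := IH (fun k => w k.+1) (fun k nk => w0 k.+1 (leqW nk)).
rewrite (eq_bigr (fun a : 'I_n => g a * w (a + l.+1)%N)); last first.
  by move=> a _; rewrite addnS.
move=> ->; case: n w0 {IH} => [|n] w0; first by rewrite !big_ord0.
rewrite big_ord_recr [RHS]big_ord_recl /= w0// mulr0 if_same addr0 add0r.
by apply: eq_bigr => k _; rewrite /bump /= add1n ltnS subSS.
Qed.

(** Collects the total weight with which each [w k] occurs. The sequences [g] used later are those
    for which this inner sum has a closed form. *)
Lemma sum_telescope n (g : nat -> R) w (z : R) : (forall k, (n <= k)%N -> w k = 0) ->
  \sum_(l < n) z ^+ l * (\sum_(a < n) g a * w (a + l)%N) =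
  \sum_(k < n) (\sum_(l < k.+1) z ^+ l * g (k - l)%N) * w k.
Proof.
move=> w0; under eq_bigr do rewrite (sum_shift _ _ w0) mulr_sumr.
rewrite exchange_sum; apply: eq_bigr => k _; rewrite mulr_suml.
rewrite (big_ord_widen n (fun l => z ^+ l * g (k - l)%N * w k)) ?ltn_ord//.
rewrite [RHS]big_mkcond; apply: eq_bigr => l _; rewrite ltnS.
by case: ifP => _; rewrite ?mulr0// mulrA.
Qed.

End ConvSequences.

Section WeightedBounds.
Variable R : realType.
Implicit Types (x y u v w : nat -> R).

(* The weights make [conv_wt X mu D * X ^+ D * (D + 1)], for [D = a + b], at most the
   product form that telescopes in [weighted_bound]; [mu < 1] leaves a strict gain. *)
Definition conv_wt (X mu : R) (D : nat) : R :=
  match D with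
  | 0 => 1
  | 1 => (1 - X) / (2 * X)
  | _ => mu * (1 - X) ^+ 2 / (D.+1%:R * X ^+ D)
  end.

Lemma sig_ge0 (X mu : R) D : 0 < X < 1 -> 0 <= mu -> 0 <= conv_wt X mu D.
Proof.
move=> /andP[X0 X1] mu0; have X1' : 0 <= 1 - X by lra.
case: D => [|[|D]] /=; first exact: ler01.
  by rewrite divr_ge0//; lra.
apply: divr_ge0; first by apply: mulr_ge0 => //; exact: sqr_ge0.
by rewrite mulr_ge0// exprn_ge0// ltW.
Qed.

(** The factors 1 at index 0 and [1 - X] elsewhere are dictated by [telescope_geometric]. Given
    them, the values of [conv_wt] at 0 and 1 are exact, and for [a, b > 0] the factor [mu] leaves
    the subtracted gain. *)
Lemma sig_le (X mu : R) a b : 0 < X < 1 -> 0 <= mu <= 1 ->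
  conv_wt X mu (a + b) * X ^+ (a + b) * (a + b).+1%:R <=
  (if a is 0 then 1 else 1 - X) * (if b is 0 then 1 else 1 - X) -
  (if (a > 0)%N && (b > 0)%N then (1 - mu) * (1 - X) ^+ 2 else 0).
Proof.
move=> /andP[X0 X1] /andP[mu0 mu1].
have big (D : nat) : (2 <= D)%N -> conv_wt X mu D * X ^+ D * D.+1%:R = mu * (1 - X) ^+ 2.
  case: D => [|[|D]] // _ /=; move: (exprn_gt0 D.+2 X0); move: (X ^+ D.+2) => Z Z0.
  have : (D.+3%:R : R) != 0 by rewrite pnatr_eq0.
  by move: (D.+3%:R : R) => m m0; field; rewrite m0 gt_eqF.
have X2 : (1 - X) ^+ 2 <= 1 - X by nra.
have mX : mu * (1 - X) ^+ 2 <= 1 - X by apply: le_trans X2; apply: ler_piMl; [exact: sqr_ge0|lra].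
have [h|] := leqP 2 (a + b).
  by rewrite big//; case: a b h => [|a] [|b] //= _; rewrite ?subr0 ?mul1r ?mulr1 //; lra.
have one : (1 - X) / (2 * X) * X * 2 = 1 - X by field; rewrite gt_eqF.
by case: a b => [|[|a]] [|[|b]] //= _; rewrite ?one; lra.
Qed.

(** The terms with [l < k] add up to [1 - X^k], and the last one is [X^k]. *)
Lemma telescope_geometric X k :
  \sum_(l < k.+1) X ^+ l * (if (k - l)%N is 0 then 1 else 1 - X) = 1 :> R.
Proof.
rewrite big_ord_recr /= subnn mulr1.
rewrite (eq_bigr (fun l : 'I_k => X ^+ l * (1 - X))); last first.
  by move=> l _; case E: (k - l)%N => //; move: (ltn_ord l); lia.
elim: k => [|k IH]; first by rewrite big_ord0 add0r expr0.
by rewrite big_ord_recr /= -[RHS]IH exprS; ring.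
Qed.

(* With [w k = x k ^+ 2], the terms with [l] cancelled letters have weighted norm at most
   [w l + (1 - r ^+ 2) * \sum_(k > l) w k], and these bounds, weighted by [(r ^+ 2) ^+ l],
   add up to [\sum_k w k]. *)
Lemma weighted_bound n N (r : R) x (mu : R) : 0 < r -> r ^+ 2 < 1 -> 0 <= mu <= 1 ->
  (forall k, (n < k)%N -> x k = 0) -> \sum_(k < n.+1) x k ^+ 2 <= 1 ->
  \sum_(D < N) conv_wt (r ^+ 2) mu D *
     convseq n.+1 (fun k => r ^+ k * x k) (fun k => r ^+ k * x k) D ^+ 2 <=
  (\sum_(k < n.+1) x k ^+ 2 -
    (1 - mu) * (1 - r ^+ 2) ^+ 2 * (\sum_(k < n) x k.+1 ^+ 2) ^+ 2 / 2) ^+ 2.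
Proof.
move=> r0 r1 mu01 x0 S1; set X : R := r ^+ 2; set S := \sum_(k < n.+1) _.
have X01 : 0 < X < 1 by rewrite exprn_gt0.
have [X0 X1] := andP X01; have [mu0 mu1] := andP mu01.
pose w k := x k ^+ 2; have w0 k : 0 <= w k by exact: sqr_ge0.
set T := \sum_(k < n) _; have T0 : 0 <= T by apply: sumr_ge0 => k _; exact: w0.
have ST : S = w 0%N + T by rewrite /S big_ord_recl.
pose g a : R := if a is 0 then 1 else 1 - X.
pose h a : R := if a is 0 then 0 else 1.
have X1' : 0 <= 1 - X by rewrite subr_ge0 ltW.
have g0 a : 0 <= g a by rewrite /g; case: a.
pose G l := \sum_(a < n.+1) h a * w (a + l)%N.
pose C l := \sum_(a < n.+1) g a * w (a + l)%N.
have G0 l : 0 <= G l by apply: sumr_ge0 => -[[|a] /= _] _; rewrite /h ?mul0r ?mul1r.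
have CG l : C l = w l + (1 - X) * G l.
  rewrite /C /G !big_ord_recl /= mul0r mul1r add0r add0n mulr_sumr; congr (_ + _).
  by apply: eq_bigr => a _; rewrite mul1r.
have GT : G 0%N = T.
  rewrite /G big_ord_recl /= mul0r add0r; apply: eq_bigr => a _.
  by rewrite mul1r addn0.
(* Half of the gain at [l = 0], the only place where the gain is kept. As [C 0 <= 1],
   [C 0 ^+ 2 - 2 * eta <= (C 0 - eta) ^+ 2]. *)
set eta := (1 - mu) * (1 - X) ^+ 2 * T ^+ 2 / 2.
have eta0 : 0 <= eta.
  apply: divr_ge0 => //; apply: mulr_ge0; last exact: sqr_ge0.
  by apply: mulr_ge0; [lra|exact: sqr_ge0].
pose b l := C l - (if l == 0%N then eta else 0).
have T1 : T <= 1 by have := w0 0%N; have := S1; rewrite -/S ST; lra.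
have etaT : eta <= (1 - X) * T.
  have X2 : (1 - X) ^+ 2 <= 1 - X by nra.
  have h1 : (1 - mu) * (1 - X) ^+ 2 <= 1 - X by apply: le_trans X2; apply: ler_piMl; [exact: sqr_ge0|lra].
  have h2 : T ^+ 2 <= T by nra.
  have : (1 - mu) * (1 - X) ^+ 2 * T ^+ 2 <= (1 - X) * T.
    apply: ler_pM; [apply: mulr_ge0; [lra|exact: sqr_ge0]|exact: sqr_ge0|exact: h1|exact: h2].
  have := mulr_ge0 X1' T0; rewrite /eta; lra.
have b0 l : 0 <= b l.
  rewrite /b CG; case: eqP => [->|_]; first by rewrite GT; have := w0 0%N; lra.
  have := w0 l; have : 0 <= (1 - X) * G l by exact: mulr_ge0.
  lra.
have Sb : \sum_(l < n.+1) X ^+ l * b l = S - eta.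
  transitivity (\sum_(l < n.+1) X ^+ l * C l - \sum_(l < n.+1) X ^+ l * (if val l == 0%N then eta else 0)).
    by rewrite -sumrB; apply: eq_bigr => l _; rewrite mulrBr.
  congr (_ - _).
    rewrite (@sum_telescope _ _ g w X); last by move=> k nk; rewrite /w x0// expr0n.
    by apply: eq_bigr => k _; rewrite telescope_geometric mul1r.
  rewrite big_ord_recl /= mul1r big1 ?addr0// => i _; exact: mulr0.
rewrite -Sb; apply: convseq_bound => //; first by move=> D; exact: sig_ge0.
move=> l ln.
pose K a c := g a * g c - (if (a > 0)%N && (c > 0)%N then (1 - mu) * (1 - X) ^+ 2 else 0).
have := @conv_single R n.+1 N (fun k => x (k + l)%N) (fun D => conv_wt X mu D * X ^+ D) K.
move=> /(_ (fun D => mulr_ge0 (sig_ge0 D X01 mu0) (exprn_ge0 D (ltW X0)))).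
move=> /(_ (fun a c => sig_le a c X01 mu01)) H; apply: (le_trans H).
rewrite (_ : \sum_(a < _) _ = C l ^+ 2 - (1 - mu) * (1 - X) ^+ 2 * G l ^+ 2); last first.
  rewrite !expr2 {1}/C {1}/G mulr_suml [in RHS]mulr_suml mulr_sumr -sumrB.
  apply: eq_bigr => a _; rewrite /C /G !mulr_sumr -sumrB; apply: eq_bigr => c _.
  rewrite /K -!expr2 -/(w (a + l)%N) -/(w (c + l)%N) /h.
  by case: (nat_of_ord a) (nat_of_ord c) => [|a'] [|c'] /=; ring.
rewrite /b; case: eqP => [->|_].
  rewrite GT; have -> : (1 - mu) * (1 - X) ^+ 2 * T ^+ 2 = 2 * eta by rewrite /eta; field.
  have : C 0%N <= 1 by rewrite CG GT; have := mulr_ge0 (ltW X0) T0; have := S1; rewrite -/S ST; lra.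
  by move: (C 0%N) => c c1; nra.
rewrite subr0 lerBlDr lerDl; apply: mulr_ge0; last exact: sqr_ge0.
by apply: mulr_ge0; [lra|exact: sqr_ge0].
Qed.

Lemma sum_binomial k : \sum_(l < k.+1) 1 ^+ l * ((k - l).+1%:R) = (k.+1 * k.+2)%:R / 2 :> R.
Proof.
under eq_bigr do rewrite expr1n mul1r.
elim: k => [|k IH]; first by rewrite big_ord1 mul1n divff// pnatr_eq0.
rewrite big_ord_recl /= subn0.
rewrite (eq_bigr (fun l : 'I_k.+1 => (k - l).+1%:R)); last first.
  by move=> l _; rewrite /bump /= add1n subSS.
by rewrite IH !natrM -[k.+3%:R]natr1 -[k.+2%:R]natr1 -[k.+1%:R]natr1; field.
Qed.

(** The undamped case [r = 1]: the product form comes from [a + b + 1 <= (a + 1) * (b + 1)], and the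
    accumulated weights are triangular numbers. *)
Lemma conv_sqr_bound n N x : (forall k, (n <= k)%N -> x k = 0) ->
  \sum_(D < N) convseq n x x D ^+ 2 <=
  (\sum_(k < n) ((k.+1 * k.+2)%:R / 2) * x k ^+ 2) ^+ 2.
Proof.
move=> x0; pose g a : R := a.+1%:R; pose w k := x k ^+ 2.
have E : \sum_(l < n) (1 ^+ 2) ^+ l * (\sum_(a < n) g a * w (a + l)%N) =
  \sum_(k < n) ((k.+1 * k.+2)%:R / 2) * x k ^+ 2.
  rewrite expr1n (@sum_telescope _ _ g w 1); last by move=> k nk; rewrite /w x0// expr0n.
  by apply: eq_bigr => k _; rewrite sum_binomial.
rewrite -E.
have := @convseq_bound R n N 1 x (fun _ => 1) (fun l => \sum_(a < n) g a * w (a + l)%N).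
have -> : (fun k => 1 ^+ k * x k) = x by apply/funext => k; rewrite expr1n mul1r.
move=> H; under eq_bigr do rewrite -[_ ^+ 2]mul1r; apply: H => //.
  by move=> l; apply: sumr_ge0 => a _; rewrite mulr_ge0// sqr_ge0.
move=> l ln; rewrite expr1n.
have := @conv_single R n N (fun k => x (k + l)%N) (fun D => 1 * 1 ^+ D) (fun a b => g a * g b).
move=> H; apply: (le_trans (H _ _)).
- by move=> D; rewrite expr1n mul1r.
- move=> a b; rewrite expr1n !mul1r /g -natrM ler_nat; nia.
rewrite le_eqVlt; apply/orP; left; apply/eqP.
rewrite expr2 mulr_suml; apply: eq_bigr => a _; rewrite mulr_sumr; apply: eq_bigr => b _.
by rewrite /w; ring.
Qed.

End WeightedBounds.

(** * Third and fourth moments in terms of the weighted tail *)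

Section Trilinear.
Variable R : realType.
Implicit Types (x y u v w z : nat -> R).

(* Proportional to [conv_wt] for [k >= 2] and equal to 1 at [k = 2]. *)
Definition tail_wt (X : R) (k : nat) : R :=
  if k is k'.+2 then 3 / (k'.+3%:R * X ^+ k') else 0.

Lemma wt_ge0 X k : 0 < X -> 0 <= tail_wt X k.
Proof.
move=> X0; case: k => [|[|k]] //=; apply: divr_ge0 => //.
by rewrite mulr_ge0// exprn_ge0// ltW.
Qed.

Lemma wt2 X : tail_wt X 2 = 1. Proof. by rewrite /= expr0 mulr1 divff// pnatr_eq0. Qed.

Lemma wt_inv X k : 0 < X -> tail_wt X k.+2 * (k.+3%:R * X ^+ k) = 3.
Proof.
move=> X0; rewrite /tail_wt divfK// mulf_neq0 ?pnatr_eq0// gt_eqF// exprn_gt0//.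
Qed.

Lemma wtS X k : 0 < X -> k.+4%:R * X * tail_wt X k.+3 = k.+3%:R * tail_wt X k.+2.
Proof.
move=> X0; have h := wt_inv k X0; have := wt_inv k.+1 X0.
rewrite exprS -{}h => h; have Xk : X ^+ k != 0 by rewrite gt_eqF// exprn_gt0.
by apply: (mulIf Xk); rewrite [RHS]mulrAC [RHS]mulrC -mulrA -h; ring.
Qed.

(** [35 / 100] leaves room above [X = 1 / 3], its value at [q = 4]. The weight at 3 is
    [3 / (4 X) > 2], and later weights increase. *)
Lemma wt_ge2 X k : 0 < X <= 35 / 100 -> 2 <= tail_wt X k.+3.
Proof.
move=> /andP[X0 X1]; elim: k => [|k IH].
  have := wtS 0 X0; rewrite wt2 => h; have : 0 <= tail_wt X 3 by exact: wt_ge0.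
  by move: h; move: (tail_wt X 3) => a h; nra.
have := wtS k.+1 X0; move: IH; move: (tail_wt X k.+3) (tail_wt X k.+4) (wt_ge0 k.+4 X0) => a b b0 a2.
have : (3 : R) <= k.+3%:R by rewrite ler_nat.
rewrite -[k.+4%:R]natr1 -[k.+1.+4%:R]natr1 -[k.+4%:R]natr1; move: (k.+3%:R : R) => m m3 h.
have : (m + 1 + 1) * X <= m + 1 by nra.
by move=> h'; have := ler_wpM2r b0 h'; rewrite h; nra.
Qed.

(** Equality at [k = 0], where the triangular number is 6; afterwards the weights grow faster. The
    triangular number 3 at index 1 and this 6 are the constants of [conv_sqr_le]. *)
Lemma wt_binomial X k : 0 < X <= 35 / 100 ->
  (k.+3 * k.+4)%:R / 2 <= 6 * tail_wt X k.+2.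
Proof.
move=> /andP[X0 X1]; elim: k => [|k IH]; first by rewrite wt2 natrM; lra.
have := wtS k X0; move: IH; rewrite !natrM.
move: (tail_wt X k.+2) (tail_wt X k.+3) (wt_ge0 k.+3 X0) => a b b0.
rewrite -[k.+1.+4%:R]natr1 -[k.+4%:R]natr1.
have : (3 : R) <= k.+3%:R by rewrite ler_nat.
move: (k.+3%:R : R) => m m3 a1 h.
have h2 : m * (m * (m + 1)) <= 12 * ((m + 1) * X * b) by rewrite h; nra.
have h3 : (m + 1) * X * b <= (m + 1) * (35 / 100) * b.
  by rewrite ler_wpM2r// ler_wpM2l//; lra.
have h4 : m * m <= 12 * (35 / 100) * b by nra.
nra.
Qed.

Lemma sum_wt n x X :
  \sum_(k < n.+2) tail_wt X k * x k ^+ 2 = \sum_(k < n) tail_wt X k.+2 * x k.+2 ^+ 2.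
Proof. by rewrite 2!big_ord_recl /= !mul0r !add0r. Qed.

(** The three indices are the side lengths of a tripod with legs [a], [b], [l], whence the symmetry
    in [x], [y], [w]. *)
Definition trilin n x y w : R :=
  \sum_(a < n) \sum_(b < n) \sum_(l < n) x (a + l)%N * y (b + l)%N * w (a + b)%N.

Lemma triC n x y w : trilin n x y w = trilin n y x w.
Proof.
rewrite /trilin exchange_sum; apply: eq_bigr => a _; apply: eq_bigr => b _.
by apply: eq_bigr => l _; rewrite [y _ * _]mulrC [(b + a)%N]addnC.
Qed.

Lemma triR n x y w : trilin n x y w = trilin n w y x.
Proof.
rewrite /trilin; apply: eq_bigr => a _; rewrite exchange_sum; apply: eq_bigr => b _.
by apply: eq_bigr => l _; rewrite [(l + b)%N]addnC; ring.
Qed.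

Lemma tri_lin n (c : R) u z y w :
  trilin n (fun k => c * u k + z k) y w = c * trilin n u y w + trilin n z y w.
Proof.
rewrite /trilin mulr_sumr -big_split; apply: eq_bigr => a _ /=.
rewrite mulr_sumr -big_split; apply: eq_bigr => b _ /=.
by rewrite mulr_sumr -big_split; apply: eq_bigr => l _ /=; ring.
Qed.

Lemma tri_convseq n x y w : (forall k, (n <= k)%N -> w k = 0) ->
  \sum_(D < n) convseq n x y D * w D = trilin n x y w.
Proof.
move=> w0; rewrite /convseq /trilin.
transitivity (\sum_(D < n) \sum_(l < n) \sum_(a < n) \sum_(b < n)
    (if (a + b == D)%N then x (a + l)%N * y (b + l)%N * w D else 0)).
  apply: eq_bigr => D _; rewrite mulr_suml; apply: eq_bigr => l _.
  rewrite mulr_suml; apply: eq_bigr => a _; rewrite mulr_suml; apply: eq_bigr => b _.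
  by case: ifP => // _; rewrite mul0r.
rewrite exchange_sum.
under eq_bigr do rewrite exchange_sum.
rewrite exchange_sum; apply: eq_bigr => a _.
under eq_bigr do rewrite exchange_sum.
rewrite exchange_sum; apply: eq_bigr => b _; apply: eq_bigr => l _.
have [abn|nab] := ltnP (a + b)%N n; last first.
  rewrite w0// mulr0 big1// => D _; case: eqP => // E.
  by move: (ltn_ord D); rewrite -E ltnNge nab.
rewrite (bigD1 (Ordinal abn)) //= eqxx big1 ?addr0// => D.
by rewrite -val_eqE /= eq_sym => /negbTE ->.
Qed.

Lemma sum_eq1 n (H : nat -> nat -> R) :
  \sum_(a < n.+2) \sum_(l < n.+2) (a + l == 1)%N%:R * H a l = H 0%N 1%N + H 1%N 0%N.
Proof.
have Z (F : 'I_n -> R) : (forall a, F a = 0) -> \sum_(a < n) F a = 0 by move=> F0; rewrite big1.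
rewrite 2!big_ord_recl (Z (fun a => _)) => [|a]; last first.
  by rewrite big1// => l _; rewrite /bump /= mul0r.
rewrite 2!big_ord_recl (Z (fun a => _)) => [|a]; last by rewrite /bump /= mul0r.
rewrite 2!big_ord_recl (Z (fun a => _)) => [|a]; last by rewrite /bump /= mul0r.
by rewrite /bump /= !mul0r !mul1r !add0r !addr0.
Qed.

Lemma tri_e1 n y w : trilin n.+2 (fun k => (k == 1%N)%:R) y w =
  \sum_(b < n.+2) (y b.+1 * w b + y b * w b.+1).
Proof.
rewrite /trilin exchange_sum; apply: eq_bigr => b _.
rewrite (eq_bigr (fun a : 'I_n.+2 => \sum_(l < n.+2) (a + l == 1)%N%:R *
  (y (b + l)%N * w (a + b)%N))); last by move=> a _; apply: eq_bigr => l _; rewrite mulrA.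
by rewrite (sum_eq1 n (fun a l => y (b + l)%N * w (a + b)%N)) addn0 addn1.
Qed.

(* Split [x] into [x 1] at index 1 and a tail [z]: by parity the pure index 1 term
   vanishes, and the symmetry of [trilin] reduces the mixed terms to [tri_e1]. *)
Lemma tri_bound n x (X e : R) : 0 < X <= 35 / 100 -> (forall k, 0 <= x k) ->
  x 0%N = 0 -> (forall k, (n.+2 <= k)%N -> x k = 0) ->
  0 <= e -> e ^+ 2 = \sum_(k < n.+2) tail_wt X k * x k ^+ 2 ->
  \sum_(D < n.+2) convseq n.+2 x x D * x D <=
    3 * x 1%N ^+ 2 * e + 3 * x 1%N * e ^+ 2 + 6 * e ^+ 3.
Proof.
move=> X35 x0 x00 xn e0; set E := \sum_(k < n.+2) _ => eE; have [X0 X1] := andP X35.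
pose e1 k : R := (k == 1%N)%:R.
pose z k := if (k < 2)%N then 0 else x k.
have xE : x = (fun k => x 1%N * e1 k + z k).
  apply/funext => -[|[|k]]; rewrite /e1 /z /= ?x00 ?mulr0 ?mulr1 ?addr0 ?add0r//.
have z0 k : 0 <= z k by rewrite /z; case: ifP.
have zn k : (n.+2 <= k)%N -> z k = 0 by move=> nk; rewrite /z xn// if_same.
pose m := \sum_(b < n) x b.+2 * x b.+3.
have T1 : trilin n.+2 e1 x x = 2 * (x 1%N * x 2%N) + 2 * m.
  rewrite tri_e1 2!big_ord_recl /= x00 /bump /= addrA /m [in RHS]mulr_sumr.
  by congr (_ + _); [ring|apply: eq_bigr => b _; rewrite !add1n; ring].
have T2 : trilin n.+2 e1 z x = x 1%N * x 2%N + 2 * m.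
  rewrite tri_e1 2!big_ord_recl /= x00 /bump /= addrA /m [in RHS]mulr_sumr.
  by congr (_ + _); [rewrite /z /=; ring|apply: eq_bigr => b _; rewrite !add1n /z /=; ring].
have T3 : trilin n.+2 e1 z z = 2 * m.
  rewrite tri_e1 2!big_ord_recl /= /bump /= addrA /m [in RHS]mulr_sumr.
  rewrite [X in X + _](_ : _ = 0) ?add0r; last by rewrite /z /=; ring.
  by apply: eq_bigr => b _; rewrite !add1n /z /=; ring.
have EE : E = \sum_(k < n) tail_wt X k.+2 * x k.+2 ^+ 2 by exact: sum_wt.
have wx0 k : 0 <= tail_wt X k * x k ^+ 2 by rewrite mulr_ge0 ?wt_ge0// sqr_ge0.
have E0 : 0 <= E by apply: sumr_ge0.
have x2e : x 2%N <= e.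
  apply: le_of_sqr => //; rewrite eE EE.
  case: (n) xn => [|k] xn; first by rewrite xn// expr0n big_ord0.
  rewrite big_ord_recl wt2 mul1r lerDl; apply: sumr_ge0 => j _; exact: wx0.
(* Splitting each product of neighbours in half counts index 2 with weight 1/2 and later indices
   with weight at most 1, which [tail_wt >= 2] covers. *)
have mE : m <= e ^+ 2 / 2.
  rewrite eE EE /m; case: (n) xn => [|k] xn; first by rewrite !big_ord0 mul0r.
  have : \sum_(b < k.+1) x b.+2 * x b.+3 <= 
     \sum_(b < k.+1) (x b.+2 ^+ 2 / 2) + \sum_(b < k.+1) (x b.+3 ^+ 2 / 2).
    rewrite -big_split; apply: ler_sum => b _ /=.
    by have := sqr_ge0 (x b.+2 - x b.+3); nra.
  rewrite [X in _ <= _ + X -> _](_ : _ = \sum_(b < k) x b.+3 ^+ 2 / 2); last first.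
    by rewrite big_ord_recr /= xn// expr0n /= mul0r addr0.
  move=> h; apply: le_trans h _; rewrite big_ord_recl.
  rewrite [Z in _ <= Z / 2]big_ord_recl [tail_wt X _](wt2 X) mul1r -addrA -big_split.
  rewrite mulrDl lerD2l mulr_suml; apply: ler_sum => b _.
  change (x b.+3 ^+ 2 / 2 + x b.+3 ^+ 2 / 2 <= tail_wt X b.+3 * x b.+3 ^+ 2 / 2).
  have := ler_wpM2r (sqr_ge0 (x b.+3)) (wt_ge2 b X35); lra.
(* Cauchy-Schwarz between the convolution, of norm at most [6 * e ^+ 2], and [z], of norm at most
   [e]. *)
have zzz : trilin n.+2 z z z <= 6 * e ^+ 3.
  rewrite -tri_convseq//.
  have Zw k : z k ^+ 2 <= tail_wt X k * x k ^+ 2.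
    case: k => [|[|k]]; rewrite /z /= ?expr0n ?mul0r//.
    rewrite ler_peMl ?sqr_ge0//; case: k => [|k]; first by rewrite -/(tail_wt X 2) wt2.
    by apply: le_trans (wt_ge2 k X35); lra.
  have B : \sum_(k < n.+2) ((k.+1 * k.+2)%:R / 2) * z k ^+ 2 <= 6 * e ^+ 2.
    rewrite eE mulr_sumr; apply: ler_sum => -[[|[|k]] /= _] _; rewrite /z /= ?expr0n ?mulr0 ?mul0r//.
    rewrite -/(tail_wt X k.+2) mulrA; apply: ler_wpM2r; [exact: sqr_ge0|exact: wt_binomial].
  have Z2 : \sum_(D < n.+2) z D ^+ 2 <= e ^+ 2 by rewrite eE; apply: ler_sum.
  apply: le_of_sqr; first by rewrite mulr_ge0 ?exprn_ge0.
  apply: le_trans (@cs_sum R _ (index_enum _) xpredT _ _) _.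
  have -> : (6 * e ^+ 3) ^+ 2 = (6 * e ^+ 2) ^+ 2 * e ^+ 2 by ring.
  apply: ler_pM => //; try by apply: sumr_ge0 => *; exact: sqr_ge0.
  apply: le_trans (conv_sqr_bound _ zn) _.
  rewrite ler_pXn2r// ?nnegrE ?mulr_ge0 ?exprn_ge0//.
  by apply: sumr_ge0 => k _; apply: mulr_ge0; [rewrite divr_ge0|exact: sqr_ge0].
have lin u w : trilin n.+2 x u w = x 1%N * trilin n.+2 e1 u w + trilin n.+2 z u w.
  by rewrite -tri_lin -xE.
rewrite tri_convseq// lin T1 triC lin T2 triR lin T3.
have : x 1%N ^+ 2 * x 2%N <= x 1%N ^+ 2 * e by rewrite ler_wpM2l// sqr_ge0.
have : x 1%N * m <= x 1%N * (e ^+ 2 / 2) by rewrite ler_wpM2l.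
move: zzz; move: (trilin _ _ _ _) => t; nra.
Qed.

Lemma conv_sqr_le n x (X : R) : 0 < X <= 35 / 100 ->
  (forall k, (n.+2 <= k)%N -> x k = 0) -> forall N,
  \sum_(D < N) convseq n.+2 x x D ^+ 2 <=
  (x 0%N ^+ 2 + 3 * x 1%N ^+ 2 + 6 * \sum_(k < n.+2) tail_wt X k * x k ^+ 2) ^+ 2.
Proof.
move=> X35 xn N; have [X0 X1] := andP X35; apply: le_trans (conv_sqr_bound N xn) _.
apply: lerXn2r; rewrite ?nnegrE.
- by apply: sumr_ge0 => k _; apply: mulr_ge0; [rewrite divr_ge0|exact: sqr_ge0].
- apply: addr_ge0.
    by apply: addr_ge0; [exact: sqr_ge0|apply: mulr_ge0 => //; exact: sqr_ge0].
  apply: mulr_ge0 => //; apply: sumr_ge0 => k _.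
  by apply: mulr_ge0; [exact: wt_ge0|exact: sqr_ge0].
rewrite 2!big_ord_recl [X in _ <= _ + 6 * X]big_ord_recl [X in _ <= _ + 6 * (_ + X)]big_ord_recl /=.
rewrite !mul0r !add0r /bump /= addrA lerD//; last first.
  rewrite mulr_sumr; apply: ler_sum => k _.
  change ((k.+3 * k.+4)%:R / 2 * x k.+2 ^+ 2 <= 6 * (tail_wt X k.+2 * x k.+2 ^+ 2)).
  by have := ler_wpM2r (sqr_ge0 (x k.+2)) (wt_binomial k X35); lra.
by rewrite le_eqVlt; apply/orP; left; apply/eqP; rewrite !natrM; field.
Qed.

End Trilinear.

(** * Moments of the square of a radial multiplier *)

Section Moments.
Variables (R : realType) (I : choiceType).
Local Notation F := (freegroup I).
Local Notation A := (grpalg R F).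
Local Notation dl := (delta R (1%g : F)).
Implicit Types (u v z : A) (g : F) (P Q : {poly R}).

(** The Poisson operator [P_t] with [r = exp(-t)], see [PoissonE]. *)
Definition radial (r : R) u : A := [fsfun g in finsupp u => (r ^+ fglen g)%:C%C * u g].

Lemma multE r u g : radial r u g = (r ^+ fglen g)%:C%C * u g.
Proof.
rewrite fsfunE; case: ifPn => // gu; by rewrite (fsfun_dflt gu) mulr0.
Qed.

Lemma nn_mult r u D : 0 <= r -> nn (radial r u) D = r ^+ D * nn u D.
Proof.
move=> r0; rewrite /nn /nrm.
have -> : vec (lcomp D (radial r u)) = (r ^+ D)%:C%C *: vec (lcomp D u).
  apply: l2_ext => g; rewrite l2Z !vecE !compE multE.
  by case: eqP => [->//|_]; rewrite mulr0.
by rewrite l2normZr ger0_norm// exprn_ge0.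
Qed.

Lemma shorter_mult n r u : shorter n u -> shorter n (radial r u).
Proof. by move=> un g /(fsubsetP (finsupp_sub _ _ _)); exact: un. Qed.

Definition traceless u : A := [fsfun g in finsupp u => if fglen g == 0%N then 0 else u g].

Lemma offE u g : traceless u g = if fglen g == 0%N then 0 else u g.
Proof.
rewrite fsfunE; case: ifPn => // gu; case: ifP => // _.
by rewrite (fsfun_dflt gu).
Qed.

Lemma fglen0 g : (fglen g == 0%N) = (g == 1%g).
Proof.
apply/idP/eqP => [/nilP h|->] //; apply: val_inj; exact: h.
Qed.

Lemma shorter_off n u : shorter n u -> shorter n (traceless u).
Proof. by move=> un g /(fsubsetP (finsupp_sub _ _ _)); exact: un. Qed.

Lemma nn_off u D : nn (traceless u) D = if D == 0%N then 0 else nn u D.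
Proof.
rewrite /nn /nrm; case: eqP => [->|/eqP D0].
  rewrite -[RHS](l2norm0 R F); congr l2norm; apply: l2_ext => g.
  by rewrite vecE compE offE; case: (fglen g == 0%N).
congr l2norm; apply: l2_ext => g; rewrite !vecE !compE offE.
by case: eqP => // ->; rewrite (negbTE D0).
Qed.

Lemma lsum_off u f : lsum u f = u 1%g *: f + lsum (traceless u) f.
Proof.
apply: l2_ext => g.
have S1 : (finsupp u `<=` (1%g |` finsupp u))%fset by exact: fsubsetU1.
have S2 : (finsupp (traceless u) `<=` (1%g |` finsupp u))%fset.
  by apply: fsubset_trans S1; exact: finsupp_sub.
rewrite (lsum_sub f S1) (lsum_sub f S2) l2D l2Z.
have o1 : 1%g \in (1%g |` finsupp u)%fset by rewrite in_fset1U eqxx.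
rewrite 2!(big_fsetD1 1%g o1) !l2D !l2Z lregE offE fglen0 eqxx mul0r add0r invg1 mul1g.
congr (_ + _); rewrite !l2_sumE; apply: eq_big_seq => a.
by rewrite in_fsetD1 !l2Z offE fglen0 => /andP[/negbTE -> _].
Qed.

(** The real part of the trace of [P(u)]; for [u = z^* z] and [P = X^k] it is a moment of [y]. *)
Definition mom u P : R := ip (polyop P (lsum u) dl) dl.

Lemma mom_lin u c P Q : mom u (c *: P + Q) = c * mom u P + mom u Q.
Proof. by rewrite /mom polyop_lin ipDl ipZl. Qed.

Lemma mom0 u : mom u 0 = 0.
Proof. by rewrite /mom polyop0 ip0l. Qed.

Lemma momD u P Q : mom u (P + Q) = mom u P + mom u Q.
Proof. by rewrite -[P]scale1r mom_lin mul1r scale1r. Qed.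

Lemma momZ u c P : mom u (c *: P) = c * mom u P.
Proof. by rewrite -[c *: P]addr0 mom_lin mom0 addr0. Qed.

Lemma ip_delta : ip dl dl = 1.
Proof. by rewrite ipff l2norm_delta expr1n. Qed.

Lemma mom1 u : mom u 1 = 1.
Proof. by rewrite /mom -[1]/(1%:P) polyopC ipZl mul1r ip_delta. Qed.

Lemma mom_bcomp z P :
  ip (polyop P (bcomp (adjoint (lsum z)) (lsum z)) dl) dl = mom (conv (star z) z) P.
Proof.
rewrite /mom (@eq_polyop _ _ _ _ (lsum (conv (star z) z)))// => f.
by rewrite lsum_conv -adjoint_lsum.
Qed.

Section Square.
Variable z : A.
Let y := conv (star z) z.
Let s0 := nn y 0.

Lemma square_sym f h : ip (lsum y f) h = ip f (lsum y h).
Proof.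
rewrite !lsum_conv ipC -[star z]/(star z).
have S f1 h1 : ip (lsum (star z) f1) h1 = ip f1 (lsum z h1).
  by rewrite ipC -ip_lsum ipC.
by rewrite ipC S [RHS]ipC S ipC.
Qed.

(** The coefficient at the identity is a sum of squared moduli, so it equals its own modulus: [s0]
    is the trace of [y]. *)
Lemma square1 : y 1%g = s0%:C%C.
Proof.
have E : y 1%g = (\sum_(a <- finsupp (star z)) normsq (z a^-1%g))%:C%C.
  rewrite /y convE raddf_sum /=; apply: eq_bigr => a _; rewrite starE mulg1.
  by case: (z _) => p q; apply/eqP; rewrite eq_complex /normsq /=; apply/andP; split; apply/eqP; ring.
rewrite E; congr (_ %:C)%C; set c := \sum_(_ <- _) _ in E *.
have c0 : 0 <= c by apply: sumr_ge0 => a _; exact: normsq_ge0.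
apply/eqP; rewrite -(@eqrXn2 _ 2)// ?nn_ge0// /s0 nn_sqr.
have S1 : (finsupp y `<=` (1%g |` finsupp y))%fset by exact: fsubsetU1.
have o1 : 1%g \in (1%g |` finsupp y)%fset by rewrite in_fset1U eqxx.
rewrite big_mkcond (big_fset_incl _ S1) => [|g _ gy]; last first.
  by rewrite (fsfun_dflt gy) /normsq /= expr0n addr0 if_same.
rewrite (big_fsetD1 1%g o1) /= E big1_fset => [|g]; last first.
  by rewrite in_fsetD1 fglen0 => /andP[/negbTE ->].
by rewrite addr0 /normsq /= expr0n addr0.
Qed.

Lemma lsum_square f : lsum y f = s0%:C%C *: f + lsum (traceless y) f.
Proof. by rewrite lsum_off square1. Qed.

Lemma off_sym f h : ip (lsum (traceless y) f) h = ip f (lsum (traceless y) h).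
Proof.
have E k : lsum (traceless y) k = lsum y k - s0%:C%C *: k by rewrite lsum_square addrAC subrr add0r.
by rewrite !E ipBl ipBr square_sym ipZl ipZr.
Qed.

Lemma polyop_shift k f :
  polyop (('X - s0%:P) ^+ k) (lsum y) f = iter k (lsum (traceless y)) f.
Proof.
elim: k => [|k IH]; first by rewrite expr0 -[1]/(1%:P) polyopC scale1r.
rewrite exprS (polyopM _ _ (lsum y)) IH /= -polyCN polyopD polyopX polyopC lsum_square.
by rewrite rmorphN scaleNr addrAC subrr add0r.
Qed.

Lemma mom_shift1 : mom y ('X - s0%:P) = 0.
Proof.
rewrite -[_ - _]expr1 /mom polyop_shift /= -/(vec _).
rewrite (ip_vec _ (fsubset_refl _)) big_seq big1// => g.
rewrite mem_finsupp offE fglen0 /delta /=; have [_|_] := eqVneq g 1%g; first by rewrite eqxx.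
by rewrite rmorph0 mulr0.
Qed.

Lemma mom_shift2 : mom y (('X - s0%:P) ^+ 2) = nrm (traceless y) ^+ 2.
Proof. by rewrite /mom polyop_shift /= off_sym ipff. Qed.

Lemma mom_shift3 :
  mom y (('X - s0%:P) ^+ 3) = ip (vec (conv (traceless y) (traceless y))) (vec (traceless y)).
Proof. by rewrite /mom polyop_shift /= off_sym vec_conv. Qed.

Lemma mom_shift4 : mom y (('X - s0%:P) ^+ 4) = nrm (conv (traceless y) (traceless y)) ^+ 2.
Proof. by rewrite /mom polyop_shift /= off_sym off_sym -ipff vec_conv. Qed.

Lemma momX4 : mom y ('X ^+ 4) = nrm (conv y y) ^+ 2.
Proof.
have -> : 'X ^+ 4 = 'X * ('X * ('X * 'X)) :> {poly R} by rewrite !exprS expr0 mulr1.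
rewrite /mom !(polyopM _ _ (lsum y)) !polyopX.
by rewrite square_sym square_sym -ipff vec_conv.
Qed.

End Square.
End Moments.

(** * Weighted estimates for [y] and its moments *)

Section Bounds.
Variables (R : realType) (I : choiceType).
Local Notation F := (freegroup I).
Local Notation A := (grpalg R F).
Implicit Types (x y z : A).

Lemma nn_square0 z : nn (conv (star z) z) 0 = nrm z ^+ 2.
Proof.
set y := conv _ _; have := mom_shift1 z; rewrite -/y /mom -polyCN polyopD polyopX polyopC.
rewrite ipDl ipZl ip_delta mulr1 => h.
have : nrm z ^+ 2 = ip (lsum y (delta R 1%g)) (delta R 1%g).
  by rewrite lsum_conv ipC -ip_lsum -ipff.
by move=> ->; move: h; lra.
Qed.

(** Turns a gain in [T], the mass of [x] off the identity, into one in [1 - s0 <= 1 - a]. If [1 - a]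
    is large, then [T] is large or the total mass falls short of 1:
    [(1 - a)^2 <= 2 (1 - a - T) + 2 T^2]. *)
Lemma deficit_bound (k a T S s0 : R) : 0 <= k <= 1 -> 0 <= a -> 0 <= T -> S = a + T -> S <= 1 ->
  a <= s0 <= 1 -> (S - k * T ^+ 2 / 2) ^+ 2 <= 1 - k / 4 * (1 - s0) ^+ 2.
Proof.
move=> /andP[k0 k1] a0 T0 -> S1 /andP[as0 s01].
have T1 : 0 <= T ^+ 2 <= T by apply/andP; split; [exact: sqr_ge0|nra].
have kT : 0 <= k * T ^+ 2 <= T ^+ 2.
  apply/andP; split; first by apply: mulr_ge0 => //; exact: sqr_ge0.
  by apply: ler_piMl => //; exact: sqr_ge0.
have h1 : (a + T - k * T ^+ 2 / 2) ^+ 2 <= a + T - k * T ^+ 2 / 2.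
  move: kT T1 => /andP[u1 u2] /andP[u3 u4].
  have : 0 <= a + T - k * T ^+ 2 / 2 <= 1 by apply/andP; split; lra.
  by move: (a + T - _) => c /andP[c0 c1]; nra.
apply: le_trans h1 _.
have h2 : (1 - s0) ^+ 2 <= (1 - a) ^+ 2 by nra.
have h3 : (1 - a) ^+ 2 <= 2 * (1 - a - T) + 2 * T ^+ 2.
  by have := sqr_ge0 (1 - a - 2 * T); nra.
have h4 : k / 4 * (1 - s0) ^+ 2 <= k / 4 * (2 * (1 - a - T) + 2 * T ^+ 2).
  by apply: ler_wpM2l; [lra|lra].
have : k * (1 - a - T) <= 1 - a - T by apply: ler_piMl; lra.
lra.
Qed.

Lemma sig_wt (X mu : R) k : 0 < X ->
  conv_wt X mu k.+2 = mu * ((1 - X) ^+ 2 / (3 * X ^+ 2)) * tail_wt X k.+2.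
Proof.
move=> X0; rewrite /= (_ : X ^+ k.+2 = X ^+ 2 * X ^+ k); last by rewrite -exprD add2n.
have : X ^+ k != 0 by rewrite gt_eqF// exprn_gt0.
have : (k.+3%:R : R) != 0 by rewrite pnatr_eq0.
by move: (X ^+ k) (k.+3%:R) => b m m0 b0; field; rewrite m0 b0 gt_eqF.
Qed.

(** The base [(1 - X) / (2 X)] is [p - 1]. The factor [2^D] in the denominator beats the number
    [D + 1] of pairs. *)
Lemma sig_pow (X : R) D : 0 < X < 1 -> ((1 - X) / (2 * X)) ^+ D <= conv_wt X 1 D.
Proof.
move=> /andP[X0 X1]; case: D => [|[|D]] /=; rewrite ?expr0 ?expr1//.
have h1 : (1 - X) ^+ D <= 1 by apply: exprn_ile1; lra.
have h2 : (D.+3 <= 2 ^ D.+2)%N by apply: ltn_expl.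
have h3 : (D.+3%:R : R) <= 2 ^+ D.+2 by rewrite -natrX ler_nat.
have XD := exprn_gt0 D.+2 X0.
have den : 0 < D.+3%:R * X ^+ D.+2 by apply: mulr_gt0.
rewrite mul1r (ler_pdivlMr _ _ den) [_ ^+ D.+2]exprMn exprVn [(2 * X) ^+ _]exprMn.
rewrite [X in X <= _](_ : _ = (1 - X) ^+ 2 * ((1 - X) ^+ D * D.+3%:R / 2 ^+ D.+2)); last first.
  rewrite (_ : (1 - X) ^+ D.+2 = (1 - X) ^+ 2 * (1 - X) ^+ D); last by rewrite -exprD add2n.
  move: XD; move: (X ^+ D.+2) ((1 - X) ^+ D) => b c b0.
  have : (2 ^+ D.+2 : R) != 0 by rewrite gt_eqF// exprn_gt0.
  by move: (2 ^+ D.+2) => d d0; field; rewrite d0 gt_eqF.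
apply: ler_piMr; first exact: sqr_ge0.
rewrite ler_pdivrMr ?exprn_gt0// mul1r; apply: le_trans h3.
by apply: ler_piMl.
Qed.

Lemma square_weighted n N x (r mu : R) : 0 < r -> r ^+ 2 < 1 -> 0 <= mu <= 1 ->
  nrm x <= 1 -> shorter n x ->
  let y := conv (star (radial r x)) (radial r x) in
  (\sum_(D < N) conv_wt (r ^+ 2) mu D * nn y D ^+ 2 <=
  1 - (1 - mu) * (1 - r ^+ 2) ^+ 2 / 4 * (1 - nn y 0) ^+ 2) /\ nn y 0 <= 1.
Proof.
move=> r0 r1 mu01 x1 xn y; have [mu0 mu1] := andP mu01.
have X0 : 0 < r ^+ 2 by exact: exprn_gt0.
have xn1 : shorter n.+1 x by exact: shorter_le xn.
have zn : shorter n.+1 (radial r x) by exact: shorter_mult.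
have z0 : forall k, (n < k)%N -> nn x k = 0 by move=> k nk; apply: nn_eq0 xn _; exact: ltnW.
have x1' : nrm x ^+ 2 <= 1 by apply: exprn_ile1 => //; exact: nrm_ge0.
have S1 := x1'; rewrite (nrm_sum xn1) in S1.
have s0E : nn y 0 = \sum_(D < n.+1) (r ^+ 2) ^+ D * nn x D ^+ 2.
  rewrite nn_square0 (nrm_sum zn); apply: eq_bigr => D _.
  by rewrite nn_mult ?ltW// exprMn -!exprM mulnC.
have s01 : nn y 0 <= 1.
  rewrite s0E; apply: le_trans S1; apply: ler_sum => D _.
  apply: ler_piMl; first exact: sqr_ge0.
  by apply: exprn_ile1; exact: ltW.
split=> //.
have a0 : nn x 0 ^+ 2 <= nn y 0.
  rewrite s0E big_ord_recl expr0 mul1r lerDl; apply: sumr_ge0 => D _.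
  by apply: mulr_ge0; [apply: exprn_ge0; exact: ltW|exact: sqr_ge0].
have k01 : 0 <= (1 - mu) * (1 - r ^+ 2) ^+ 2 <= 1.
  clear -X0 r1 mu0 mu1; have : 0 <= (1 - r ^+ 2) ^+ 2 <= 1.
    by apply/andP; split; [exact: sqr_ge0|apply: exprn_ile1; lra].
  by move=> /andP[u1 u2]; apply/andP; split; [apply: mulr_ge0; lra|apply: mulr_ile1; lra].
pose T := \sum_(k < n) nn x k.+1 ^+ 2.
have ST : \sum_(k < n.+1) nn x k ^+ 2 = nn x 0 ^+ 2 + T by rewrite big_ord_recl.
have a1 : nn x 0 ^+ 2 <= nn y 0 <= 1 by rewrite a0.
have T0 : 0 <= T by apply: sumr_ge0 => *; exact: sqr_ge0.
apply: le_trans (deficit_bound k01 (sqr_ge0 _) T0 ST S1 a1).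
apply: le_trans (weighted_bound N r0 r1 mu01 z0 S1).
apply: ler_sum => D _; apply: ler_wpM2l.
  by apply: sig_ge0 => //; rewrite X0.
have Ynn := nn_ge0 y D.
have H : nn y D <= convseq n.+1 (fun k => r ^+ k * nn x k) (fun k => r ^+ k * nn x k) D.
  apply: le_trans (haagerup D (shorter_star zn) zn) _.
  rewrite (_ : nn (star _) = fun k => r ^+ k * nn x k); last first.
    by apply/funext => k; rewrite nn_star nn_mult// ltW.
  rewrite (_ : nn (radial _ _) = fun k => r ^+ k * nn x k)//.
  by apply/funext => k; rewrite nn_mult// ltW.
apply: lerXn2r => //; rewrite nnegrE//; exact: le_trans H.
Qed.

Lemma square_contraction x (r : R) : 0 < r -> r ^+ 2 < 1 -> nrm x <= 1 ->
  nrm (radial (Num.sqrt ((1 - r ^+ 2) / (2 * r ^+ 2))) (conv (star (radial r x)) (radial r x))) <= 1.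
Proof.
move=> r0 r1 x1; have [n xn] := exists_shorter x.
have X0 : 0 < r ^+ 2 by exact: exprn_gt0.
set y := conv _ _; have [N yN] := exists_shorter y.
set P := (1 - r ^+ 2) / _.
have P0 : 0 <= P by apply: divr_ge0; [lra|apply: mulr_ge0; lra].
apply: le_of_sqr => //; rewrite expr1n.
rewrite (nrm_sum (@shorter_mult _ _ N _ _ yN)).
have mu01 : 0 <= (1 : R) <= 1 by rewrite ler01 lexx.
have [H _] := square_weighted N r0 r1 mu01 x1 xn.
apply: le_trans (_ : _ <= \sum_(D < N) conv_wt (r ^+ 2) 1 D * nn y D ^+ 2) _.
  apply: ler_sum => D _; rewrite nn_mult ?sqrtr_ge0// exprMn -exprM mulnC exprM sqr_sqrtr//.
  by apply: ler_wpM2r; [exact: sqr_ge0|apply: sig_pow; rewrite X0].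
by apply: le_trans H _; rewrite subrr !mul0r subr0.
Qed.

(** [b] is [Y_1] and [e] the weighted tail norm. The fourth moment is bounded twice: centred at [s0]
    by [Q], for exponents [p < 2], and uncentred by [N], for [p > 3]. [mu] stays free because both
    [mu = 1] and [mu = 7 / 8] are used. *)
Lemma moment_bounds x (r : R) : 0 < r -> r ^+ 2 <= 35 / 100 -> nrm x <= 1 ->
  let z := radial r x in let y := conv (star z) z in let s0 := nn y 0 in
  exists b e V T N Q : R,
  [/\ [/\ mom y (('X - s0%:P) ^+ 2) = V, mom y (('X - s0%:P) ^+ 3) = T,
        mom y (('X - s0%:P) ^+ 4) = Q & mom y ('X ^+ 4) = N ^+ 2],
      [/\ 0 <= b, 0 <= e, 0 <= N & 0 <= s0 <= 1],
      [/\ 0 <= V <= b ^+ 2 + e ^+ 2, `|T| <= 3 * b ^+ 2 * e + 3 * b * e ^+ 2 + 6 * e ^+ 3,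
        N <= s0 ^+ 2 + 3 * b ^+ 2 + 6 * e ^+ 2 & Q <= (3 * b ^+ 2 + 6 * e ^+ 2) ^+ 2] &
      forall mu, 0 <= mu <= 1 ->
        s0 ^+ 2 + (1 - r ^+ 2) / (2 * r ^+ 2) * b ^+ 2 +
          mu * ((1 - r ^+ 2) ^+ 2 / (3 * r ^+ 2 ^+ 2)) * e ^+ 2 <=
        1 - (1 - mu) * (1 - r ^+ 2) ^+ 2 / 4 * (1 - s0) ^+ 2].
Proof.
move=> r0 r35 x1 z y s0; have [n xn] := exists_shorter x.
have X0 : 0 < r ^+ 2 by exact: exprn_gt0.
have X35 : 0 < r ^+ 2 <= 35 / 100 by rewrite X0.
have r1 : r ^+ 2 < 1 by lra.
have [m ym0] := exists_shorter y; have ym : shorter m.+2 y by apply: shorter_le ym0; lia.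
have yz k : (m.+2 <= k)%N -> nn y k = 0 by move=> ?; exact: nn_eq0 ym _.
have oz k : (m.+2 <= k)%N -> nn (traceless y) k = 0 by move=> h; rewrite nn_off yz// if_same.
set E := \sum_(k < m.+2) tail_wt (r ^+ 2) k * nn y k ^+ 2.
have wy k : 0 <= tail_wt (r ^+ 2) k * nn y k ^+ 2 by apply: mulr_ge0; [exact: wt_ge0|exact: sqr_ge0].
have E0 : 0 <= E by apply: sumr_ge0.
pose e := Num.sqrt E; have eE : e ^+ 2 = E by rewrite sqr_sqrtr.
have oE : e ^+ 2 = \sum_(k < m.+2) tail_wt (r ^+ 2) k * nn (traceless y) k ^+ 2.
  by rewrite eE; apply: eq_bigr => -[[|k] /= _] _; rewrite nn_off //= !mul0r.
exists (nn y 1), e, (nrm (traceless y) ^+ 2), (ip (vec (conv (traceless y) (traceless y))) (vec (traceless y))),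
  (nrm (conv y y)), (nrm (conv (traceless y) (traceless y)) ^+ 2).
have on : shorter m.+2 (traceless y) by exact: shorter_off.
have conv_le (u : A) N : shorter m.+2 u -> shorter N (conv u u) ->
    nrm (conv u u) ^+ 2 <= \sum_(D < N) convseq m.+2 (nn u) (nn u) D ^+ 2.
  move=> um uN; rewrite (nrm_sum uN); apply: ler_sum => D _.
  have H := haagerup D um um; apply: lerXn2r => //; rewrite nnegrE ?nn_ge0//.
  exact: le_trans (nn_ge0 _ _) H.
have EY : \sum_(k < m.+2) tail_wt (r ^+ 2) k * nn y k ^+ 2 = \sum_(k < m) tail_wt (r ^+ 2) k.+2 * nn y k.+2 ^+ 2.
  exact: sum_wt.
split.
- by split; [exact: mom_shift2|exact: mom_shift3|exact: mom_shift4|exact: momX4].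
- split; [exact: nn_ge0|exact: sqrtr_ge0|exact: nrm_ge0|rewrite nn_ge0 /=].
  have mu01 : 0 <= (1 : R) <= 1 by rewrite ler01 lexx.
  by have [_] := square_weighted 0 r0 r1 mu01 x1 xn.
- split.
  + rewrite sqr_ge0 /= (nrm_sum on) eE /E EY 2!big_ord_recl !nn_off /= expr0n add0r lerD2l.
    apply: ler_sum => k _; rewrite nn_off /= -/(tail_wt (r ^+ 2) k.+2).
    apply: ler_peMl; first exact: sqr_ge0.
    case: (nat_of_ord k) => [|j]; first by rewrite wt2.
    by apply: le_trans (wt_ge2 j X35); rewrite ler1n.
  + have := @tri_bound R m (nn (traceless y)) _ e X35 (nn_ge0 _) _ oz (sqrtr_ge0 _) oE.
    rewrite !nn_off /= => /(_ erefl); apply: le_trans.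
    rewrite ipC; apply: le_trans (ip_vec_le _ on) _; apply: ler_sum => D _.
    rewrite mulrC; apply: ler_wpM2r; [exact: nn_ge0|exact: haagerup].
  + have [N yN] := exists_shorter (conv y y).
    apply: le_of_sqr.
      rewrite eE; apply: addr_ge0; last exact: mulr_ge0.
      by apply: addr_ge0; [exact: sqr_ge0|apply: mulr_ge0 => //; exact: sqr_ge0].
    rewrite eE; exact: le_trans (conv_le y N ym yN) (conv_sqr_le X35 yz N).
  + have [N yN] := exists_shorter (conv (traceless y) (traceless y)).
    apply: (le_trans (conv_le _ N on yN)).
    apply: le_trans (conv_sqr_le X35 oz N) _.
    by rewrite -oE !nn_off /= expr0n add0r.
move=> mu mu01; have [H _] := square_weighted m.+2 r0 r1 mu01 x1 xn.
apply: le_trans H; rewrite 2!big_ord_recl /= mul1r addrA lerD2l eE /E EY mulr_sumr.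
apply: ler_sum => k _; rewrite -/(conv_wt (r ^+ 2) mu k.+2) (sig_wt mu k X0) -/(tail_wt _ _).
by rewrite mulrA.
Qed.

End Bounds.

(** * Comparison of powers with quartic polynomials *)

Section PowerTaylor.
Variable R : realType.
Implicit Types (s p k lo : R).

(** A convex function with a double zero at 1; the mean value theorem is applied twice on each side
    of 1. *)
Lemma second_order (f f1 f2 : R -> R) lo : lo < 1 ->
  (forall s, lo < s -> is_derive s 1 f (f1 s)) ->
  (forall s, lo < s -> is_derive s 1 f1 (f2 s)) ->
  (forall s, lo < s -> 0 <= f2 s) -> f 1 = 0 -> f1 1 = 0 ->
  forall s, lo < s -> 0 <= f s.
Proof.
move=> lo1 df df1 f20 f0 f10.
have mvt (g dg : R -> R) (a b : R) : (forall s, lo < s -> is_derive s 1 g (dg s)) ->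
    lo < a -> a <= b -> exists2 c, a <= c <= b & g b - g a = dg c * (b - a).
  move=> dgP la ab; have [x xab|x|c cab E] := @MVT_segment R g dg a b ab.
  - by apply: dgP; move: xab; rewrite in_itv /= => /andP[xa _]; exact: lt_trans xa.
  - apply: derivable_within_continuous => {}x xab; apply: ex_derive.
    by apply: dgP; move: xab; rewrite in_itv /= => /andP[xa _]; exact: lt_le_trans xa.
  by exists c => //; move: cab; rewrite in_itv.
move=> s los; have [s1|/ltW s1] := leP 1 s.
  have [c /andP[c1 cs]] := mvt f f1 1 s df lo1 s1; rewrite f0 subr0 => ->.
  have [d /andP[d1 dc]] := mvt f1 f2 1 c df1 lo1 c1; rewrite f10 subr0 => ->.
  by rewrite !mulr_ge0// ?subr_ge0// f20// (lt_le_trans lo1).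
have [c /andP[c1 cs]] := mvt f f1 s 1 df los s1; rewrite f0 sub0r => E.
have loc : lo < c by exact: lt_le_trans c1.
have [d /andP[d1 dc]] := mvt f1 f2 c 1 df1 loc cs; rewrite f10 sub0r => E1.
have fd := f20 d (lt_le_trans loc d1).
have : 0 <= f2 d * (1 - c) by rewrite mulr_ge0// subr_ge0.
have s10 : 0 <= 1 - s by rewrite subr_ge0.
rewrite -E1 => h; have := mulr_ge0 h s10; rewrite mulNr -E opprK//.
Qed.

(** The Taylor polynomial of [s^p] at 1 would have [k = (p - 2) (p - 3) / 24]; [k] is left free so
    that a majorant or a minorant can be obtained. *)
Definition taylor p k : {poly R} :=
  1 + p *: ('X - 1) + (p * (p - 1) / 2) *: ('X - 1) ^+ 2 +
  (p * (p - 1) * (p - 2) / 6) *: ('X - 1) ^+ 3 + (p * (p - 1) * k) *: ('X - 1) ^+ 4.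

Definition taylor1 p k : {poly R} :=
  p%:P + (p * (p - 1)) *: ('X - 1) +
  (p * (p - 1) * (p - 2) / 2) *: ('X - 1) ^+ 2 + (4 * (p * (p - 1) * k)) *: ('X - 1) ^+ 3.

Lemma horner1 s : (1 : {poly R}).[s] = 1. Proof. exact: hornerC. Qed.

Definition hornerS := (hornerD, hornerZ, horner_exp, hornerN, hornerX, hornerC, horner1).

Lemma horner_taylor p k s : (taylor p k).[s] =
  1 + p * (s - 1) + p * (p - 1) *
   ((s - 1) ^+ 2 / 2 + (p - 2) * (s - 1) ^+ 3 / 6 + k * (s - 1) ^+ 4).
Proof. by rewrite /taylor !hornerS; field. Qed.

Lemma deriv_pow n : (('X - 1 : {poly R}) ^+ n.+1)^`() = n.+1%:R *: ('X - 1) ^+ n.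
Proof. by rewrite deriv_exp derivB derivX -[1]/(1%:P) derivC subr0 mul1r scaler_nat. Qed.

Lemma taylor_deriv p k : (taylor p k)^`() = taylor1 p k.
Proof.
rewrite /taylor /taylor1 !derivD !derivZ !deriv_pow -['X - 1]expr1 deriv_pow expr0 !expr1.
rewrite -[1]/(1%:P) derivC add0r !scalerA mulr1 -mul_polyC mulr1.
by congr (_ + _ *: _ + _ *: _ + _ *: _); field.
Qed.

Lemma taylor1_deriv p k s : (taylor1 p k)^`().[s] =
  p * (p - 1) * (1 + (p - 2) * (s - 1) + 12 * k * (s - 1) ^+ 2).
Proof.
rewrite /taylor1 !derivD !derivZ !deriv_pow -['X - 1]expr1 deriv_pow expr0 !expr1.
by rewrite derivC !hornerS; field.
Qed.

(** Two derivatives reduce the comparison to [s^(p - 2)] against a quadratic. The sign of [c]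
    selects majorant or minorant, and [lo] keeps away from 0 where a negative exponent blows up. *)
Lemma taylor_compare (c : R) p k lo s : 0 <= lo < 1 ->
  (forall s, lo < s ->
    0 <= c * (1 + (p - 2) * (s - 1) + 12 * k * (s - 1) ^+ 2 - s `^ (p - 2))) ->
  1 <= p -> lo < s -> 0 <= c * ((taylor p k).[s] - s `^ p).
Proof.
move=> /andP[lo0 lo1] H p1 los.
pose f2 s := c * ((taylor1 p k)^`().[s] - p * ((p - 1) * s `^ (p - 1 - 1))).
apply: (@second_order (fun s => c * ((taylor p k).[s] - s `^ p))
  (fun s => c * ((taylor1 p k).[s] - p * s `^ (p - 1))) f2 lo _ _ _ _ _ _ s los).
- exact: lo1.
- move=> u lu; have u0 : 0 < u by exact: le_lt_trans lu.
  have h2 := @is_derive_poly R (taylor p k) u; rewrite taylor_deriv in h2.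
  exact: (is_deriveZ c (is_deriveB h2 (is_derive1_powR p u0))).
- move=> u lu; have u0 : 0 < u by exact: le_lt_trans lu.
  have h := is_derive1_powR (p - 1) u0.
  have h2 := @is_derive_poly R (taylor1 p k) u.
  exact: (is_deriveZ c (is_deriveB h2 (is_deriveZ p h))).
- move=> u lu; rewrite /f2 taylor1_deriv (_ : p - 1 - 1 = p - 2); last by ring.
  rewrite mulrA -mulrBr mulrCA; apply: mulr_ge0; last exact: H.
  by apply: mulr_ge0; lra.
- by rewrite horner_taylor powR1; ring.
- by rewrite powR1 /taylor1 !hornerS; ring.
Qed.

Lemma taylor_upper p k lo s : 0 <= lo < 1 -> 1 <= p ->
  (forall s, lo < s -> s `^ (p - 2) <= 1 + (p - 2) * (s - 1) + 12 * k * (s - 1) ^+ 2) ->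
  lo < s -> s `^ p <= (taylor p k).[s].
Proof.
move=> lo01 p1 H los; rewrite -subr_ge0 -[_ - _]mul1r.
by apply: taylor_compare los => // u lu; rewrite mul1r subr_ge0; exact: H.
Qed.

Lemma taylor_lower p k s : 1 <= p ->
  (forall s, 0 < s -> 1 + (p - 2) * (s - 1) + 12 * k * (s - 1) ^+ 2 <= s `^ (p - 2)) ->
  0 < s -> (taylor p k).[s] <= s `^ p.
Proof.
move=> p1 H los; rewrite -subr_le0 -oppr_ge0 -mulN1r.
apply: taylor_compare los => //; first by rewrite lexx ltr01.
by move=> u lu; rewrite mulN1r oppr_ge0 subr_le0; exact: H.
Qed.

Lemma taylor_upper23 p s : 2 <= p <= 3 -> 0 <= s -> s `^ p <= (taylor p 0).[s].
Proof.
move=> /andP[p2 p3]; rewrite le_eqVlt => /predU1P[<-|s0].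
  rewrite powR0 ?horner_taylor; last by apply/eqP; lra.
  have : 0 <= (p - 1) * (p - 2) * (3 - p) by rewrite !mulr_ge0 ?subr_ge0//; lra.
  lra.
apply: (@taylor_upper _ _ 0) => //; first by rewrite lexx ltr01.
  lra.
move=> u u0; have := @powR_le_tangent R u (p - 2) (ltW u0).
by rewrite mulr0 mul0r addr0; apply; apply/andP; split; lra.
Qed.

(** Multiplying the tangent bound for [s^(p - 3)] by [s] gives a quadratic with leading coefficient
    [p - 3 = 12 k]. *)
Lemma taylor_upper34 p s : 3 <= p <= 4 -> 0 <= s -> s `^ p <= (taylor p ((p - 3) / 12)).[s].
Proof.
move=> /andP[p3 p4]; rewrite le_eqVlt => /predU1P[<-|s0].
  rewrite powR0 ?horner_taylor; last by apply/eqP; lra.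
  have : 0 <= (p - 1) * (p - 3) * (4 - p) by rewrite !mulr_ge0 ?subr_ge0//; lra.
  lra.
apply: (@taylor_upper _ _ 0) => //; first by rewrite lexx ltr01.
  lra.
move=> u u0; have h : u `^ (p - 3) <= 1 + (p - 3) * (u - 1).
  by apply: powR_le_tangent; [exact: ltW|apply/andP; split; lra].
rewrite (_ : p - 2 = (p - 3) + 1); last by ring.
rewrite powRD ?powRr1 ?(ltW u0) ?(lt0r_neq0 u0) ?implybT//.
by have := ler_wpM2r (ltW u0) h; lra.
Qed.

(** [k] vanishes at [p = 2], which makes the cost proportional to [2 - p]. For [s > 1 / 2] the
    tangent bound for the power [2 - p] of [1 / s] suffices; for smaller [s] the second derivative
    is of no use, and [s * s^(p - 1)] is bounded by the tangent of [s^(p - 1)]. *)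
Lemma taylor_upper2 p s : 3 / 2 <= p <= 2 -> 0 <= s -> s `^ p <= (taylor p (2 * (2 - p))).[s].
Proof.
move=> /andP[p1 p2] s0; have [s2|s2] := leP s (1 / 2); last first.
  apply: (@taylor_upper _ _ (1 / 2)) => //; first by apply/andP; split; lra.
    lra.
  move=> u u2; have u0 : 0 < u by lra.
  have -> : p - 2 = - 1 * (2 - p) by ring.
  rewrite powRrM powR_inv1 ?(ltW u0)//; set i := u^-1.
  have i0 : 0 < i by rewrite invr_gt0.
  have iu : i * u = 1 by rewrite mulVf// gt_eqF.
  have i2 : i <= 2 by nra.
  have e : i - 1 + (u - 1) = (u - 1) ^+ 2 * i by rewrite -[1 in LHS]iu; nra.
  have : i `^ (2 - p) <= 1 + (2 - p) * (i - 1).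
    by apply: powR_le_tangent; [exact: ltW|apply/andP; split; lra].
  have : (u - 1) ^+ 2 * i <= (u - 1) ^+ 2 * 2 by rewrite ler_wpM2l// sqr_ge0.
  have := sqr_ge0 (u - 1); rewrite -e; move: ((u - 1) ^+ 2) => w w0 h1 h2; apply: le_trans h2 _.
  nra.
have h : s `^ (p - 1) <= 1 + (p - 1) * (s - 1).
  by apply: powR_le_tangent => //; apply/andP; split; lra.
have -> : s `^ p = s * s `^ (p - 1).
  have [->|sn] := eqVneq s 0; first by rewrite mul0r powR0//; apply/eqP; lra.
  rewrite -[X in X * _]powRr1// -powRD ?sn ?implybT//; congr (_ `^ _); ring.
apply: le_trans (ler_wpM2l s0 h) _; rewrite horner_taylor.
have [t te] : exists t, t = 1 - s by exists (1 - s).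
have -> : s = 1 - t by lra.
have t1 : 1 / 2 <= t <= 1 by lra.
move: t1 => /andP[t1 t2].
have [n ne] : exists n, n = 2 - p by exists (2 - p).
have -> : p = 2 - n by lra.
have n0 : 0 <= n <= 1 / 2 by lra.
move: n0 => /andP[n0 n1]; rewrite -subr_ge0.
set W := (X in 0 <= X).
have -> : W = n * (- t ^+ 2 / 2 + n * t ^+ 2 / 2 +
   (2 - n) * (1 - n) * (t ^+ 3 / 6 + 2 * t ^+ 4)) by rewrite /W; field.
apply: mulr_ge0 => //.
have m1 : 3 / 4 <= (2 - n) * (1 - n) by nra.
have t3 : 0 <= t ^+ 3 by apply: exprn_ge0; lra.
have t4 : t ^+ 2 / 4 <= t ^+ 4 by rewrite (_ : t ^+ 4 = t ^+ 2 * t ^+ 2); [nra|ring].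
have t5 : (2 - n) * (1 - n) * (t ^+ 2 / 2) <= (2 - n) * (1 - n) * (t ^+ 3 / 6 + 2 * t ^+ 4).
  by apply: ler_wpM2l; lra.
have : 0 <= (1 - n) ^+ 2 * t ^+ 2 by apply: mulr_ge0; exact: sqr_ge0.
lra.
Qed.

Lemma taylor_lower_all p s : 3 / 2 <= p -> 0 <= s -> (taylor p (- (12^-1))).[s] <= s `^ p.
Proof.
move=> p1; rewrite le_eqVlt => /predU1P[<-|s0].
  rewrite powR0 ?horner_taylor; last by apply/eqP; lra.
  have : 0 <= (p - 1) * (12 - p * (9 - 2 * p)).
    by apply: mulr_ge0; [lra|have := sqr_ge0 (p - 9 / 4); lra].
  lra.
apply: taylor_lower => //; first lra.
move=> u u0; have w0 := sqr_ge0 (u - 1).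
have -> : 12 * - 12^-1 = -1 :> R by lra.
have [p3|p3] := leP 3 p.
  apply: le_trans (@powR_ge_tangent R u (p - 2) (ltW u0) _); lra.
have [p2|p2] := leP 2 p.
  (* The quadratic lies below [u] exactly on the left part, where [u <= u^(p - 2)]; on the right
     part it lies below the tangent of [u^(p - 1)] divided by [u]. *)
  have [up|up] := leP (u - 1) (p - 3); last first.
    have -> : p - 2 = (p - 1) - 1 by ring.
    have h : 1 + (p - 1) * (u - 1) <= u `^ (p - 1).
      by apply: powR_ge_tangent; [exact: ltW|lra].
    rewrite powRD ?(lt0r_neq0 u0) ?implybT// powR_inv1 ?(ltW u0)// ler_pdivlMr//.
    apply: le_trans h; nra.
  have : u <= u `^ (p - 2) by rewrite -[leLHS]powRr1 ?(ltW u0)// ger_powR//; [apply/andP; split; lra|lra].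
  nra.
have h : u `^ (2 - p) <= 1 + (2 - p) * (u - 1).
  by apply: powR_le_tangent; [exact: ltW|apply/andP; split; lra].
have -> : p - 2 = - (2 - p) by ring.
rewrite powRN; have v0 : 0 < u `^ (2 - p) by exact: powR_gt0.
rewrite -[leRHS]mul1r ler_pdivlMr//.
have [c|c] := leP (1 + - (2 - p) * (u - 1) + -1 * (u - 1) ^+ 2) 0.
  by apply: le_trans (_ : _ <= 0) _ => //; rewrite pmulr_lle0.
apply: le_trans (ler_wpM2l (ltW c) h) _.
have q0 : 0 <= 1 + (2 - p) ^+ 2 + (2 - p) * (u - 1) by nra.
have := mulr_ge0 w0 q0; lra.
Qed.

End PowerTaylor.

(** * The base case *)

Section ScalarInequalities.
Variable R : realType.
Implicit Types (b d e m n u v E V T N Q : R).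

(* The left-hand side is a quadratic polynomial in [d] in Bernstein form. *)
Lemma bernstein2 (c0 c1 c2 : R) d : 0 <= d <= 1 -> 0 <= c0 -> 0 <= c2 ->
  0 <= c0 + c1 -> 0 <= c1 + c2 ->
  0 <= c0 * (1 - d) ^+ 2 + 2 * c1 * d * (1 - d) + c2 * d ^+ 2.
Proof.
move=> /andP[d0 d1] h0 h2 h01 h12; have d1' : 0 <= 1 - d by rewrite subr_ge0.
have m0 := mulr_ge0 d0 d1'; have [c|c] := leP 0 c1.
  by rewrite !addr_ge0// ?mulr_ge0// sqr_ge0.
have a1 := mulr_ge0 h01 (sqr_ge0 (1 - d)); have a2 := mulr_ge0 h12 (sqr_ge0 d).
have a3 : 0 <= - c1 * (1 - 2 * d) ^+ 2 by apply: mulr_ge0; [lra|exact: sqr_ge0].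
lra.
Qed.

(* [core0], [core1] and [core2] are the inequalities to which [base23] and [base34] reduce
   at [m = 0], [1] and [2], after the substitution [e = d * u] and the replacement of
   [m ^+ 2] (or [(1 + m) ^+ 2]) by a tangent, which makes them affine in [m]. *)
Lemma core0 d u : 0 <= d <= 1 -> 0 <= u ->
  0 <= 3 - 2 * d - 3 * (2 - d) * u + (15 / 2 - 3 * d + 3 / 2 * d ^+ 2) * u ^+ 2 -
    3 * d * u ^+ 3 + 3 / 2 * d ^+ 2 * u ^+ 4.
Proof.
move=> /andP[d0 d1] u0.
have h1 : 0 <= (u - d * u ^+ 2) ^+ 2 by exact: sqr_ge0.
have h2 : 0 <= (2 - d) * (u - 1 / 2) ^+ 2 by apply: mulr_ge0; [lra|exact: sqr_ge0].
have h3 : 0 <= d ^+ 2 * u ^+ 2 by apply: mulr_ge0; exact: sqr_ge0.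
lra.
Qed.

Lemma core1 d u : 0 <= d <= 1 -> 0 <= u ->
  0 <= 3 - d - (2 - d) ^+ 2 / 16 - 3 * (2 - d) * u +
    (9 * (1 - d) - 3 - 3 * d + 3 / 2 * d ^+ 2) * u ^+ 2 +
    3 * d * u ^+ 3 + 15 / 2 * d ^+ 2 * u ^+ 4.
Proof.
move=> d01 u0; have := @bernstein2 (11 / 4 - 6 * u + 6 * u ^+ 2)
  (19 / 8 - 9 / 2 * u + 3 / 2 * u ^+ 3)
  (31 / 16 - 3 * u - 9 / 2 * u ^+ 2 + 3 * u ^+ 3 + 15 / 2 * u ^+ 4) d d01.
(* Squares for sum-of-squares certificates of the four polynomials in [u] required by [bernstein2],
   with zeros around their minimisers. *)
have s1 := sqr_ge0 (u - 1 / 2).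
have s2 := sqr_ge0 (u ^+ 2 + u / 5 - 45 / 100).
have s3 := sqr_ge0 (u ^+ 2 + 3 / 10 * u - 6 / 10).
have s4 : 0 <= u * (u - 7 / 10) ^+ 2 by apply: mulr_ge0 => //; exact: sqr_ge0.
have s5 := sqr_ge0 (u - 42 / 100); have s6 := sqr_ge0 (u - 63 / 100).
have s7 := sqr_ge0 (u - 7 / 10).
have k0 : 0 <= 11 / 4 - 6 * u + 6 * u ^+ 2 by clear -u0 s1; lra.
have k2 : 0 <= 31 / 16 - 3 * u - 9 / 2 * u ^+ 2 + 3 * u ^+ 3 + 15 / 2 * u ^+ 4.
  by clear -u0 s1 s2 s5; lra.
move=> /(_ k0 k2 ltac:(clear -u0 s1 s4 s7; lra) ltac:(clear -u0 s3 s5 s6; lra)); clear; lra.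
Qed.

Lemma core2 d u : 0 <= d <= 1 -> 0 <= u ->
  0 <= 1 - (2 - d) ^+ 2 / 16 - 3 * (2 - d) * u +
    (26 * (1 - d) - 9 / 2 - 3 * d + 3 / 2 * d ^+ 2) * u ^+ 2 +
    17 * d * u ^+ 3 + 35 / 2 * d ^+ 2 * u ^+ 4.
Proof.
move=> d01 u0; have := @bernstein2 (3 / 4 - 6 * u + 43 / 2 * u ^+ 2)
  (7 / 8 - 9 / 2 * u + 7 * u ^+ 2 + 17 / 2 * u ^+ 3)
  (15 / 16 - 3 * u - 6 * u ^+ 2 + 17 * u ^+ 3 + 35 / 2 * u ^+ 4) d d01.
have s1 := sqr_ge0 (u - 14 / 100).
have s2 := sqr_ge0 (u ^+ 2 - 9 / 100); have s3 := sqr_ge0 (u ^+ 2 - 1 / 10).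
have s4 : 0 <= u * (u - 3 / 10) ^+ 2 by apply: mulr_ge0 => //; exact: sqr_ge0.
have s5 := sqr_ge0 (u - 31 / 100); have s6 := sqr_ge0 (u - 25 / 100).
have s7 := sqr_ge0 (u - 184 / 1000).
have s8 : 0 <= u ^+ 3 by apply: exprn_ge0.
have k0 : 0 <= 3 / 4 - 6 * u + 43 / 2 * u ^+ 2 by clear -u0 s1; lra.
have k2 : 0 <= 15 / 16 - 3 * u - 6 * u ^+ 2 + 17 * u ^+ 3 + 35 / 2 * u ^+ 4.
  by clear -u0 s1 s2 s4 s5 s6; lra.
move=> /(_ k0 k2 ltac:(clear -u0 s1 s5 s6 s7 s8; lra) ltac:(clear -u0 s3 s4 s5 s6; lra)); clear; lra.
Qed.

(** With [m = p - 2] and [d = 1 - s0], the conclusion says that the trace of [taylor p 0] at [y] is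
    at most 1, after division by [p]. *)
Lemma base23 m d b e V T : 0 <= m <= 1 -> 0 <= d <= 1 -> 0 <= b -> 0 <= e ->
  V <= b ^+ 2 + e ^+ 2 -> T <= 3 * b ^+ 2 * e + 3 * b * e ^+ 2 + 6 * e ^+ 3 ->
  (1 - d) ^+ 2 + (1 + m) * b ^+ 2 + 4 / 3 * (1 + m) ^+ 2 * e ^+ 2 <= 1 ->
  (1 + m) * ((V + d ^+ 2) / 2 + m / 6 * (T - 3 * d * V - d ^+ 3)) <= d.
Proof.
move=> /andP[m0 m1] d01 b0 e0 hV hT hR; have [d0 d1] := andP d01.
have md : 0 <= 1 - m * d by have := mulr_ge0 (_ : 0 <= 1 - m) d0; nra.
set P := 1 + m; have P0 : 0 <= P by rewrite /P; lra.
set v := b ^+ 2; set E := e ^+ 2.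
have v0 : 0 <= v by exact: sqr_ge0.
have E0 : 0 <= E by exact: sqr_ge0.
(* The upper bound for [P * b ^+ 2] in the constraint; [b] is eliminated through it. *)
pose Y := 2 * d - d ^+ 2 - 4 / 3 * P ^+ 2 * E.
have hY : P * v <= Y by rewrite /Y /v /E /P; lra.
have e3 : e ^+ 3 = E * e by rewrite /E; ring.
(* The odd power of [b] in [T] is made affine in [v], so that [hY] can be used everywhere. *)
have hb : b <= (1 + v) / 2 by have := sqr_ge0 (1 - b); rewrite /v; lra.
have hbE : b * E <= (1 + v) / 2 * E by exact: ler_wpM2r.
have s1 : P * (V * (1 - m * d)) <= P * ((v + E) * (1 - m * d)).
  by apply: ler_wpM2l => //; apply: ler_wpM2r.
have s2 : P * (m * T) <= P * (m * (3 * v * e + 3 / 2 * (1 + v) * E + 6 * (E * e))).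
  apply: ler_wpM2l => //; apply: ler_wpM2l => //; apply: le_trans hT _.
  by rewrite e3 -/v -/E; lra.
have s3 : P * v * (1 - m * d) <= Y * (1 - m * d) by exact: ler_wpM2r.
have s4 : P * v * (m * e) <= Y * (m * e) by apply: ler_wpM2r => //; exact: mulr_ge0.
have s5 : P * v * (m * E) <= Y * (m * E) by apply: ler_wpM2r => //; exact: mulr_ge0.
have key : 0 <= m * (3 * d ^+ 2 - (2 - m) * d ^+ 3 - 3 * (2 * d - d ^+ 2) * e +
    (4 * P ^+ 2 - 6 * P) * (E * e) - 3 / 2 * E * (P + 2 * d - d ^+ 2) + 2 * P ^+ 2 * E ^+ 2) +
    P * (4 * P - 3) * (1 - m * d) * E.
  have k1 : 9 * m * ((1 - m * d) * E) <= P * (4 * P - 3) * ((1 - m * d) * E).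
    apply: ler_wpM2r; first exact: mulr_ge0.
    by have := sqr_ge0 (1 - 2 * m); rewrite /P; lra.
  have k2 : 0 <= (1 + m) ^+ 2 * (2 * (E * e) * 2 + 2 * E ^+ 2) - (3 * P - 9 / 4) * (4 * (E * e) + 2 * E ^+ 2).
    rewrite /P (_ : _ - _ = (m - 1 / 2) ^+ 2 * (4 * (E * e) + 2 * E ^+ 2)); last by field.
    by apply: mulr_ge0; [exact: sqr_ge0|rewrite addr_ge0// ?mulr_ge0// sqr_ge0].
  suff k3 : 0 <= 3 * d ^+ 2 - (2 - m) * d ^+ 3 - 3 * (2 * d - d ^+ 2) * e +
    (4 * (3 * P - 9 / 4) - 6 * P) * (E * e) - 3 / 2 * E * (P + 2 * d - d ^+ 2) +
    2 * (3 * P - 9 / 4) * E ^+ 2 + 9 * (1 - m * d) * E.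
    have k4 := mulr_ge0 m0 k3; have k5 := mulr_ge0 m0 k2.
    move: k1 k4 k5; rewrite /P; clear; lra.
  have [dz|dn] := eqVneq d 0.
    have E00 : E = 0.
      have : 4 / 3 * P ^+ 2 * E <= 0.
        have : 0 <= P * v by exact: mulr_ge0.
        by move: hY; rewrite /Y dz; clear; lra.
      have : 4 / 3 * 1 * E <= 4 / 3 * P ^+ 2 * E.
        by apply: ler_wpM2r => //; rewrite /P; clear -m0; nra.
      by clear -E0; lra.
    by rewrite E00 dz; clear; lra.
  (* After [e = d * u] every term of [k3] is divisible by [d ^+ 2]. *)
  pose u := e / d; have dp : 0 < d by rewrite lt_neqAle eq_sym dn.
  have u0 : 0 <= u by exact: divr_ge0.
  have eu : e = d * u by rewrite /u mulrC divfK.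
  have c0 := mulr_ge0 (_ : 0 <= 1 - m) (core0 d01 u0); have c1 := mulr_ge0 m0 (core1 d01 u0).
  (* [core1] also serves [base34], which needs its term [- (2 - d) ^+ 2 / 16]; here that term is
     added back. *)
  have c2 : 0 <= m * ((2 - d) ^+ 2 / 16) by apply: mulr_ge0 => //; rewrite divr_ge0// sqr_ge0.
  have {}c0 := c0 ltac:(clear -m1; lra).
  have := mulr_ge0 (sqr_ge0 d) (addr_ge0 c0 (addr_ge0 c1 c2)).
  by rewrite /P /E eu; clear; lra.
move: s1 s2 s3 s4 s5 key; rewrite /Y /P; clear; lra.
Qed.

(** Through the uncentred fourth moment [N ^+ 2], the second and third moments keep only the factor
    [2 - m]. So does the excess of the bound for [N] over 1, and the whole inequality reduces to
    [2 - m] times [key]. *)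
Lemma base34 m d b e V T N : 1 <= m <= 2 -> 0 <= d <= 1 -> 0 <= b -> 0 <= e ->
  V <= b ^+ 2 + e ^+ 2 -> T <= 3 * b ^+ 2 * e + 3 * b * e ^+ 2 + 6 * e ^+ 3 -> 0 <= N ->
  N <= (1 - d) ^+ 2 + 3 * b ^+ 2 + 6 * e ^+ 2 ->
  (1 - d) ^+ 2 + (1 + m) * b ^+ 2 + 4 / 3 * (1 + m) ^+ 2 * e ^+ 2 <= 1 ->
  (1 + m) * ((V + d ^+ 2) / 2 + m / 6 * (T - 3 * d * V - d ^+ 3) +
    (m - 1) / 12 * (N ^+ 2 - 1 + 4 * d - 6 * (V + d ^+ 2) - 4 * (T - 3 * d * V - d ^+ 3))) <= d.
Proof.
move=> /andP[m1 m2] d01 b0 e0 hV hT N0 hN hR; have [d0 d1] := andP d01.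
have d1' : 0 <= 1 - d by lra.
have m2' : 0 <= 2 - m by lra.
set P := 1 + m; have P0 : 0 < P by rewrite /P; lra.
set v := b ^+ 2; set E := e ^+ 2.
have v0 : 0 <= v by exact: sqr_ge0.
have E0 : 0 <= E by exact: sqr_ge0.
pose W := 2 * d - d ^+ 2; have W0 : 0 <= W by rewrite /W; nra.
pose Y := W - 4 / 3 * P ^+ 2 * E.
have hY : P * v <= Y by rewrite /Y /W /v /E /P; lra.
have e3 : e ^+ 3 = E * e by rewrite /E; ring.
(* Eliminating [v] from the bound for [N] leaves [1 + f * W], because [3 - P = 2 - m]. *)
pose f := (2 - m) / P; have f0 : 0 <= f by apply: divr_ge0; lra.
have Pf : P * f = 2 - m by rewrite /f mulrC divfK// gt_eqF.
have hN2 : N ^+ 2 <= (1 + f * W) ^+ 2.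
  have : N <= 1 + f * W.
    rewrite -(ler_pM2l P0); apply: le_trans (ler_wpM2l (ltW P0) hN) _.
    have : 0 <= (m - 1) * (P * E) by rewrite !mulr_ge0 ?(ltW P0)//; lra.
    have : 0 <= P * E by rewrite !mulr_ge0 ?(ltW P0).
    have -> : P * (1 + f * W) = P + (2 - m) * W by rewrite -Pf; ring.
    by move: hY; rewrite /Y -/v -/E /W /P; lra.
  move=> h; apply: lerXn2r => //; rewrite nnegrE//.
  by apply: addr_ge0 => //; exact: mulr_ge0.
have hb : b <= (1 + v) / 2 by have := sqr_ge0 (1 - b); rewrite /v; lra.
have hbE : b * E <= (1 + v) / 2 * E by exact: ler_wpM2r.
have s1 : P * (V * (1 - d)) <= P * ((v + E) * (1 - d)).
  by apply: ler_wpM2l; [exact: ltW|apply: ler_wpM2r].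
have s2 : P * T <= P * (3 * v * e + 3 / 2 * (1 + v) * E + 6 * (E * e)).
  apply: ler_wpM2l; [exact: ltW|apply: le_trans hT _].
  by rewrite e3 -/v -/E; lra.
have s3 : P * v * (1 - d) <= Y * (1 - d) by exact: ler_wpM2r.
have s4 : P * v * e <= Y * e by exact: ler_wpM2r.
have s5 : P * v * E <= Y * E by exact: ler_wpM2r.
have A : 6 * P * ((V + d ^+ 2) / 2 + (T - 3 * d * V - d ^+ 3) / 6) <=
  3 * (Y + P * E) * (1 - d) + 3 * P * d ^+ 2 - P * d ^+ 3 + 3 * Y * e + 3 / 2 * E * (P + Y) + 6 * P * (E * e).
  by move: s1 s2 s3 s4 s5; clear; lra.
have B : P * (m - 1) / 2 * (N ^+ 2 - 1) <= (2 - m) * ((m - 1) / 2 * (2 * W + f * W ^+ 2)).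
  apply: le_trans (_ : _ <= P * (m - 1) / 2 * ((1 + f * W) ^+ 2 - 1)) _.
    by apply: ler_wpM2l; [rewrite divr_ge0// mulr_ge0 ?(ltW P0)//; clear -m1; lra|rewrite lerD2r].
  by rewrite le_eqVlt; apply/orP; left; apply/eqP; rewrite -Pf; field.
have fm : (m - 1) * f <= (m - 1) * (2 - m) / 2.
  rewrite -mulrA; apply: ler_wpM2l; first by clear -m1; lra.
  by rewrite /f; apply: ler_wpM2l => //; rewrite lef_pV2 ?posrE//; rewrite /P; clear -m1; lra.
have W4 : W ^+ 2 = d ^+ 2 * (2 - d) ^+ 2 by rewrite /W; ring.
have fW : (m - 1) * f * W ^+ 2 <= (m - 1) * (2 - m) / 2 * W ^+ 2 by apply: ler_wpM2r => //; exact: sqr_ge0.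
have key : 0 <= (2 - m) * (3 * d ^+ 2 - d ^+ 3) + (m - 1) * d ^+ 2 -
    (m - 1) * (2 - m) / 4 * W ^+ 2 + P * (4 * P - 3) * (1 - d) * E - 3 * W * e +
    (4 * P ^+ 2 - 6 * P) * (E * e) - 3 / 2 * E * (P + W) + 2 * P ^+ 2 * E ^+ 2.
  (* Replaces [m ^+ 2] by its tangent at the midpoint [3 / 2]; in particular [(m - 1) * (2 - m)]
     becomes [1 / 4]. *)
  have k0 : 0 <= (m - 3 / 2) ^+ 2 * (4 * (1 - d) * E + 4 * (E * e) + 2 * E ^+ 2 + W ^+ 2 / 4).
    apply: mulr_ge0; first exact: sqr_ge0.
    have := mulr_ge0 d1' E0; have := mulr_ge0 E0 e0; have := sqr_ge0 E; have := sqr_ge0 W; clear; lra.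
  have [dz|dn] := eqVneq d 0.
    have E00 : E = 0.
      have : 4 / 3 * P ^+ 2 * E <= 0.
        have : 0 <= P * v by apply: mulr_ge0 => //; exact: ltW.
        by move: hY; rewrite /Y /W dz; clear; lra.
      have : 4 / 3 * 1 * E <= 4 / 3 * P ^+ 2 * E.
        by apply: ler_wpM2r => //; rewrite /P; clear -m1; nra.
      by clear -E0; lra.
    by rewrite E00 /W dz; clear; lra.
  pose u := e / d; have dp : 0 < d by rewrite lt_neqAle eq_sym dn.
  have u0 : 0 <= u by exact: divr_ge0.
  have eu : e = d * u by rewrite /u mulrC divfK.
  have c1 := mulr_ge0 m2' (core1 d01 u0).
  have c2 := mulr_ge0 (_ : 0 <= m - 1) (core2 d01 u0); have {}c2 := c2 ltac:(clear -m1; lra).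
  have := mulr_ge0 (sqr_ge0 d) (addr_ge0 c1 c2).
  by move: k0; rewrite W4 /W /P /E eu; clear; lra.
have key2 := mulr_ge0 m2' key.
have fW2 : (2 - m) * ((m - 1) * f * W ^+ 2) <= (2 - m) * ((m - 1) * (2 - m) / 2 * W ^+ 2).
  exact: ler_wpM2l.
have A2 := ler_wpM2l m2' A.
move: A2 B key2 fW2; rewrite /Y /W /P; clear; lra.
Qed.

End ScalarInequalities.

Section BaseCase.
Variable R : realType.
Implicit Types (p q r k d : R).

(** [b] is absent on the right because [b ^+ 2 <= 3 * d] makes [b ^+ 2 * e] and [b ^+ 4] quadratic
    in [d] and [e]. Term by term, [34 = 24 + 9 + 1] and [280 >= 162 + 96 + 18 + 1]. *)
Lemma tail_bounds (d b e V T Q : R) : 0 <= d <= 1 -> 0 <= b -> 0 <= e ->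
  b ^+ 2 <= 3 * d -> e ^+ 2 <= 2 * d ->
  0 <= V <= b ^+ 2 + e ^+ 2 -> `|T| <= 3 * b ^+ 2 * e + 3 * b * e ^+ 2 + 6 * e ^+ 3 ->
  Q <= (3 * b ^+ 2 + 6 * e ^+ 2) ^+ 2 ->
  - (T - 3 * d * V - d ^+ 3) <= 34 * (d ^+ 2 + e ^+ 2) /\
  Q - 4 * d * T + 6 * d ^+ 2 * V + d ^+ 4 <= 280 * (d ^+ 2 + e ^+ 2).
Proof.
move=> /andP[d0 d1] b0 e0 hv hornerS /andP[V0 hV] hT hQ.
have v0 := sqr_ge0 b; have E0 := sqr_ge0 e; have dd0 := sqr_ge0 d.
have e2 : e <= 2 by apply: le_of_sqr => //; lra.
have b2 : b <= 2 by apply: le_of_sqr => //; lra.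
have hT1 : `|T| <= 24 * (d ^+ 2 + e ^+ 2).
  apply: le_trans hT _; clear hQ.
  have bE : b * e ^+ 2 <= 2 * e ^+ 2 by exact: ler_wpM2r.
  have eE : e ^+ 3 <= 2 * e ^+ 2 by rewrite exprS; exact: ler_wpM2r.
  have h1 : b ^+ 2 * e <= 3 * d * e by exact: ler_wpM2r.
  by have h2 := sqr_ge0 (d - e); lra.
have hQ1 : Q <= 162 * (d ^+ 2 + e ^+ 2).
  apply: le_trans hQ _; clear hT hT1.
  have EE : e ^+ 2 * e ^+ 2 <= 2 * e ^+ 2 by apply: ler_wpM2r => //; lra.
  apply: le_trans (_ : _ <= (9 * d + 6 * e ^+ 2) ^+ 2) _.
    by apply: lerXn2r; rewrite ?nnegrE; lra.
  have := sqr_ge0 (9 * d - 6 * e ^+ 2); lra.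
have dV : d * V <= 3 * (d ^+ 2 + e ^+ 2).
  clear hT hQ hT1 hQ1.
  have h1 : d * V <= d * (b ^+ 2 + e ^+ 2) by exact: ler_wpM2l.
  have h2 : d * b ^+ 2 <= d * (3 * d) by exact: ler_wpM2l.
  have h3 : d * e ^+ 2 <= e ^+ 2 by exact: ler_piMl.
  lra.
have d3 : d ^+ 3 <= d ^+ 2 by rewrite exprS; apply: ler_piMl.
have d4 : d ^+ 4 <= d ^+ 2 by rewrite exprS; apply: le_trans d3; apply: ler_piMl => //; exact: exprn_ge0.
have dV0 : 0 <= d * V by exact: mulr_ge0.
have ddV : d ^+ 2 * V <= d * V by rewrite expr2 -mulrA; exact: ler_piMl.
have T1 : - `|T| <= T by rewrite lerNl -normrN; exact: ler_norm.
have dT : - (d * T) <= `|T|.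
  rewrite -mulrN; apply: le_trans (ler_norm _) _; rewrite normrM normrN ger0_norm//.
  exact: ler_piMl.
clear hT hQ hV; split; lra.
Qed.

(** Exponents just below 2, with [n = 2 - p]. The terms with a factor [n] are at most a small
    multiple of [d ^+ 2 + e ^+ 2], which is absorbed by the strict gains [d ^+ 2 / 100] and
    [7 / 6 > 1]; [b] has no gain and needs none. *)
Lemma base2 (n d b e V T Q : R) : 0 <= n -> n * 10 ^+ 6 <= 1 ->
  0 <= d <= 1 -> 0 <= b -> 0 <= e ->
  0 <= V <= b ^+ 2 + e ^+ 2 -> `|T| <= 3 * b ^+ 2 * e + 3 * b * e ^+ 2 + 6 * e ^+ 3 ->
  Q <= (3 * b ^+ 2 + 6 * e ^+ 2) ^+ 2 ->
  (1 - d) ^+ 2 + (1 - n) * b ^+ 2 + 7 / 6 * (1 - n) ^+ 2 * e ^+ 2 <= 1 - d ^+ 2 / 100 ->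
  (1 - n) * ((V + d ^+ 2) / 2 - n / 6 * (T - 3 * d * V - d ^+ 3) +
    2 * n * (Q - 4 * d * T + 6 * d ^+ 2 * V + d ^+ 4)) <= d.
Proof.
move=> n0 n1 d01 b0 e0 hV hT hQ hR; have [d0 d1] := andP d01; have [V0 V1] := andP hV.
have v0 := sqr_ge0 b; have E0 := sqr_ge0 e; have dd0 := sqr_ge0 d.
have n2 : n <= 1 / 100 by clear -n0 n1; lra.
have P2 : 98 / 100 <= (1 - n) ^+ 2 by clear -n0 n2; nra.
have PE : 98 / 100 * e ^+ 2 <= (1 - n) ^+ 2 * e ^+ 2 by exact: ler_wpM2r.
have Pv : 99 / 100 * b ^+ 2 <= (1 - n) * b ^+ 2 by apply: ler_wpM2r => //; clear -n2; lra.
have [hM3 hM4] : - (T - 3 * d * V - d ^+ 3) <= 34 * (d ^+ 2 + e ^+ 2) /\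
    Q - 4 * d * T + 6 * d ^+ 2 * V + d ^+ 4 <= 280 * (d ^+ 2 + e ^+ 2).
  by apply: (tail_bounds d01 b0 e0 _ _ hV hT hQ); clear hV hT hQ; lra.
have P0 : 0 <= 1 - n by clear -n2; lra.
have P1 : 1 - n <= 1 by clear -n0; lra.
have hPV : (1 - n) * V <= (1 - n) * (b ^+ 2 + e ^+ 2) by exact: ler_wpM2l.
clear hV hT hQ V1.
have a1 := ler_wpM2l n0 hM3; have a2 := ler_wpM2l n0 hM4.
move: (T - 3 * d * V - d ^+ 3) (Q - 4 * d * T + 6 * d ^+ 2 * V + d ^+ 4) a1 a2 => M3 M4 a1 a2.
clear hM3 hM4.
have G0 : 0 <= d ^+ 2 + e ^+ 2 by exact: addr_ge0.
have nG : n * (d ^+ 2 + e ^+ 2) * 10 ^+ 6 <= d ^+ 2 + e ^+ 2.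
  by rewrite mulrAC; exact: ler_piMl.
have nG0 : 0 <= n * (d ^+ 2 + e ^+ 2) by exact: mulr_ge0.
have hZ : - n / 6 * M3 + 2 * n * M4 <= d ^+ 2 / 200 + e ^+ 2 / 200.
  by clear -a1 a2 nG nG0; lra.
have hPZ : (1 - n) * (- n / 6 * M3 + 2 * n * M4) <= d ^+ 2 / 200 + e ^+ 2 / 200.
  by apply: le_trans (ler_wpM2l P0 hZ) _; apply: ler_piMl; [clear -dd0 E0; lra|exact: P1].
have nd : 0 <= n * d ^+ 2 by exact: mulr_ge0.
have nE : 0 <= n * e ^+ 2 by exact: mulr_ge0.
have -> : (1 - n) * ((V + d ^+ 2) / 2 - n / 6 * M3 + 2 * n * M4) =
  (1 - n) * V / 2 + (1 - n) * d ^+ 2 / 2 + (1 - n) * (- n / 6 * M3 + 2 * n * M4) by field.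
clear -hPZ hPV hR PE Pv nd nE v0 E0 dd0; lra.
Qed.

(** [X] is the critical [1 / (q - 1)], for which [(1 - X) / (2 * X) = p - 1]. Of the two formulas
    for [M4], [base2] uses the one with [Q] and [base34] the one with [N]. *)
Lemma base_scalar (p X d b e V T Q N M4 : R) :
  (2 - p) * 10 ^+ 6 <= 1 -> p <= 4 -> X * (2 * p - 1) = 1 ->
  0 <= d <= 1 -> 0 <= b -> 0 <= e -> 0 <= N ->
  0 <= V <= b ^+ 2 + e ^+ 2 -> `|T| <= 3 * b ^+ 2 * e + 3 * b * e ^+ 2 + 6 * e ^+ 3 ->
  N <= (1 - d) ^+ 2 + 3 * b ^+ 2 + 6 * e ^+ 2 -> Q <= (3 * b ^+ 2 + 6 * e ^+ 2) ^+ 2 ->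
  (forall mu, 0 <= mu <= 1 ->
    (1 - d) ^+ 2 + (1 - X) / (2 * X) * b ^+ 2 + mu * ((1 - X) ^+ 2 / (3 * X ^+ 2)) * e ^+ 2 <=
    1 - (1 - mu) * (1 - X) ^+ 2 / 4 * d ^+ 2) ->
  M4 = Q - 4 * d * T + 6 * d ^+ 2 * V + d ^+ 4 ->
  M4 = N ^+ 2 - 1 + 4 * d - 6 * (V + d ^+ 2) - 4 * (T - 3 * d * V - d ^+ 3) ->
  exists2 k, (forall s, 0 <= s -> s `^ p <= (taylor p k).[s]) &
    1 - p * d + p * (p - 1) * ((V + d ^+ 2) / 2 +
      (p - 2) / 6 * (T - 3 * d * V - d ^+ 3) + k * M4) <= 1.
Proof.
move=> p1 p4 XE d01 b0 e0 N0 V1 T1 N1 Q1 H M4Q M4N.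
have [V0 V2] := andP V1.
have P0 : 0 < 2 * p - 1 by clear -p1; lra.
have p0 : 0 <= p by clear -P0; lra.
have D0 : 2 * p - 1 != 0 by rewrite gt_eqF.
have X1 : X <= 35 / 100 by clear -p1 XE; nra.
have {}XE : X = (2 * p - 1)^-1 by apply: (mulIf D0); rewrite XE mulVf.
have PE : (1 - X) / (2 * X) = p - 1 by rewrite XE; field.
have P2E : (1 - X) ^+ 2 / (3 * X ^+ 2) = 4 / 3 * (p - 1) ^+ 2 by rewrite XE; field.
rewrite PE P2E in H.
have H1 : (1 - d) ^+ 2 + (1 + (p - 2)) * b ^+ 2 + 4 / 3 * (1 + (p - 2)) ^+ 2 * e ^+ 2 <= 1.
  have := H 1 ltac:(by rewrite ler01 lexx); clear; lra.
have fin B C : B <= d -> (p - 1) * C = B -> 1 - p * d + p * (p - 1) * C <= 1.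
  by move=> h CB; have := ler_wpM2l p0 h; rewrite -CB mulrA; clear; lra.
have T2 : T <= 3 * b ^+ 2 * e + 3 * b * e ^+ 2 + 6 * e ^+ 3 by exact: le_trans (ler_norm _) T1.
have [p2|p2] := leP 2 p; last first.
  exists (2 * (2 - p)).
    by move=> s s_0; apply: taylor_upper2 => //; clear -p1 p2; apply/andP; split; lra.
  have n0 : 0 <= 2 - p by clear -p2; lra.
  have H2 : (1 - d) ^+ 2 + (1 - (2 - p)) * b ^+ 2 + 7 / 6 * (1 - (2 - p)) ^+ 2 * e ^+ 2 <= 1 - d ^+ 2 / 100.
    (* [7 / 8] turns [4 / 3] into [7 / 6], still above 1, and with [X <= 35 / 100] leaves more than
       [1 / 100] for [d ^+ 2]. *)
    have mu01 : 0 <= (7 / 8 : R) <= 1 by clear; apply/andP; split; lra.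
    have {}H := H _ mu01.
    have h : 1 / 100 * d ^+ 2 <= (1 - 7 / 8) * (1 - X) ^+ 2 / 4 * d ^+ 2.
      by apply: ler_wpM2r; [exact: sqr_ge0|clear -X1; nra].
    by clear -H h; lra.
  have h := base2 n0 p1 d01 b0 e0 V1 T1 Q1 H2.
  by apply: (fin _ _ h); rewrite M4Q; clear; field.
have [p3|p3] := leP p 3.
  exists 0; first by move=> s s_0; apply: taylor_upper23 => //; rewrite p2.
  have m01 : 0 <= p - 2 <= 1 by clear -p2 p3; apply/andP; split; lra.
  have h := base23 m01 d01 b0 e0 V2 T2 H1.
  by apply: (fin _ _ h); clear; field.
exists ((p - 3) / 12); first by move=> s s_0; apply: taylor_upper34 => //; rewrite (ltW p3).
have m01 : 1 <= p - 2 <= 2 by clear -p3 p4; apply/andP; split; lra.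
have h := base34 m01 d01 b0 e0 V2 T2 N0 N1 H1.
by apply: (fin _ _ h); rewrite M4N; clear; field.
Qed.

Variable I : choiceType.
Local Notation A := (grpalg R (freegroup I)).
Implicit Types (x z u : A).

Lemma momB u (P Q : {poly R}) : mom u (P - Q) = mom u P - mom u Q.
Proof. by rewrite momD -[- Q]scaleN1r momZ mulN1r. Qed.

Lemma momMn u (P : {poly R}) n : mom u (P *+ n) = mom u P *+ n.
Proof. by rewrite -scaler_nat momZ mulr_natl. Qed.

Lemma momCl u (c : R) (P : {poly R}) : mom u (c%:P * P) = c * mom u P.
Proof. by rewrite mul_polyC momZ. Qed.

(** Moments are known around [s0], while the polynomial is expanded around 1; [X - 1] is
    [(X - s0) - d]. *)
Lemma mom_taylor z p k V T Q N :
  let y := conv (star z) z in let s0 := nn y 0 in let d := 1 - s0 in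
  mom y (('X - s0%:P) ^+ 2) = V -> mom y (('X - s0%:P) ^+ 3) = T ->
  mom y (('X - s0%:P) ^+ 4) = Q -> mom y ('X ^+ 4) = N ^+ 2 ->
  mom y (taylor p k) = 1 - p * d + p * (p - 1) * ((V + d ^+ 2) / 2 +
     (p - 2) / 6 * (T - 3 * d * V - d ^+ 3) +
     k * (Q - 4 * d * T + 6 * d ^+ 2 * V + d ^+ 4)) /\
  Q - 4 * d * T + 6 * d ^+ 2 * V + d ^+ 4 =
   N ^+ 2 - 1 + 4 * d - 6 * (V + d ^+ 2) - 4 * (T - 3 * d * V - d ^+ 3).
Proof.
move=> y s0 d hV hT hQ hN; set g := 'X - s0%:P; have h1 : mom y g = 0 by exact: mom_shift1.
set D := d%:P; have XE : 'X - 1 = g - D :> {poly R}.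
  by rewrite /g /D /d rmorphB /=; ring.
have m1 : mom y ('X - 1) = - d.
  by rewrite XE momB h1 -[D]mulr1 momCl mom1; ring.
have m2 : mom y (('X - 1) ^+ 2) = V + d ^+ 2.
  rewrite XE (_ : _ ^+ 2 = g ^+ 2 - (D * g) *+ 2 + D * (D * 1)); last by ring.
  by rewrite momD momB momMn !momCl h1 mom1 hV; ring.
have m3 : mom y (('X - 1) ^+ 3) = T - 3 * d * V - d ^+ 3.
  rewrite XE (_ : _ ^+ 3 = g ^+ 3 - (D * g ^+ 2) *+ 3 + (D * (D * g)) *+ 3 - D * (D * (D * 1))); last by ring.
  by rewrite momB momD momB !momMn !momCl h1 mom1 hV hT; ring.
have m4 : mom y (('X - 1) ^+ 4) = Q - 4 * d * T + 6 * d ^+ 2 * V + d ^+ 4.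
  rewrite XE (_ : _ ^+ 4 = g ^+ 4 - (D * g ^+ 3) *+ 4 + (D * (D * g ^+ 2)) *+ 6 -
    (D * (D * (D * g))) *+ 4 + D * (D * (D * (D * 1)))); last by ring.
  by rewrite momD momB momD momB !momMn !momCl h1 mom1 hV hT hQ; ring.
split; first by rewrite /taylor !momD !momZ mom1 m1 m2 m3 m4; field.
rewrite -m4 (_ : ('X - 1) ^+ 4 = 'X ^+ 4 - 1 - ('X - 1) *+ 4 - (('X - 1) ^+ 2) *+ 6 -
   (('X - 1) ^+ 3) *+ 4); last by ring.
by rewrite !momB !momMn hN mom1 m1 m2 m3; ring.
Qed.

Lemma Lpnorm_le1 z p k : 1 <= p -> (forall s, 0 <= s -> s `^ p <= (taylor p k).[s]) ->
  mom (conv (star z) z) (taylor p k) <= 1 -> Lpnorm (2 * p) (lsum z) <= 1.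
Proof.
move=> p1 tay m1.
have q1 : 1 <= 2 * p by lra.
have pE : 2 * p / 2 = p by rewrite mulrAC divff ?mul1r// pnatr_eq0.
have H := @Lpnorm_le_poly R _ (lsum z) (2 * p) (taylor p k) (lsum_adjoint z) q1.
have [_ [b [_ [L0 _]]]] := Lpnorm_calc (lsum_adjoint z) q1.
rewrite leNgt; apply/negP => L1.
have : 1 < Lpnorm (2 * p) (lsum z) `^ (2 * p).
  have o : 1 `^ (2 * p) = 1 :> R by rewrite powR1.
  by rewrite -[ltLHS]o; apply: gt0_ltr_powR; rewrite ?nnegrE//; lra.
rewrite ltNge => /negP; apply; apply: le_trans (H _) _; first by rewrite pE.
by rewrite mom_bcomp.
Qed.

(** Only the critical time; later times follow by the semigroup law in [contr_ge]. *)
Definition hypercontr q := forall x r, 0 < r -> r ^+ 2 * (q - 1) = 1 -> nrm x <= 1 ->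
  Lpnorm q (lsum (radial r x)) <= 1.

Lemma base_case q : (4 - q) * 10 ^+ 6 <= 1 -> q <= 8 -> hypercontr q.
Proof.
move=> q0 q8 x r r0 rq x1; set z := radial r x; set y := conv (star z) z.
have [p pE] : exists p, p = q / 2 by exists (q / 2).
have qE : q = 2 * p by rewrite pE mulrC divfK// pnatr_eq0.
rewrite {}qE {pE} in q0 q8 rq *.
have X0 : 0 < r ^+ 2 by exact: exprn_gt0.
have X35 : r ^+ 2 <= 35 / 100 by clear -q0 rq; nra.
have p1 : 1 <= p by clear -q0; lra.
have p4 : p <= 4 by clear -q8; lra.
have pe : (2 - p) * 10 ^+ 6 <= 1 by clear -q0; lra.
have [b [e [V [T [N [Q [[hV hT hQ hN] [b0 e0 N0 s01] [V1 T1 N1 Q1] H]]]]]]] :=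
  moment_bounds r0 X35 x1.
rewrite -/z -/y in hV hT hQ s01 N1 H.
have [d dE] : exists d, d = 1 - nn y 0 by exists (1 - nn y 0).
have s0E : nn y 0 = 1 - d by rewrite dE opprB addrCA subrr addr0.
have M4 k := mom_taylor p k hV hT hQ hN.
rewrite -/y -dE in M4; rewrite -dE s0E in H; rewrite s0E in s01 N1.
have d01 : 0 <= d <= 1 by clear -s01; move: s01 => /andP[u1 u2]; apply/andP; split; lra.
have [k kP kle] := base_scalar pe p4 rq d01 b0 e0 N0 V1 T1 N1 Q1 H erefl (M4 0).2.
by apply: (Lpnorm_le1 p1 kP); rewrite -/y (M4 k).1.
Qed.

End BaseCase.

(** * From p to 2p *)

Section Doubling.
Variables (R : realType) (I : choiceType).
Local Notation A := (grpalg R (freegroup I)).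
Local Notation dl := (delta R (1%g : freegroup I)).
Implicit Types (p q r : R) (x z u : A).

Lemma powR_le1 (L q : R) : 0 <= L -> 0 < q -> L `^ q <= 1 -> L <= 1.
Proof.
move=> L0 q0; rewrite leNgt => Lq; rewrite leNgt; apply: contra Lq => L1.
have o : 1 `^ q = 1 :> R by rewrite powR1.
by rewrite -[ltLHS]o; apply: gt0_ltr_powR; rewrite ?nnegrE.
Qed.

Lemma powR_le1_pow (L q : R) : 0 <= L -> 0 <= q -> L <= 1 -> L `^ q <= 1.
Proof.
move=> L0 q0 L1; have o : 1 `^ q = 1 :> R by rewrite powR1.
by rewrite -[leRHS]o; apply: ge0_ler_powR; rewrite ?nnegrE.
Qed.

Lemma lsum_star_square z f : let y := conv (star z) z in
  lsum (star y) f = lsum y f.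
Proof.
move=> y; apply: ip_ext => k; rewrite -ip_lsum; exact: square_sym.
Qed.

Lemma mom_square z (P : {poly R}) : let y := conv (star z) z in
  mom (conv (star y) y) P = mom y (P \Po 'X ^+ 2).
Proof.
move=> y; rewrite /mom (polyop_comp _ _ (lsum y)); apply: (congr1 (fun v => ip v dl)); apply: eq_polyop => f.
by rewrite lsum_conv lsum_star_square expr2 (polyopM _ _ (lsum y)) !polyopX.
Qed.

Lemma common_bound (a b : R) : 0 <= a -> 0 <= b ->
  exists M : R, [/\ 0 <= M, a <= M & b <= M ^+ 2].
Proof. by move=> a0 b0; exists (a + b + 1); split; nra. Qed.

(** One polynomial [P] close to [s^(p / 2)] on [[0, M^2]] approximates both sides by the same moment
    of [y]. A common [M] avoids comparing the norms of the two operators. *)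
Lemma Lpnorm_square z p : 2 <= p ->
  Lpnorm (2 * p) (lsum z) `^ (2 * p) = Lpnorm p (lsum (conv (star z) z)) `^ p.
Proof.
move=> p2; set y := conv (star z) z.
set a1 := bcomp (adjoint (lsum z)) (lsum z); set a2 := bcomp (adjoint (lsum y)) (lsum y).
have q1 : 1 <= 2 * p by lra.
have p1 : 1 <= p by lra.
have ph : p / 2 = 2^-1 \/ 1 <= p / 2 by right; lra.
have [[_ _ o1 _] _] := Lpnorm_calc (lsum_adjoint z) q1.
have [[_ _ o2 _] _] := Lpnorm_calc (lsum_adjoint y) p1.
have [M [M0 h1 h2]] := common_bound o1 o2.
have close e : 0 < e -> `|Lpnorm (2 * p) (lsum z) `^ (2 * p) - Lpnorm p (lsum y) `^ p| <= e + e.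
  move=> e0; have [P HP] := powR_approx ph (exprn_ge0 2 M0) e0.
  have HP2 s : 0 <= s <= M -> `|(P \Po 'X ^+ 2).[s] - s `^ (2 * p / 2)| <= e.
    move=> /andP[s0 sM]; rewrite horner_comp hornerXn.
    have -> : s `^ (2 * p / 2) = (s ^+ 2) `^ (p / 2).
      by rewrite -powR_mulrn// -powRrM mulrA.
    apply: HP; rewrite sqr_ge0 /=; apply: lerXn2r; rewrite ?nnegrE//.
  have A1 := Lpnorm_approx (lsum_adjoint z) q1 (ltW e0) h1 HP2.
  have A2 := Lpnorm_approx (lsum_adjoint y) p1 (ltW e0) h2 HP.
  rewrite mom_bcomp -/y in A1; rewrite mom_bcomp mom_square -/y in A2.
  set c := mom _ _ in A1 A2; rewrite distrC in A2; exact: (le_trans (ler_distD c _ _) (lerD A1 A2)).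
apply/eqP; rewrite -subr_eq0 -normr_eq0 eq_le normr_ge0 andbT.
apply/ler_addgt0Pl => e e0; rewrite addr0.
by rewrite [e]splitr; apply: close; exact: divr_gt0.
Qed.

Lemma mult_mult r1 r2 x : radial r1 (radial r2 x) = radial (r1 * r2) x.
Proof.
apply/fsfunP => g; rewrite !multE mulrA exprMn rmorphM //.
Qed.

Lemma mult1 x : radial 1 x = x.
Proof. by apply/fsfunP => g; rewrite multE expr1n mul1r. Qed.

Lemma contr_double p : 2 <= p -> hypercontr I p -> hypercontr I (2 * p).
Proof.
move=> p2 Cp x r r0 rp x1; set z := radial r x; set y := conv (star z) z.
have q1 : 1 <= 2 * p by lra.
have p1 : 1 <= p by lra.
have p0 : 0 <= p by lra.
have pp0 : 0 < 2 * p by lra.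
have P0 : 0 < p - 1 by lra.
have [_ [_ [_ [L0 _]]]] := Lpnorm_calc (lsum_adjoint z) q1.
apply: (powR_le1 L0 pp0); rewrite (Lpnorm_square z p2) -/y; clear L0.
have X0 : 0 < r ^+ 2 by exact: exprn_gt0.
have X1 : r ^+ 2 < 1 by nra.
have PE : (1 - r ^+ 2) / (2 * r ^+ 2) = p - 1.
  apply: (mulIf (_ : 2 * r ^+ 2 != 0)); first by rewrite mulf_neq0// gt_eqF.
  by rewrite divfK; [lra|rewrite mulf_neq0// gt_eqF].
have := square_contraction r0 X1 x1; rewrite PE -/z -/y => z1.
have S0 : 0 < Num.sqrt (p - 1) by rewrite sqrtr_gt0.
have S1 : (Num.sqrt (p - 1))^-1 ^+ 2 * (p - 1) = 1.
  by rewrite exprVn sqr_sqrtr ?mulVf ?gt_eqF// ltW.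
have S2 : 0 < (Num.sqrt (p - 1))^-1 by rewrite invr_gt0.
have := Cp _ _ S2 S1 z1; rewrite mult_mult mulVf ?gt_eqF// mult1 => L1.
have [_ [_ [_ [Ly0 _]]]] := Lpnorm_calc (lsum_adjoint y) p1.
exact: (powR_le1_pow Ly0 p0 L1).
Qed.

(** Halving [q > 8] stays above 4, so [contr_double] applies at each step until the range of
    [base_case] is reached. *)
Lemma contr_all q : (4 - q) * 10 ^+ 6 <= 1 -> hypercontr I q.
Proof.
move=> q4; have [k qk] : exists k, q <= 8 * 2 ^+ k.
  have [k kq] := exists_natr_gt `|q|; exists k.
  apply: le_trans (ler_norm q) _; apply: le_trans (ltW kq) _.
  apply: le_trans (_ : _ <= 2 ^+ k) _; last by rewrite ler_peMl// ?exprn_ge0// ler1n.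
  by rewrite -natrX ler_nat; apply: ltnW; exact: ltn_expl.
elim: k q q4 qk => [|k IH] q q4 qk; first by apply: base_case => //; move: qk; rewrite expr0; lra.
have [q8|q8] := leP q 8; first exact: base_case.
have -> : q = 2 * (q / 2) by lra.
apply: contr_double; first lra.
by apply: IH; [lra|move: qk; rewrite exprS; lra].
Qed.

Lemma mom_X z : mom (conv (star z) z) 'X = nrm z ^+ 2.
Proof.
by rewrite /mom polyopX lsum_conv ipC -ip_lsum -ipff.
Qed.

Lemma Lpnorm2 x : Lpnorm 2 (lsum x) = nrm x.
Proof.
have q1 : 1 <= (2 : R) by rewrite ler1n.
have [_ [_ [_ [L0 _]]]] := Lpnorm_calc (lsum_adjoint x) q1.
have E (s : R) : 0 <= s -> s `^ (2 / 2) = 'X.[s] :> R by move=> s0; rewrite divff// powRr1// hornerX.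
have h1 := @Lpnorm_le_poly R _ (lsum x) 2 'X (lsum_adjoint x) q1.
have h2 := @Lpnorm_ge_poly R _ (lsum x) 2 'X (lsum_adjoint x) q1.
have E1 (s : R) : 0 <= s -> s `^ (2 / 2) <= 'X.[s] by move=> s0; rewrite (E s s0).
have E2 (s : R) : 0 <= s -> 'X.[s] <= s `^ (2 / 2) by move=> s0; rewrite (E s s0).
have {}h1 := h1 E1; have {}h2 := h2 E2.
move: h1 h2; rewrite mom_bcomp mom_X powR_mulrn// => h1 h2.
by apply/eqP; rewrite -(@eqrXn2 _ 2)// ?nrm_ge0// eq_le h1 h2.
Qed.

Lemma nrm_mult_le r x : 0 <= r <= 1 -> nrm (radial r x) <= nrm x.
Proof.
move=> /andP[r0 r1]; have [n xn] := exists_shorter x.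
have zn : shorter n (radial r x) by exact: shorter_mult.
apply: le_of_sqr; first exact: nrm_ge0.
rewrite (nrm_sum xn) (nrm_sum zn).
apply: ler_sum => D _.
rewrite nn_mult// exprMn; apply: ler_piMl; first exact: sqr_ge0.
by apply: exprn_ile1; [exact: exprn_ge0|exact: exprn_ile1].
Qed.

Lemma contr_ge q r x : (4 - q) * 10 ^+ 6 <= 1 -> 0 < r -> r ^+ 2 * (q - 1) <= 1 ->
  nrm x <= 1 -> Lpnorm q (lsum (radial r x)) <= 1.
Proof.
move=> q4 r0 rq x1; have P0 : 0 < q - 1 by lra.
have S0 : 0 < Num.sqrt (q - 1) by rewrite sqrtr_gt0.
have SE : Num.sqrt (q - 1) ^+ 2 = q - 1 by rewrite sqr_sqrtr// ltW.
have rE : r = (Num.sqrt (q - 1))^-1 * (r * Num.sqrt (q - 1)).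
  by rewrite mulrCA mulVf ?mulr1// gt_eqF.
rewrite rE -mult_mult; apply: contr_all => //; first by rewrite invr_gt0.
  by rewrite exprVn SE mulVf// gt_eqF.
apply: le_trans x1; apply: nrm_mult_le; apply/andP; split; first by apply: mulr_ge0; exact: ltW.
apply: le_of_sqr => //.
by rewrite exprMn SE expr1n.
Qed.

End Doubling.

(** * Necessity *)

Section Necessity.
Variables (R : realType) (I : choiceType) (i : I).
Local Notation F := (freegroup I).
Local Notation A := (grpalg R F).
Local Notation l2 := (l2 R F).
Local Notation dl := (delta R (1%g : F)).
Implicit Types (f h : l2) (al be c r p : R).

Definition fgen : F := @FreeGroup I [:: (i, true)] isT.

Lemma gen_neq1 : fgen != 1%g. Proof. by []. Qed.
Lemma genV_neq1 : (fgen^-1)%g != 1%g. Proof. by []. Qed.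
Lemma gen_neqV : fgen != (fgen^-1)%g.
Proof. by apply/eqP => /(congr1 (@fgword I)). Qed.

Definition genop f : l2 := lreg R fgen f + lreg R (fgen^-1)%g f.

Lemma l2norm_lreg (g : F) f : l2norm (lreg R g f) = l2norm f.
Proof. by rewrite /l2norm /= l2sq_lreg. Qed.

Lemma genop_norm f : l2norm (genop f) <= 2 * l2norm f.
Proof. by apply: le_trans (l2norm_triangle _ _) _; rewrite !l2norm_lreg mulr2n mulrDl mul1r. Qed.

Lemma genop_sym f h : ip (genop f) h = ip f (genop h).
Proof. by rewrite ipDl ipDr !ip_lreg invgK addrC. Qed.

Lemma genopD f h : genop (f + h) = genop f + genop h.
Proof. by rewrite /genop !linearD /= addrACA. Qed.

Lemma genopZ (c : R[i]) f : genop (c *: f) = c *: genop f.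
Proof. by rewrite /genop !linearZ /= scalerDr. Qed.

(** A perturbation of the unit that is self-adjoint, so that squares of the operator replace
    [z^* z]; [al ^+ 2 + 2 * be ^+ 2 = 1] normalises it. *)
Definition test_elt al be : A :=
  [fsfun h in [fset 1%g; fgen; (fgen^-1)%g]%fset =>
    if h == 1%g then al%:C%C else be%:C%C].

Lemma sum_three (V : nmodType) (G : F -> V) :
  \sum_(h <- [fset 1%g; fgen; (fgen^-1)%g]%fset) G h = G 1%g + (G fgen + G (fgen^-1)%g).
Proof.
rewrite [[fset 1%g; fgen; _]%fset]fsetUC big_fsetU1 /=; last first.
  by rewrite !inE negb_or genV_neq1 eq_sym gen_neqV.
rewrite [[fset 1%g; fgen]%fset]fsetUC big_fsetU1 /=; last by rewrite !inE gen_neq1.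
by rewrite big_seq_fset1 [RHS]addrA [RHS]addrC [G 1%g + _]addrC.
Qed.

Lemma testE al be (h : F) : test_elt al be h =
  if h == 1%g then al%:C%C else if (h == fgen) || (h == (fgen^-1)%g) then be%:C%C else 0.
Proof.
rewrite fsfunE !inE; case: (h == 1%g) => //=.
Qed.

Lemma lsum_test r al be f :
  lsum (radial r (test_elt al be)) f = al%:C%C *: f + (r * be)%:C%C *: genop f.
Proof.
have S : (finsupp (radial r (test_elt al be)) `<=` [fset 1%g; fgen; (fgen^-1)%g])%fset.
  by apply: fsubset_trans (finsupp_sub _ _ _) _; exact: finsupp_sub.
rewrite (lsum_sub f S) sum_three !multE !testE !eqxx (negbTE gen_neq1) (negbTE genV_neq1) orbT /=.
rewrite fglenV (_ : fglen fgen = 1%N)// expr0 expr1 mul1r -rmorphM /= scalerDr.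
by congr (_ *: _ + _); apply: l2_ext => g; rewrite lregE invg1 mul1g.
Qed.

Lemma nrm_test al be : nrm (test_elt al be) ^+ 2 = al ^+ 2 + 2 * be ^+ 2.
Proof.
have S : (finsupp (test_elt al be) `<=` [fset 1%g; fgen; (fgen^-1)%g])%fset by exact: finsupp_sub.
rewrite (nrm_sqr S) sum_three !testE !eqxx (negbTE gen_neq1) (negbTE genV_neq1) orbT /=.
by rewrite /normsq /= expr0n /= !addr0; ring.
Qed.

Lemma ip_dl f : ip f dl = complex.Re (f 1%g).
Proof.
pose u : A := [fsfun h in [fset (1%g : F)]%fset => 1].
have uE : vec u = dl.
  by apply: l2_ext => g; rewrite vecE fsfunE in_fset1 /=; case: eqP.
have u1 : u 1%g = 1 by rewrite -vecE uE.
rewrite ipC -uE (ip_vec _ (finsupp_sub _ _ _)) big_seq_fset1 u1 mul1r.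
by case: (f 1%g).
Qed.

Lemma deltaE (h : F) : dl h = (h == 1%g)%:R. Proof. by []. Qed.

Lemma genop_moment1 : ip (genop dl) dl = 0.
Proof.
rewrite ip_dl l2D !lregE !deltaE !mulg1 invgK (negbTE gen_neq1) (negbTE genV_neq1).
by rewrite addr0.
Qed.

Lemma genop_moment2 : l2norm (genop dl) ^+ 2 = 2.
Proof.
rewrite -ipff -genop_sym ip_dl !l2D !lregE !l2D !lregE !deltaE invgK !mulg1.
have e1 : (fgen^-1 * fgen^-1 == 1)%g = false.
  by rewrite mulVg_eq1 (negbTE gen_neqV).
have e2 : (fgen * fgen == 1)%g = false.
  by rewrite -[X in (X * _)%g]invgK mulVg_eq1 eq_sym (negbTE gen_neqV).
rewrite mulgV mulVg eqxx e1 e2 /=; ring.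
Qed.

Lemma scaler_binomial (C : comNzRingType) (V : lmodType C) (a c : C) (u v w : V) :
  a *: (a *: u + c *: v) + c *: (a *: v + c *: w) - u =
  (a ^+ 2 - 1) *: u + ((2 * a * c) *: v + c ^+ 2 *: w).
Proof.
rewrite !scalerDr !scalerA (_ : 2 * a * c = a * c + c * a); last by ring.
rewrite !expr2 scalerBl scalerDl scale1r -!addrA; congr (_ + _).
by rewrite [RHS]addrC -!addrA.
Qed.

Section Operator.
Variables (r al be : R).
Hypotheses (r01 : 0 <= r <= 1) (al01 : 0 <= al <= 1) (be01 : 0 <= be <= 1)
  (abe : al ^+ 2 + 2 * be ^+ 2 = 1).
Let z := radial r (test_elt al be).
Let y := conv (star z) z.
Let B f : l2 := lsum y f - f.

Lemma test_sym f h : ip (lsum z f) h = ip f (lsum z h).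
Proof. by rewrite !lsum_test ipDl ipDr !ipZl !ipZr genop_sym. Qed.

Lemma test_square f : B f = (- (2 * be ^+ 2))%:C%C *: f +
  ((2 * al * (r * be))%:C%C *: genop f + ((r * be) ^+ 2)%:C%C *: genop (genop f)).
Proof.
rewrite /B lsum_conv (_ : lsum (star z) _ = lsum z (lsum z f)); last first.
  by apply: ip_ext => k; rewrite -ip_lsum test_sym.
rewrite !lsum_test genopD !genopZ.
rewrite (_ : - (2 * be ^+ 2) = al ^+ 2 - 1); last by move: abe; lra.
by rewrite scaler_binomial rmorphB !rmorphXn !rmorphM rmorph1 rmorph_nat.
Qed.

(** [genop] has norm at most 2, so the three terms contribute [2 + 4 + 4]. *)
Lemma test_sub_norm f : l2norm (B f) <= 10 * be * l2norm f.
Proof.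
rewrite test_square.
move: r01 al01 be01 => /andP[r0 r1] /andP[a0 a1] /andP[b0 b1].
have rb0 : 0 <= r * be by exact: mulr_ge0.
have rb : r * be <= be by exact: ler_piMl.
have n0 := l2norm_ge0 f; have n1 := genop_norm f; have n2 := genop_norm (genop f).
apply: le_trans (l2norm_triangle _ _) _.
apply: le_trans (lerD (lexx _) (l2norm_triangle _ _)) _.
rewrite !l2normZr normrN !ger0_norm ?sqr_ge0 ?mulr_ge0 ?sqr_ge0//.
have h1 : be ^+ 2 * l2norm f <= be * l2norm f.
  by apply: ler_wpM2r => //; rewrite expr2; exact: ler_piMl.
have h2 : 2 * al * (r * be) * l2norm (genop f) <= 2 * be * (2 * l2norm f).
  apply: ler_pM => //; [by rewrite !mulr_ge0|exact: l2norm_ge0|].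
  rewrite -mulrA; apply: ler_wpM2l => //; apply: le_trans (rb); exact: ler_piMl.
have h3 : (r * be) ^+ 2 * l2norm (genop (genop f)) <= be * (2 * (2 * l2norm f)).
  apply: ler_pM; [exact: sqr_ge0|exact: l2norm_ge0| |].
    rewrite expr2; apply: le_trans (rb); apply: ler_piMl => //; exact: le_trans rb b1.
  by apply: le_trans n2 _; apply: ler_wpM2l.
lra.
Qed.

Lemma test_sub_sym f h : ip (B f) h = ip f (B h).
Proof. by rewrite /B ipBl ipBr square_sym. Qed.

Lemma polyop_sub1 k f : polyop (('X - 1) ^+ k) (lsum y) f = iter k B f.
Proof.
elim: k => [|k IH]; first by rewrite expr0 -[1]/(1%:P) polyopC scale1r.
rewrite exprS (polyopM _ _ (lsum y)) IH /= -[1]/(1%:P) -polyCN polyopD polyopX polyopC.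
by rewrite rmorphN scaleNr scale1r.
Qed.

(** Only the first two moments matter at order [be ^+ 2]; the others are of higher order by
    [test_sub_norm]. The error 48 is twice the product of the norm bounds [4 * be] and [6 * be ^+ 2]
    in the cross term. *)
Lemma test_moments :
  [/\ mom y ('X - 1) = - 2 * be ^+ 2 * (1 - r ^+ 2),
      8 * al ^+ 2 * (r * be) ^+ 2 - 48 * be ^+ 3 <= mom y (('X - 1) ^+ 2),
      `|mom y (('X - 1) ^+ 3)| <= (10 * be) ^+ 3 &
      mom y (('X - 1) ^+ 4) <= (10 * be) ^+ 4].
Proof.
move: r01 al01 be01 => /andP[r0 r1] /andP[a0 a1] /andP[b0 b1].
have rb0 : 0 <= r * be by exact: mulr_ge0.
have rb : r * be <= be by exact: ler_piMl.
have d1 : l2norm dl = 1 by exact: l2norm_delta.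
have N1 : l2norm (B dl) <= 10 * be by have := test_sub_norm dl; rewrite d1 mulr1.
have b10 : 0 <= 10 * be by exact: mulr_ge0.
have N2 : l2norm (B (B dl)) <= (10 * be) ^+ 2.
  by apply: le_trans (test_sub_norm _) _; rewrite expr2; exact: ler_wpM2l.
split.
- rewrite -['X - 1]expr1 /mom polyop_sub1 /= test_square !ipDl !ipZl genop_moment1 ip_delta.
  by rewrite genop_sym ipff genop_moment2; ring.
- rewrite /mom polyop_sub1 /= test_sub_sym ipff test_square.
  set u := (2 * al * _)%:C%C *: _; set w1 := _ *: dl; set w2 := _ *: genop (genop dl).
  have -> : w1 + (u + w2) = u + (w1 + w2) by rewrite addrCA.
  have uE : l2norm u ^+ 2 = 8 * al ^+ 2 * (r * be) ^+ 2.
    by rewrite l2normZr exprMn genop_moment2 real_normK ?num_real//; ring.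
  have un : l2norm u <= 4 * be.
    rewrite l2normZr ger0_norm; last by rewrite !mulr_ge0.
    have := genop_norm dl; rewrite d1 mulr1 => g2.
    rewrite (_ : 4 * be = 2 * be * 2); last by ring.
    apply: ler_pM => //; [by rewrite !mulr_ge0|exact: l2norm_ge0|].
    rewrite -mulrA; apply: ler_wpM2l => //; apply: le_trans (rb); exact: ler_piMl.
  have wn : l2norm (w1 + w2) <= 6 * be ^+ 2.
    apply: le_trans (l2norm_triangle _ _) _.
    rewrite !l2normZr normrN !ger0_norm ?sqr_ge0 ?mulr_ge0 ?sqr_ge0// d1 mulr1.
    have := genop_norm (genop dl); have := genop_norm dl; rewrite d1 mulr1 => g1 g2.
    have g4 : l2norm (genop (genop dl)) <= 4 by lra.
    have h : (r * be) ^+ 2 * l2norm (genop (genop dl)) <= be ^+ 2 * 4.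
      by apply: ler_pM => //; [exact: sqr_ge0|exact: l2norm_ge0|apply: lerXn2r; rewrite ?nnegrE].
    lra.
  move: wn; move: (w1 + w2) => w wn; clear w1 w2; rewrite -ipff ipDl !ipDr !ipff uE (ipC w u).
  have cs := cauchy_schwarz u w; have cs2 := ler_norm (- ip u w).
  rewrite normrN in cs2.
  have pr : l2norm u * l2norm w <= 4 * be * (6 * be ^+ 2).
    by apply: ler_pM => //; exact: l2norm_ge0.
  have w0 := sqr_ge0 (l2norm w).
  have e3 : be ^+ 3 = be * be ^+ 2 by ring.
  move: (ip u w) cs cs2 pr w0 => q cs cs2 pr w0; rewrite e3; lra.
- rewrite /mom polyop_sub1 /= test_sub_sym; apply: le_trans (cauchy_schwarz _ _) _.
  by rewrite exprSr; apply: ler_pM => //; exact: l2norm_ge0.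
- rewrite /mom polyop_sub1 /= test_sub_sym test_sub_sym ipff.
  by rewrite (exprM _ 2 2); apply: lerXn2r; rewrite ?nnegrE ?l2norm_ge0 ?sqr_ge0.
Qed.

End Operator.

Lemma necessary p r : 3 / 2 <= p -> 0 < r <= 1 ->
  (forall x : A, nrm x <= 1 -> Lpnorm (2 * p) (lsum (radial r x)) <= 1) ->
  r ^+ 2 * (2 * p - 1) <= 1.
Proof.
move=> p1 /andP[r0 r1] H; rewrite leNgt; apply/negP => th.
set t := r ^+ 2 * (2 * p - 1) - 1; have t0 : 0 < t by rewrite subr_gt0.
(* Divided by [be ^+ 2], the expansion is at least [2 * t - 2 * K * be]: the main terms [- 2 * (1 -
   r ^+ 2) + 4 * (p - 1) * r ^+ 2] equal [2 * t]. *)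
pose K := (p - 1) * (16 + 10 ^+ 3 * p + 10 ^+ 4).
have K0 : 0 < K.
  apply: mulr_gt0; first lra.
  have : 0 <= 10 ^+ 3 * p by apply: mulr_ge0; [exact: exprn_ge0|lra].
  have : 0 <= 10 ^+ 4 :> R by exact: exprn_ge0.
  lra.
(* Small enough for [K * be < t] and [be <= 1 / 2] at once. *)
pose be := t / (2 * (K + t)); have D0 : 0 < 2 * (K + t) by lra.
have beE : be * (2 * (K + t)) = t by rewrite divfK// gt_eqF.
have be0 : 0 < be by exact: divr_gt0.
have be1 : be <= 1 / 2 by rewrite ler_pdivrMr//; lra.
have Kbe : K * be < t by nra.
have be2 : be ^+ 2 <= 1 / 4 by nra.
pose al := Num.sqrt (1 - 2 * be ^+ 2).
have alE : al ^+ 2 = 1 - 2 * be ^+ 2 by rewrite sqr_sqrtr//; lra.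
have al01 : 0 <= al <= 1.
  rewrite sqrtr_ge0 /=; apply: le_of_sqr => //; rewrite alE expr1n.
  by have := sqr_ge0 be; lra.
have be01 : 0 <= be <= 1 by apply/andP; split; lra.
have r01 : 0 <= r <= 1 by rewrite ltW.
have abe : al ^+ 2 + 2 * be ^+ 2 = 1 by rewrite alE; ring.
have x1 : nrm (test_elt al be) <= 1.
  by apply: le_of_sqr => //; rewrite nrm_test abe expr1n.
have L1 := H _ x1.
have [M1 M2 M3 M4] := test_moments r01 al01 be01 abe.
set z := radial r (test_elt al be) in L1 M1 M2 M3 M4.
have q1 : 1 <= 2 * p by lra.
have p0 : 0 <= 2 * p by lra.
have pE : 2 * p / 2 = p by rewrite mulrAC divff ?mul1r// pnatr_eq0.
have [_ [_ [_ [L0 _]]]] := Lpnorm_calc (lsum_adjoint z) q1.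
have Lq := powR_le1_pow L0 p0 L1.
have tay (s : R) : 0 <= s -> (taylor p (- (12^-1))).[s] <= s `^ (2 * p / 2).
  by move=> s0; rewrite pE; exact: taylor_lower_all.
have := le_trans (Lpnorm_ge_poly (lsum_adjoint z) q1 tay) Lq.
clear L1 L0 Lq tay H.
rewrite mom_bcomp /taylor !momD !momZ mom1 M1.
move: (mom _ _) (mom _ _) (mom _ _) M2 M3 M4 => m4 m3 m2 M2 M3 M4.
have [p2 p4] : 0 <= p /\ 0 <= p - 1 by clear -p1; split; lra.
move=> h.
have {}h : p * (- 2 * be ^+ 2 * (1 - r ^+ 2) + (p - 1) * (m2 / 2 + (p - 2) / 6 * m3 - m4 / 12)) <= 0.
  by move: h; clear; lra.
have {}h : - 2 * be ^+ 2 * (1 - r ^+ 2) + (p - 1) * (m2 / 2 + (p - 2) / 6 * m3 - m4 / 12) <= 0.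
  by rewrite pmulr_rle0 in h => //; clear -p1; lra.
have b3 : 0 <= be ^+ 3 by apply: exprn_ge0; exact: ltW.
have m3' : - (p * (10 * be) ^+ 3) <= (p - 2) / 6 * m3.
  rewrite lerNl; apply: le_trans (ler_norm _) _; rewrite normrN normrM.
  by apply: ler_pM => //; rewrite ler_norml; clear -p1; apply/andP; split; lra.
have m4' : m4 / 12 <= 10 ^+ 4 * be ^+ 3.
  have e4 : (10 * be) ^+ 4 = 10 ^+ 4 * (be * be ^+ 3) by rewrite exprMn; ring.
  have e5 : 10 ^+ 4 * (be * be ^+ 3) <= 10 ^+ 4 * be ^+ 3 :> R.
    by apply: ler_wpM2l; [exact: exprn_ge0|apply: ler_piMl => //; clear -be1; lra].
  have e6 : 0 <= 10 ^+ 4 * be ^+ 3 by apply: mulr_ge0 => //; exact: exprn_ge0.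
  by move: M4 e6; rewrite e4; move: e5; clear; lra.
have rb : be ^+ 4 * r ^+ 2 <= be ^+ 3.
  rewrite exprSr -mulrA; apply: ler_piMr => //; case/andP: be01 => u1 u2; case/andP: r01 => u3 u4.
  by apply: mulr_ile1 => //; [exact: sqr_ge0|exact: exprn_ile1].
have b2 : 0 < be ^+ 2 by exact: exprn_gt0.
have low : (p - 1) * (4 * r ^+ 2 * be ^+ 2 - (32 + 10 ^+ 3 * p + 10 ^+ 4) * be ^+ 3) <=
    (p - 1) * (m2 / 2 + (p - 2) / 6 * m3 - m4 / 12).
  apply: ler_wpM2l => //.
  move: M2 m3' m4' rb; rewrite alE; clear -p4; lra.
have fin : 0 < be ^+ 2 * (t - K * be) by apply: mulr_gt0 => //; rewrite subr_gt0.
have q3 : 0 <= (p - 1) * ((10 ^+ 3 * p + 10 ^+ 4) * be ^+ 3).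
  apply: mulr_ge0 => //; apply: mulr_ge0 => //; apply: addr_ge0; last exact: exprn_ge0.
  by apply: mulr_ge0; [exact: exprn_ge0|].
move: fin h low q3; rewrite /t /K; clear; lra.
Qed.

End Necessity.

Lemma PoissonE (R : realType) n (t : R) (x : grpalg R (freegrp n)) :
  Poisson t x = radial (expR (- t)) x.
Proof.
apply/fsfunP => g; rewrite multE fsfunE; case: ifPn => gx.
  by rewrite -expRM_natr mulNr.
by rewrite (fsfun_dflt gx) mulr0.
Qed.

Lemma expR_ge_sqrt (R : realType) (a t : R) : 0 < a ->
  (ln (Num.sqrt a) <= t) = (expR (- t) ^+ 2 * a <= 1).
Proof.
move=> a0; have s0 : 0 < Num.sqrt a by rewrite sqrtr_gt0.
have e0 := expR_gt0 t.
rewrite -ler_expR lnK ?posrE// expRN exprVn mulrC ler_pdivrMr ?exprn_gt0// mul1r.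
by rewrite -[X in _ = (X <= _)](sqr_sqrtr (ltW a0)) ler_pXn2r// nnegrE ltW.
Qed.

Theorem theorem10 (R : realType) :
  exists eps0 : R, 0 < eps0 /\
    forall (n : option nat) (q t : R),
      n <> Some 0%N -> 4 - eps0 <= q -> 0 < t ->
      ((norm2to q (@Poisson R n t) <= 1)%E <-> ln (Num.sqrt (q - 1)) <= t).
Proof.
have e0 : 0 < 10 ^+ 6 :> R by exact: exprn_gt0.
have e1 : 1 <= 10 ^+ 6 :> R by apply: exprn_ege1; rewrite ler1n.
(* The smallness of [2 - p] that [base2] asks for, expressed in [q]. *)
exists (10 ^+ 6)^-1; split=> [|n q t n0 q4 t0]; first by rewrite invr_gt0.
have q6 : (4 - q) * 10 ^+ 6 <= 1 by rewrite -ler_pdivlMr// div1r; lra.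
have i1 : (10 ^+ 6)^-1 <= 1 :> R by rewrite invf_le1.
have q1 : 0 < q - 1 by lra.
rewrite (expR_ge_sqrt t q1).
have r0 := expR_gt0 (- t); have r1 : expR (- t) <= 1 by rewrite -expR0 ler_expR; lra.
split=> [H|H].
  have [i _] : exists i : gens n, True.
    case: n n0 H => [[|m]|] // n0 _; first by exists ord0.
    by exists 0%N.
  have := @necessary R (gens n) i (q / 2) (expR (- t)).
  rewrite (_ : 2 * (q / 2) = q); last by rewrite mulrC divfK// pnatr_eq0.
  apply; [lra|by rewrite r0|] => x x1.
  rewrite -lee_fin -PoissonE; apply: le_trans H; apply: ereal_sup_ubound.
  by exists x => //=; rewrite Lpnorm2.
apply: ge_ereal_sup => _ [x x1 <-]; rewrite lee_fin PoissonE.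
by apply: contr_ge => //; rewrite -Lpnorm2.
Qed.
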